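(* Let $\mathfrak g$ be of classical type, let the alphabet $I=\{1,\dots,n\}$ be ordered by $1<2<\dots<n$, and let $e_\gamma,f_\gamma$ ($\gamma\in\Phi^+$) be the corresponding quantum root vectors of $U_{r,s}(\mathfrak g)$. The Hopf pairing $(\cdot,\cdot)_H$ takes the following values. (1) In type $A_n$ ($\mathfrak g=\mathfrak{sl}_{n+1}$): $(f_{\gamma_{ij}},e_{\gamma_{ij}})_H=\frac1{s-r}$ for $1\le i\le j\le n$. (2) In type $B_n$ ($\mathfrak g=\mathfrak{so}_{2n+1}$): $(f_{\gamma_{ij}},e_{\gamma_{ij}})_H=\frac1{s^2-r^2}$ for $1\le i\le j<n$; $(f_{\gamma_{in}},e_{\gamma_{in}})_H=\frac1{s-r}$ for $1\le i\le n$; $(f_{\beta_{ij}},e_{\beta_{ij}})_H=\frac{[2]_{r,s}^2(rs)^{2(j-n)}}{s^2-r^2}$ for $1\le i<j\le n$. (3) In type $C_n$ ($\mathfrak g=\mathfrak{sp}_{2n}$): $(f_{\gamma_{ij}},e_{\gamma_{ij}})_H=\frac1{s-r}$ for $1\le i\le j\le n$ with $(i,j)\ne(n,n)$; $(f_{\gamma_{nn}},e_{\gamma_{nn}})_H=\frac1{s^2-r^2}$; $(f_{\beta_{ii}},e_{\beta_{ii}})_H=\frac{[2]_{r,s}^2}{s^2-r^2}$ for $1\le i<n$; $(f_{\beta_{ij}},e_{\beta_{ij}})_H=\frac{(rs)^{j-n}}{s-r}$ for $1\le i<j<n$. (4) In type $D_n$ ($\mathfrak g=\mathfrak{so}_{2n}$):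 $(f_{\gamma_{ij}},e_{\gamma_{ij}})_H=\frac1{s-r}$ for $1\le i\le j<n$; $(f_{\beta_{ij}},e_{\beta_{ij}})_H=\frac{(rs)^{j-n}}{s-r}$ for $1\le i<j\le n$.
   Context: Root data and notation for positive roots. Type $A_n$: $\{\varepsilon_i\}_{i=1}^{n+1}$ orthonormal, $\alpha_i=\varepsilon_i-\varepsilon_{i+1}$ ($1\le i\le n$); positive roots $\gamma_{ij}=\alpha_i+\dots+\alpha_j$, $1\le i\le j\le n$. Type $B_n$: $\{\varepsilon_i\}_{i=1}^n$ orthogonal with $(\varepsilon_i,\varepsilon_i)=2$, $\alpha_i=\varepsilon_i-\varepsilon_{i+1}$ ($i<n$), $\alpha_n=\varepsilon_n$; $\gamma_{ij}=\alpha_i+\dots+\alpha_j$ ($1\le i\le j\le n$), $\beta_{ij}=\alpha_i+\dots+\alpha_{j-1}+2\alpha_j+\dots+2\alpha_n$ ($1\le i<j\le n$). Type $C_n$: $\{\varepsilon_i\}_{i=1}^n$ orthonormal, $\alpha_i=\varepsilon_i-\varepsilon_{i+1}$ ($i<n$), $\alpha_n=2\varepsilon_n$; $\gamma_{ij}=\alpha_i+\dots+\alpha_j$ ($1\le i\le j\le n$), $\beta_{ij}=\alpha_i+\dots+\alpha_{j-1}+2\alpha_j+\dots+2\alpha_{n-1}+\alpha_n$ ($1\le i\le j<n$). Type $D_n$: $\{\varepsilon_i\}_{i=1}^n$ orthonormal, $\alpha_i=\varepsilon_i-\varepsilon_{i+1}$ ($i<n$), $\alpha_n=\varepsilon_{n-1}+\varepsilon_n$;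 $\gamma_{ij}=\alpha_i+\dots+\alpha_j$ ($1\le i\le j<n$), $\beta_{in}=\alpha_i+\dots+\alpha_{n-2}+\alpha_n$ ($1\le i<n$), $\beta_{i,n-1}=\alpha_i+\dots+\alpha_n$ ($1\le i<n-1$), $\beta_{ij}=\alpha_i+\dots+\alpha_{j-1}+2\alpha_j+\dots+2\alpha_{n-2}+\alpha_{n-1}+\alpha_n$ ($1\le i<j<n-1$). In each case $a_{ij}=2(\alpha_i,\alpha_j)/(\alpha_i,\alpha_i)$, $d_i=(\alpha_i,\alpha_i)/2$, $Q=\bigoplus\mathbb Z\alpha_i$. Let $\langle\cdot,\cdot\rangle$ be the bilinear form on $Q$ with $\langle\alpha_i,\alpha_j\rangle=d_ia_{ij}$ if $i<j$, $d_i$ if $i=j$, $0$ if $i>j$, except that in type $D_n$ one sets $\langle\alpha_{n-1},\alpha_n\rangle=-1$, $\langle\alpha_n,\alpha_{n-1}\rangle=1$. Let $r,s$ be indeterminates, $r_i=r^{d_i}$, $s_i=s^{d_i}$; $[m]_{a,b}=\frac{a^m-b^m}{a-b}$ (so $[2]_{r,s}=r+s$), $[m]_{a,b}!=\prod_{k=1}^m[k]_{a,b}$, $\begin{bmatrix}m\\k\end{bmatrix}_{a,b}=\frac{[m]_{a,b}!}{[k]_{a,b}![m-k]_{a,b}!}$. For $\lambda,\mu\in Q$ put $(\omega'_\lambda,\omega_\mu)=r^{\langle\lambda,\mu\rangle}s^{-\langle\mu,\lambda\rangle}\in\mathbb C(r,s)$, with index $i$ standing for $\alpha_i$. Quantum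 group. $U_{r,s}(\mathfrak g)$ is the associative $\mathbb C(r,s)$-algebra generated by $e_i,f_i,\omega_i^{\pm1},(\omega_i')^{\pm1}$ ($1\le i\le n$) with relations: the $\omega_i,\omega'_j$ commute and are invertible; $\omega_ie_j=r^{\langle\alpha_j,\alpha_i\rangle}s^{-\langle\alpha_i,\alpha_j\rangle}e_j\omega_i$, $\omega_if_j=r^{-\langle\alpha_j,\alpha_i\rangle}s^{\langle\alpha_i,\alpha_j\rangle}f_j\omega_i$, $\omega'_ie_j=r^{-\langle\alpha_i,\alpha_j\rangle}s^{\langle\alpha_j,\alpha_i\rangle}e_j\omega'_i$, $\omega'_if_j=r^{\langle\alpha_i,\alpha_j\rangle}s^{-\langle\alpha_j,\alpha_i\rangle}f_j\omega'_i$; $e_if_j-f_je_i=\delta_{ij}\frac{\omega_i-\omega'_i}{r_i-s_i}$; and for $i\ne j$, with $c_k=(-1)^k\begin{bmatrix}1-a_{ij}\\k\end{bmatrix}_{r_i,s_i}(r_is_i)^{k(k-1)/2}(rs)^{k\langle\alpha_j,\alpha_i\rangle}$, $\sum_{k=0}^{1-a_{ij}}c_ke_i^{1-a_{ij}-k}e_je_i^k=0$ and $\sum_{k=0}^{1-a_{ij}}c_kf_i^kf_jf_i^{1-a_{ij}-k}=0$. $U^{\ge}_{r,s}$ is the subalgebra generated by $e_i,\omega_i^{\pm1}$ and $U^{\le}_{r,s}$ the one generated by $f_i,(\omega'_i)^{\pm1}$. The coproduct is $\Delta(\omega_i)=\omega_i\otimes\omega_i$, $\Delta(\omega'_i)=\omega'_i\otimes\omega'_i$,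 $\Delta(e_i)=e_i\otimes1+\omega_i\otimes e_i$, $\Delta(f_i)=1\otimes f_i+f_i\otimes\omega'_i$. For $\mu=\sum c_i\alpha_i$, $\omega_\mu=\prod\omega_i^{c_i}$, $\omega'_\mu=\prod(\omega'_i)^{c_i}$. Hopf pairing. $(\cdot,\cdot)_H:U^{\le}_{r,s}\times U^{\ge}_{r,s}\to\mathbb C(r,s)$ is the unique bilinear pairing with $(yy',x)_H=(y\otimes y',\Delta(x))_H$, $(y,xx')_H=(\Delta(y),x'\otimes x)_H$ (where $(y\otimes y',x\otimes x')_H=(y,x)_H(y',x')_H$), $(f_i,\omega_j)_H=0=(\omega'_i,e_i)_H$, $(f_i,e_j)_H=\delta_{ij}\frac1{s_i-r_i}$, $(\omega'_\lambda,\omega_\mu)_H=r^{\langle\lambda,\mu\rangle}s^{-\langle\mu,\lambda\rangle}$. Dominant Lyndon words. Let $\mathcal W$ be the set of words in $I$, $\mathcal F$ the $\mathbb C(r,s)$-vector space with basis $\mathcal W$, graded by $|[i_1\dots i_d]|=\alpha_{i_1}+\dots+\alpha_{i_d}$. The shuffle product $*$ on $\mathcal F$ is defined inductively by $\emptyset*x=x*\emptyset=x$ and $(xi)*(yj)=(x*(yj))i+(\omega'_{|xi|},\omega_j)^{-1}((xi)*y)j$ for $i,j\in I$ and homogeneous $x,y$; it is associative. Let $\mathcal U$ be the subalgebra of $(\mathcal F,* )$ generated by $I$. Order $\mathcal W$ lexicographically (a proper prefix is smaller). A word is dominant if it is the largest word occurring with nonzero coefficient in some nonzero element of $\mathcal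 U$. A nonempty word is Lyndon if it is strictly smaller than each of its proper nonempty right factors (suffixes). $\mathcal L^+$ is the set of dominant Lyndon words. The map $w\mapsto|w|$ is a bijection $\mathcal L^+\to\Phi^+$, with inverse denoted $\ell:\Phi^+\to\mathcal L^+$. The costandard factorization of a Lyndon word $w$ of length $\ge2$ is $w=w_1w_2$ with $w_1,w_2$ nonempty, $w_1$ Lyndon and of maximal possible length; for $w\in\mathcal L^+$ both factors lie in $\mathcal L^+$. Quantum root vectors. $e_{\alpha_i}=e_i$, $f_{\alpha_i}=f_i$, and for non-simple $\gamma\in\Phi^+$, if $\ell(\gamma)=\ell(\alpha)\ell(\beta)$ ($\alpha,\beta\in\Phi^+$) is the costandard factorization, then $e_\gamma=e_\alpha e_\beta-(\omega'_\beta,\omega_\alpha)e_\beta e_\alpha$ and $f_\gamma=f_\beta f_\alpha-(\omega'_\alpha,\omega_\beta)^{-1}f_\alpha f_\beta$. *)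

(* Defs.v *)
From HB Require Import structures.
From mathcomp Require Import all_boot all_order all_algebra.
From mathcomp Require Import boolp classical_sets reals.
From mathcomp.real_closed Require Import complex.
From mathcomp.finmap Require Import finmap.
From mathcomp.multinomials Require Import monalg.

Set Implicit Arguments.
Unset Strict Implicit.
Unset Printing Implicit Defensive.

Import Order.TTheory GRing.Theory Num.Theory.
Local Open Scope ring_scope.
Local Open Scope quotient_scope.

Record proper_ideal (K : fieldType) (A : algType K) := ProperIdeal {
  ideal_pred :> A -> Prop;
  ideal0 : ideal_pred 0;
  idealD : forall x y, ideal_pred x -> ideal_pred y -> ideal_pred (x + y);
  idealMl : forall a x, ideal_pred x -> ideal_pred (a * x);
  idealMr : forall a x, ideal_pred x -> ideal_pred (x * a);
  ideal_proper : ~ ideal_pred 1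
}.

Section QuotientAlgebra.
Variables (K : fieldType) (A : algType K) (J : proper_ideal A).

Definition ideal_mem : {pred A} := fun x => `[< J x >].

Lemma ideal_mem_zmod : zmod_closed ideal_mem.
Proof.
split; first by apply/asboolP/ideal0.
move=> x y /asboolP Jx /asboolP Jy; apply/asboolP/idealD => //.
by rewrite -mulN1r; apply: idealMl.
Qed.
HB.instance Definition _ := GRing.isZmodClosed.Build A ideal_mem ideal_mem_zmod.

Definition quotalg_type : Type := {ideal_quot ideal_mem}.
HB.instance Definition _ := GRing.Zmodule.on quotalg_type.

Definition quotpi (x : A) : quotalg_type := \pi_({ideal_quot ideal_mem}) x.

Lemma quotpi_eq x y : quotpi x = quotpi y <-> J (x - y).
Proof.
split=> [/eqP|Jxy]; last apply/eqP.
  by rewrite -Quotient.idealrBE => /asboolP.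
by rewrite -Quotient.idealrBE; apply/asboolP.
Qed.

Lemma quotpi_surj (x : quotalg_type) : exists a, x = quotpi a.
Proof. by exists (repr x); rewrite /quotpi reprK. Qed.

Lemma quotpi_repr a : J (repr (quotpi a) - a).
Proof. by apply/quotpi_eq; rewrite /quotpi reprK. Qed.

Lemma quotpiD x y : quotpi (x + y) = quotpi x + quotpi y.
Proof. exact: raddfD. Qed.

Definition quot1 : quotalg_type := quotpi 1.
Definition quotM (x y : quotalg_type) : quotalg_type := quotpi (repr x * repr y).
Definition quotZ (c : K) (x : quotalg_type) : quotalg_type := quotpi (c *: repr x).

Lemma quotME a b : quotM (quotpi a) (quotpi b) = quotpi (a * b).
Proof.
apply/quotpi_eq; rewrite -[_ * _](subrK (a * repr (quotpi b))) -mulrBl.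
rewrite -addrA -mulrBr; apply: idealD.
  by apply: idealMr; apply: quotpi_repr.
by apply: idealMl; apply: quotpi_repr.
Qed.

Lemma quotZE c a : quotZ c (quotpi a) = quotpi (c *: a).
Proof.
by apply/quotpi_eq; rewrite -scalerBr -mulr_algl; apply/idealMl/quotpi_repr.
Qed.

Ltac lift x := let a := fresh "a" in
  have [a ->] := quotpi_surj x; clear x.

Lemma quotMA : associative quotM.
Proof. by move=> x y z; lift x; lift y; lift z; rewrite !quotME mulrA. Qed.
Lemma quot1M : left_id quot1 quotM.
Proof. by move=> x; lift x; rewrite quotME mul1r. Qed.
Lemma quotM1 : right_id quot1 quotM.
Proof. by move=> x; lift x; rewrite quotME mulr1. Qed.
Lemma quotMDl : left_distributive quotM +%R.
Proof.
by move=> x y z; lift x; lift y; lift z; rewrite -quotpiD !quotME mulrDl quotpiD.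
Qed.
Lemma quotMDr : right_distributive quotM +%R.
Proof.
by move=> x y z; lift x; lift y; lift z; rewrite -quotpiD !quotME mulrDr quotpiD.
Qed.
Lemma quot1_neq0 : quot1 != 0.
Proof.
apply/eqP; rewrite -[0](raddf0 (\pi_({ideal_quot ideal_mem}))) => /quotpi_eq.
by rewrite subr0; apply: ideal_proper.
Qed.
HB.instance Definition _ := GRing.Zmodule_isNzRing.Build quotalg_type
  quotMA quot1M quotM1 quotMDl quotMDr quot1_neq0.

Lemma quotZA a b x : quotZ a (quotZ b x) = quotZ (a * b) x.
Proof. by lift x; rewrite !quotZE scalerA. Qed.
Lemma quot1Z : left_id 1 quotZ.
Proof. by move=> x; lift x; rewrite quotZE scale1r. Qed.
Lemma quotZDr : right_distributive quotZ +%R.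
Proof. by move=> c x y; lift x; lift y; rewrite -quotpiD !quotZE scalerDr quotpiD. Qed.
Lemma quotZDl x : {morph quotZ^~ x : a b / a + b}.
Proof. by move=> a b /=; lift x; rewrite !quotZE scalerDl quotpiD. Qed.
HB.instance Definition _ := GRing.Zmodule_isLmodule.Build K quotalg_type
  quotZA quot1Z quotZDr quotZDl.

Lemma quotZAl c (x y : quotalg_type) : c *: (x * y) = (c *: x) * y.
Proof.
by lift x; lift y; rewrite /GRing.scale /GRing.mul /= !(quotZE, quotME) scalerAl.
Qed.
HB.instance Definition _ := GRing.Lmodule_isLalgebra.Build K quotalg_type quotZAl.
Lemma quotZAr c (x y : quotalg_type) : c *: (x * y) = x * (c *: y).
Proof.
by lift x; lift y; rewrite /GRing.scale /GRing.mul /= !(quotZE, quotME) scalerAr.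
Qed.
HB.instance Definition _ := GRing.Lalgebra_isAlgebra.Build K quotalg_type quotZAr.

Definition quotalg : algType K := GRing.Algebra.clone K quotalg_type _.

Definition quotproj (x : A) : quotalg := quotpi x.

Lemma quotproj_is_linear : linear quotproj.
Proof. by move=> c x y; rewrite /quotproj quotpiD -quotZE. Qed.
Lemma quotproj_is_monoid_morphism : monoid_morphism quotproj.
Proof. by split=> // x y; rewrite /quotproj -quotME. Qed.
HB.instance Definition _ :=
  GRing.isLinear.Build K A quotalg *:%R quotproj quotproj_is_linear.
HB.instance Definition _ :=
  GRing.isMonoidMorphism.Build A quotalg quotproj quotproj_is_monoid_morphism.

End QuotientAlgebra.

(* The algebra A with the relations x = y imposed whenever rel x y.  The ideal *)
(* is proper as soon as some character eps of A respects the relations.        *)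

Section Presentation.
Variables (K : fieldType) (A : algType K) (rel : A -> A -> Prop).

Inductive ideal_span : A -> Prop :=
| ideal_span_rel x y : rel x y -> ideal_span (x - y)
| ideal_span0 : ideal_span 0
| ideal_spanD x y : ideal_span x -> ideal_span y -> ideal_span (x + y)
| ideal_spanMl a x : ideal_span x -> ideal_span (a * x)
| ideal_spanMr a x : ideal_span x -> ideal_span (x * a).

Variable eps : {lrmorphism A -> K | *%R}.
Hypothesis eps_rel : forall x y, rel x y -> eps x = eps y.

Lemma eps_ideal x : ideal_span x -> eps x = 0.
Proof.
elim=> {x} [x y /eps_rel e||x y _ ex _ ey|a x _ ex|a x _ ex].
- by rewrite rmorphB /= e subrr.
- exact: rmorph0.
- by rewrite rmorphD /= ex ey addr0.
- by rewrite rmorphM /= ex mulr0.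
- by rewrite rmorphM /= ex mul0r.
Qed.

Lemma ideal_span_proper : ~ ideal_span 1.
Proof. by move/eps_ideal/eqP; rewrite rmorph1 oner_eq0. Qed.

Definition span_ideal : proper_ideal A :=
  ProperIdeal ideal_span0 ideal_spanD ideal_spanMl ideal_spanMr ideal_span_proper.

Definition presalg : algType K := quotalg span_ideal.

Definition preproj (x : A) : presalg := quotproj span_ideal x.
HB.instance Definition _ := GRing.LRMorphism.copy preproj (quotproj span_ideal).

Lemma preproj_rel x y : rel x y -> preproj x = preproj y.
Proof. by move=> xy; apply/quotpi_eq/ideal_span_rel. Qed.

End Presentation.

Section FreeAlgebra.
Variables (K : fieldType) (G : choiceType).

Lemma malg_scalerAr c (x y : {malg K[{fmonom G}]}) :
  fgmul (c *: x) y = fgmul x (c *: y).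
Proof.
rewrite (fgmullw (msuppZ_le c x) (fsubset_refl _)).
rewrite (fgmullw (fsubset_refl _) (msuppZ_le c y)).
apply: eq_bigr => k _; apply: eq_bigr => l _.
by rewrite !mcoeffZ mulrCA mulrA.
Qed.

Definition freealg_type : Type := {malg K[{fmonom G}]}.
HB.instance Definition _ := GRing.Lalgebra.on freealg_type.

Lemma freealg_scalerAr c (x y : freealg_type) : c *: (x * y) = x * (c *: y).
Proof. by rewrite scalerAl; apply: malg_scalerAr. Qed.
HB.instance Definition _ := GRing.Lalgebra_isAlgebra.Build K freealg_type freealg_scalerAr.

Definition freealg : algType K := GRing.Algebra.clone K freealg_type _.

Definition fgen (g : G) : freealg := (<< fmu g >> : {malg K[{fmonom G}]}).

Section Character.
Variable h : G -> K.

Let hm (m : {fmonom G}) : K := \prod_(g <- (m : seq G)) h g.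
Lemma freechar_mmorphism : mmorphism hm.
Proof. by split=> [m1 m2|]; rewrite /hm ?fmM ?fm1 ?big_cat ?big_nil. Qed.
HB.instance Definition _ := isMultiplicative.Build {fmonom G} K hm freechar_mmorphism.

Definition freechar : {lrmorphism freealg -> K | *%R} := mmap idfun hm.

Lemma freechar_gen g : freechar (fgen g) = h g.
Proof. by rewrite /freechar /= mmapU mul1r /hm fmU big_seq1. Qed.
End Character.

End FreeAlgebra.

Lemma unit_functional (K : fieldType) (A : algType K) :
  exists2 f : A -> K, linear_for *%R f & f 1 = 1.
Proof.
pose P (W : set A) :=
  (forall c x y, W x -> W y -> W (c *: x + y)) /\ ~ W 1.
have [W [[Wlin W1] Wmax]] : exists W, P W /\ forall B, (W `<` B)%classic -> ~ P B.
  apply: Zorn_bigcup => F FP Ftot; split=> [c x y [X FX Xx] [Y FY Yy]|[X FX X1]].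
    have [XY|YX] := Ftot X Y FX FY.
      by exists Y => //; apply: (FP Y FY).1 => //; apply: XY.
    by exists X => //; apply: (FP X FX).1 => //; apply: YX.
  exact: (FP X FX).2.
have W0 : W 0.
  apply: contrapT => nW0.
  have nW x : ~ W x by move=> Wx; have := Wlin (-1) x x Wx Wx; rewrite scaleN1r addNr.
  apply: (Wmax [set 0]%classic).
    by split=> [x /nW//|/(_ 0 erefl)].
  split=> [c x y /= -> ->|/= /eqP]; first by rewrite scaler0 addr0.
  by rewrite oner_eq0.
have WZ c x : W x -> W (c *: x) by move=> Wx; rewrite -[_ *: _]addr0; apply: Wlin.
have ex x : exists c, W (x - c%:A).
  apply: contrapT => nex; have nW c : ~ W (x - c%:A) by move=> Wc; apply: nex; exists c.
  pose B := [set z | exists c, exists2 w, W w & z = c *: x + w]%classic.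
  apply: (Wmax B).
    split=> [w Ww|BW]; first by exists 0, w; rewrite // scale0r add0r.
    apply: (nW 0); rewrite scale0r subr0; apply: BW.
    by exists 1, 0; rewrite // scale1r addr0.
  split=> [c _ _ [a [v Wv ->]] [b [w Ww ->]]|[c [w Ww e]]].
    exists (c * a + b), (c *: v + w); first exact: Wlin.
    by rewrite scalerDr scalerA scalerDl addrACA.
  have [c0|c0] := eqVneq c 0.
    by apply: W1; rewrite e c0 scale0r add0r.
  apply: (nW c^-1); rewrite e scalerDr scalerA mulVf // scale1r opprD addrA subrr add0r.
  by rewrite -scaleNr; apply: WZ.
have [f fP] := choice ex.
have uniqf x c : W (x - c%:A) -> f x = c.
  move=> Wc; apply/eqP; rewrite -subr_eq0; apply: contraT => nz; case: W1.
  have := Wlin (-1) _ _ (fP x) Wc; rewrite scaleN1r opprB addrA subrK -scalerBl.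
  by move=> /(WZ (f x - c)^-1); rewrite scalerA mulVf // scale1r.
exists f; last by apply: uniqf; rewrite scale1r subrr.
move=> c x y; apply: uniqf.
rewrite scalerDl -scalerA opprD addrACA -scalerBr.
by apply: Wlin.
Qed.

(* The tensor square of A: the list [:: (a1, b1); ...] stands for              *)
(* a1 (x) b1 + ..., two lists being identified when every bilinear map takes   *)
(* the same value on them.                                                     *)

Section TensorSquare.
Variables (K : fieldType) (A : algType K).

Definition tval (V : lmodType K) (phi : A -> A -> V) (l : seq (A * A)) : V :=
  \sum_(p <- l) phi p.1 p.2.

Definition tequiv_prop (l l' : seq (A * A)) : Prop :=
  forall (V : lmodType K) (phi : A -> A -> V),
    bilinear_for *:%R *:%R phi -> tval phi l = tval phi l'.

Definition tequiv (l l' : seq (A * A)) : bool := `[< tequiv_prop l l' >].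

Lemma tequiv_is_equiv : equiv_class_of tequiv.
Proof.
split=> [l|l l'|l l' l''].
- by apply/asboolP.
- by apply/asboolP/asboolP => e V phi bphi; rewrite e.
- by move=> /asboolP e /asboolP e'; apply/asboolP => V phi bphi; rewrite e ?e'.
Qed.
Canonical tequiv_equiv := EquivRelPack tequiv_is_equiv.
Canonical tequiv_encModRel := defaultEncModRel tequiv.

Definition tensor2_type : Type := {eq_quot tequiv}.
HB.instance Definition _ := Choice.on tensor2_type.

Definition tpi (l : seq (A * A)) : tensor2_type := \pi_({eq_quot tequiv}) l.

Lemma tpi_eq l l' : tpi l = tpi l' <-> tequiv_prop l l'.
Proof. by split=> [/eqmodP/asboolP|e] //; apply/eqmodP/asboolP. Qed.

Lemma tpi_surj (x : tensor2_type) : exists l, x = tpi l.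
Proof. by exists (repr x); rewrite /tpi reprK. Qed.

Lemma tpi_repr l : tequiv_prop (repr (tpi l)) l.
Proof. by apply/tpi_eq; rewrite /tpi reprK. Qed.

Definition tpure (a b : A) : tensor2_type := tpi [:: (a, b)].

Lemma tval_cat (V : lmodType K) (phi : A -> A -> V) l l' :
  tval phi (l ++ l') = tval phi l + tval phi l'.
Proof. exact: big_cat. Qed.

Lemma tval_scale (V : lmodType K) (phi : A -> A -> V) c l :
  bilinear_for *:%R *:%R phi ->
  tval phi [seq (c *: p.1, p.2) | p <- l] = c *: tval phi l.
Proof.
move=> [lphi _]; rewrite /tval big_map scaler_sumr; apply: eq_bigr => p _ /=.
have phi0 : phi 0 p.2 = 0.
  by have := lphi p.2 (-1) 0 0; rewrite /= scaler0 addr0 scaleN1r addNr.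
by have := lphi p.2 c p.1 0; rewrite /= phi0 !addr0.
Qed.

Definition tmul (l l' : seq (A * A)) : seq (A * A) :=
  [seq (p.1 * q.1, p.2 * q.2) | p <- l, q <- l'].

Lemma tval_mul (V : lmodType K) (phi : A -> A -> V) l l' :
  tval phi (tmul l l') =
  \sum_(p <- l) \sum_(q <- l') phi (p.1 * q.1) (p.2 * q.2).
Proof. by rewrite /tval big_allpairs_dep. Qed.

Lemma tmull l1 l2 l :
  tequiv_prop l1 l2 -> tequiv_prop (tmul l1 l) (tmul l2 l).
Proof.
move=> e V phi [lphi rphi]; rewrite !tval_mul.
apply: (e V (fun a b => \sum_(q <- l) phi (a * q.1) (b * q.2))).
split=> [b|a] c x y /=; rewrite scaler_sumr -big_split; apply: eq_bigr => q _ /=.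
  by rewrite mulrDl -scalerAl; apply: lphi.
by rewrite mulrDl -scalerAl; apply: rphi.
Qed.

Lemma tmulr l l1 l2 :
  tequiv_prop l1 l2 -> tequiv_prop (tmul l l1) (tmul l l2).
Proof.
move=> e V phi [lphi rphi].
rewrite !tval_mul exchange_big [RHS]exchange_big /=.
apply: (e V (fun a b => \sum_(p <- l) phi (p.1 * a) (p.2 * b))).
split=> [b|a] c x y /=; rewrite scaler_sumr -big_split; apply: eq_bigr => q _ /=.
  by rewrite mulrDr -scalerAr; apply: lphi.
by rewrite mulrDr -scalerAr; apply: rphi.
Qed.

Definition tD (x y : tensor2_type) : tensor2_type := tpi (repr x ++ repr y).
Definition tZ (c : K) (x : tensor2_type) : tensor2_type :=
  tpi [seq (c *: p.1, p.2) | p <- repr x].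
Definition tM (x y : tensor2_type) : tensor2_type := tpi (tmul (repr x) (repr y)).
Definition t0 : tensor2_type := tpi [::].
Definition t1 : tensor2_type := tpure 1 1.
Definition tN (x : tensor2_type) : tensor2_type := tZ (-1) x.

Lemma tDE l l' : tD (tpi l) (tpi l') = tpi (l ++ l').
Proof.
by apply/tpi_eq => V phi bphi; rewrite !tval_cat !(tpi_repr _ bphi).
Qed.
Lemma tZE c l : tZ c (tpi l) = tpi [seq (c *: p.1, p.2) | p <- l].
Proof.
by apply/tpi_eq => V phi bphi; rewrite !tval_scale // (tpi_repr _ bphi).
Qed.
Lemma tME l l' : tM (tpi l) (tpi l') = tpi (tmul l l').
Proof.
apply/tpi_eq => V phi bphi.
rewrite (tmull (repr (tpi l')) (@tpi_repr l) bphi).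
exact: tmulr (@tpi_repr l') V phi bphi.
Qed.

Ltac tlift x := let l := fresh "l" in have [l ->] := tpi_surj x; clear x.

Lemma tDA : associative tD.
Proof. by move=> x y z; tlift x; tlift y; tlift z; rewrite !tDE catA. Qed.
Lemma tDC : commutative tD.
Proof.
move=> x y; tlift x; tlift y; rewrite !tDE.
by apply/tpi_eq => V phi bphi; rewrite !tval_cat addrC.
Qed.
Lemma t0D : left_id t0 tD.
Proof. by move=> x; tlift x; rewrite tDE. Qed.
Lemma tND : left_inverse t0 tN tD.
Proof.
move=> x; tlift x; rewrite /tN tZE tDE; apply/tpi_eq => V phi bphi.
by rewrite tval_cat tval_scale // scaleN1r addNr /tval big_nil.
Qed.
HB.instance Definition _ := GRing.isZmodule.Build tensor2_type tDA tDC t0D tND.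

Lemma tMA : associative tM.
Proof.
move=> x y z; tlift x; tlift y; tlift z; rewrite !tME.
apply/tpi_eq => V phi bphi; rewrite !tval_mul big_allpairs_dep /=.
apply: eq_bigr => p _; rewrite big_allpairs_dep; apply: eq_bigr => q _ /=.
by apply: eq_bigr => o _; rewrite !mulrA.
Qed.
Lemma t1M : left_id t1 tM.
Proof.
move=> x; tlift x; rewrite tME; apply/tpi_eq => V phi bphi.
by rewrite tval_mul big_seq1; apply: eq_bigr => p _; rewrite !mul1r.
Qed.
Lemma tM1 : right_id t1 tM.
Proof.
move=> x; tlift x; rewrite tME; apply/tpi_eq => V phi bphi.
by rewrite tval_mul; apply: eq_bigr => p _; rewrite big_seq1 !mulr1.
Qed.
Lemma tMDl : left_distributive tM +%R.
Proof.
move=> x y z; rewrite /GRing.add /=; tlift x; tlift y; tlift z.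
rewrite tDE !tME tDE; apply/tpi_eq => V phi bphi.
by rewrite tval_cat !tval_mul big_cat.
Qed.
Lemma tMDr : right_distributive tM +%R.
Proof.
move=> x y z; rewrite /GRing.add /=; tlift x; tlift y; tlift z.
rewrite tDE !tME tDE; apply/tpi_eq => V phi bphi.
by rewrite tval_cat !tval_mul -big_split; apply: eq_bigr => p _; rewrite big_cat.
Qed.
Lemma t1_neq0 : t1 != 0.
Proof.
apply/eqP; rewrite /GRing.zero /= => /tpi_eq e.
have [f flin f1] := unit_functional A.
have /e : bilinear_for *:%R *:%R (fun a b : A => f a * f b : K^o).
  split=> [b|a] c x y /=; rewrite flin /=.
    by rewrite mulrDl -mulrA.
  by rewrite mulrDr mulrCA.
rewrite /tval big_seq1 big_nil f1 mulr1 => /eqP.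
by rewrite oner_eq0.
Qed.
HB.instance Definition _ := GRing.Zmodule_isNzRing.Build tensor2_type
  tMA t1M tM1 tMDl tMDr t1_neq0.

Lemma tZA a b x : tZ a (tZ b x) = tZ (a * b) x.
Proof.
tlift x; rewrite !tZE; apply/tpi_eq => V phi bphi.
by rewrite !tval_scale // scalerA.
Qed.
Lemma t1Z : left_id 1 tZ.
Proof.
move=> x; tlift x; rewrite !tZE; apply/tpi_eq => V phi bphi.
by rewrite !tval_scale // scale1r.
Qed.
Lemma tZDr : right_distributive tZ +%R.
Proof.
move=> c x y; rewrite /GRing.add /=; tlift x; tlift y.
rewrite tDE !tZE tDE; apply/tpi_eq => V phi bphi.
by rewrite tval_cat !tval_scale // tval_cat scalerDr.
Qed.
Lemma tZDl x : {morph tZ^~ x : a b / a + b}.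
Proof.
move=> a b; rewrite [RHS]/GRing.add /=; tlift x.
rewrite !tZE tDE; apply/tpi_eq => V phi bphi.
by rewrite tval_cat !tval_scale // scalerDl.
Qed.
HB.instance Definition _ := GRing.Zmodule_isLmodule.Build K tensor2_type
  tZA t1Z tZDr tZDl.

Lemma tZAl c (x y : tensor2_type) : c *: (x * y) = (c *: x) * y.
Proof.
rewrite /GRing.scale /GRing.mul /=; tlift x; tlift y; rewrite !(tME, tZE).
apply/tpi_eq => V phi bphi; congr (tval phi).
rewrite /tmul map_allpairs allpairs_mapl.
by apply: eq_allpairs => p q /=; rewrite scalerAl.
Qed.
HB.instance Definition _ := GRing.Lmodule_isLalgebra.Build K tensor2_type tZAl.
Lemma tZAr c (x y : tensor2_type) : c *: (x * y) = x * (c *: y).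
Proof.
rewrite /GRing.scale /GRing.mul /=; tlift x; tlift y; rewrite !(tME, tZE).
apply/tpi_eq => V phi bphi; congr (tval phi).
rewrite /tmul map_allpairs allpairs_mapr.
by apply: eq_allpairs => p q /=; rewrite scalerAr.
Qed.
HB.instance Definition _ := GRing.Lalgebra_isAlgebra.Build K tensor2_type tZAr.

Definition tensor2 : algType K := GRing.Algebra.clone K tensor2_type _.

Definition tens (a b : A) : tensor2 := tpure a b.

Lemma tens_bilinear : bilinear_for *:%R *:%R tens.
Proof.
split=> [b|a] c x y /=; rewrite [in RHS]/GRing.scale [in RHS]/GRing.add /= tZE tDE;
  apply/tpi_eq => V phi bphi; have [lphi rphi] := bphi;
  by rewrite tval_cat tval_scale // /tval !big_seq1 /= (lphi, rphi).
Qed.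

Lemma tens_mul a b c d : tens a b * tens c d = tens (a * c) (b * d).
Proof. by rewrite /GRing.mul /= tME. Qed.

Lemma tpi_sum l : tpi l = \sum_(p <- l) tens p.1 p.2.
Proof.
elim: l => [|p l IH]; first by rewrite big_nil.
by rewrite big_cons -IH [RHS]/GRing.add /= tDE -surjective_pairing.
Qed.

End TensorSquare.

(* Root data.  Simple roots are numbered 1, ..., n, so that the letter or      *)
(* index i : 'I_n carries the simple root i.+1.                                *)

Variant cltype := TypeA | TypeB | TypeC | TypeD.

Section RootData.
Variables (t : cltype) (n : nat).

(* Coordinates with respect to eps_1, ..., eps_(n+1); the last one is used in  *)
(* type A only.                                                                *)
Definition epsv (i : nat) : 'rV[int]_n.+1 := \row_m (m.+1 == i)%:R.

Definition simple_vec (i : nat) : 'rV[int]_n.+1 :=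
  match t with
  | TypeA => epsv i - epsv i.+1
  | TypeB => if (i < n)%N then epsv i - epsv i.+1 else epsv n
  | TypeC => if (i < n)%N then epsv i - epsv i.+1 else epsv n *+ 2
  | TypeD => if (i < n)%N then epsv i - epsv i.+1 else epsv n.-1 + epsv n
  end.

Definition inner (u v : 'rV[int]_n.+1) : int :=
  (if t is TypeB then 2 else 1) * \sum_m u 0 m * v 0 m.

Definition simple_inner (i j : nat) : int := inner (simple_vec i) (simple_vec j).

(* Both divisions are exact. *)
Definition cartan (i j : nat) : int :=
  ((2 * simple_inner i j) %/ simple_inner i i)%Z.
Definition symd (i : nat) : int := (simple_inner i i %/ 2)%Z.

Definition simple_form (i j : nat) : int :=
  if (if t is TypeD then (i == n.-1) && (j == n) else false) then -1
  else if (if t is TypeD then (i == n) && (j == n.-1) else false) then 1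
  else if (i < j)%N then symd i * cartan i j
  else if i == j then symd i
  else 0.

(* The root lattice Q, in the basis of simple roots. *)
Definition alpha (i : nat) : 'rV[int]_n := \row_m (m.+1 == i)%:R.

Definition form (lambda mu : 'rV[int]_n) : int :=
  \sum_(i < n) \sum_(j < n) lambda 0 i * mu 0 j * simple_form i.+1 j.+1.

Definition gammar (i j : nat) : 'rV[int]_n := \sum_(i <= k < j.+1) alpha k.

Definition betar (i j : nat) : 'rV[int]_n :=
  match t with
  | TypeA => 0
  | TypeB => \sum_(i <= k < j) alpha k + \sum_(j <= k < n.+1) alpha k *+ 2
  | TypeC =>
      \sum_(i <= k < j) alpha k + \sum_(j <= k < n) alpha k *+ 2 + alpha n
  | TypeD =>
      if j == n then \sum_(i <= k < n.-1) alpha k + alpha n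
      else if j == n.-1 then \sum_(i <= k < n.+1) alpha k
      else \sum_(i <= k < j) alpha k + \sum_(j <= k < n.-1) alpha k *+ 2
           + alpha n.-1 + alpha n
  end.

Definition is_gamma (i j : nat) : bool :=
  (1 <= i)%N && (i <= j)%N && (if t is TypeD then j < n else j <= n)%N.

Definition is_beta (i j : nat) : bool :=
  match t with
  | TypeA => false
  | TypeB | TypeD => (1 <= i)%N && (i < j)%N && (j <= n)%N
  | TypeC => (1 <= i)%N && (i <= j)%N && (j < n)%N
  end.

Definition posroot (v : 'rV[int]_n) : Prop :=
  (exists i j, is_gamma i j /\ v = gammar i j) \/
  (exists i j, is_beta i j /\ v = betar i j).

End RootData.

Section QuantumNumbers.
Variable K : fieldType.

Definition qint (a b : K) (m : nat) : K := (a ^+ m - b ^+ m) / (a - b).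
Definition qfact (a b : K) (m : nat) : K := \prod_(1 <= k < m.+1) qint a b k.
Definition qbinom (a b : K) (m k : nat) : K :=
  qfact a b m / (qfact a b k * qfact a b (m - k)).

End QuantumNumbers.

Section Generators.
Variable n : nat.

(* A family of elements of A named as the generators of U_{r,s}. *)
Record gensys (K : fieldType) (A : algType K) := GenSys {
  ge : 'I_n -> A;
  gf : 'I_n -> A;
  gw : 'I_n -> A;
  gwinv : 'I_n -> A;
  gw' : 'I_n -> A;
  gw'inv : 'I_n -> A
}.

Variant ugen := GenE of 'I_n | GenF of 'I_n | GenW of 'I_n | GenWinv of 'I_n
  | GenW' of 'I_n | GenW'inv of 'I_n.

Definition ugen_code (g : ugen) : nat * 'I_n :=
  match g with
  | GenE i => (0%N, i) | GenF i => (1%N, i) | GenW i => (2%N, i)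
  | GenWinv i => (3%N, i) | GenW' i => (4%N, i) | GenW'inv i => (5%N, i)
  end.
Definition ugen_decode (c : nat * 'I_n) : ugen :=
  match c.1 with
  | 0%N => GenE c.2 | 1%N => GenF c.2 | 2%N => GenW c.2
  | 3%N => GenWinv c.2 | 4%N => GenW' c.2 | _ => GenW'inv c.2
  end.
Lemma ugen_codeK : cancel ugen_code ugen_decode. Proof. by case. Qed.
HB.instance Definition _ := Choice.copy ugen (can_type ugen_codeK).
Definition ugent : choiceType := Choice.clone ugen _.

Definition free_gens (K : fieldType) : gensys (freealg K ugent) :=
  GenSys (fun i => @fgen K ugent (GenE i)) (fun i => @fgen K ugent (GenF i))
    (fun i => @fgen K ugent (GenW i)) (fun i => @fgen K ugent (GenWinv i))
    (fun i => @fgen K ugent (GenW' i)) (fun i => @fgen K ugent (GenW'inv i)).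

Definition map_gens (K : fieldType) (A B : algType K) (h : A -> B)
    (g : gensys A) : gensys B :=
  GenSys (fun i => h (ge g i)) (fun i => h (gf g i)) (fun i => h (gw g i))
    (fun i => h (gwinv g i)) (fun i => h (gw' g i)) (fun i => h (gw'inv g i)).

End Generators.

Section QuantumGroup.
Variables (K : fieldType) (r s : K) (t : cltype) (n : nat).

Definition rspow (a b : int) : K := r ^ a * s ^ b.

(* (omega'_lambda, omega_mu) *)
Definition chi (lambda mu : 'rV[int]_n) : K :=
  rspow (form t lambda mu) (- form t mu lambda).

Definition r_ (i : 'I_n) : K := r ^ symd t n i.+1.
Definition s_ (i : 'I_n) : K := s ^ symd t n i.+1.

Definition aform (i j : 'I_n) : int := form t (alpha n i.+1) (alpha n j.+1).

Definition serre_deg (i j : 'I_n) : nat := `|1 - cartan t n i.+1 j.+1|%N.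

Definition serre_coef (i j : 'I_n) (k : nat) : K :=
  (-1) ^+ k * qbinom (r_ i) (s_ i) (serre_deg i j) k
  * (r_ i * s_ i) ^+ (k * k.-1)./2 * (r * s) ^ (k%:Z * aform j i).

Section Relations.
Variables (A : algType K) (g : gensys n A).

Local Notation e := (ge g).
Local Notation f := (gf g).
Local Notation w := (gw g).
Local Notation winv := (gwinv g).
Local Notation w' := (gw' g).
Local Notation w'inv := (gw'inv g).

(* urel x y : the defining relation x = y *)
Inductive urel : A -> A -> Prop :=
| rel_ww i j : urel (w i * w j) (w j * w i)
| rel_ww' i j : urel (w i * w' j) (w' j * w i)
| rel_w'w' i j : urel (w' i * w' j) (w' j * w' i)
| rel_wV i : urel (w i * winv i) 1
| rel_Vw i : urel (winv i * w i) 1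
| rel_w'V i : urel (w' i * w'inv i) 1
| rel_Vw' i : urel (w'inv i * w' i) 1
| rel_we i j : urel (w i * e j) (rspow (aform j i) (- aform i j) *: (e j * w i))
| rel_wf i j : urel (w i * f j) (rspow (- aform j i) (aform i j) *: (f j * w i))
| rel_w'e i j :
    urel (w' i * e j) (rspow (- aform i j) (aform j i) *: (e j * w' i))
| rel_w'f i j :
    urel (w' i * f j) (rspow (aform i j) (- aform j i) *: (f j * w' i))
| rel_ef i j : i != j -> urel (e i * f j - f j * e i) 0
| rel_efii i :
    urel (e i * f i - f i * e i) ((r_ i - s_ i)^-1 *: (w i - w' i))
| rel_serre_e i j : i != j ->
    urel (\sum_(k < (serre_deg i j).+1)
            serre_coef i j k *: (e i ^+ (serre_deg i j - k) * e j * e i ^+ k)) 0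
| rel_serre_f i j : i != j ->
    urel (\sum_(k < (serre_deg i j).+1)
            serre_coef i j k *: (f i ^+ k * f j * f i ^+ (serre_deg i j - k))) 0.

Lemma urel_character (h : {lrmorphism A -> K | *%R}) :
    (forall i, [/\ h (e i) = 0 /\ h (f i) = 0, h (w i) = 1, h (winv i) = 1,
                   h (w' i) = 1 & h (w'inv i) = 1]) ->
  forall x y, urel x y -> h x = h y.
Proof.
move=> H x y.
have hM u v : h (u * v) = h u * h v by exact: rmorphM.
have hB u v : h (u - v) = h u - h v by exact: rmorphB.
have hZ c u : h (c *: u) = c * h u by exact: linearZ.
have h1 : h 1 = 1 by exact: rmorph1.
have h0 : h 0 = 0 by exact: rmorph0.
have serre0 m (c : 'I_m -> K) a z b : h z = 0 ->
    h (\sum_k c k *: (a k * z * b k)) = 0.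
  move=> z0; rewrite rmorph_sum big1 // => k _.
  by rewrite [LHS]hZ !hM z0 mulr0 mul0r mulr0.
case=> [i j|i j|i j|i|i|i|i|i j|i j|i j|i j|i j _|i|i j _|i j _];
  have [[ei fi] wi vi wi' vi'] := H i; try have [[ej fj] wj vj wj' vj'] := H j.
- by rewrite !hM wi wj.
- by rewrite !hM wi wj'.
- by rewrite !hM wi' wj'.
- by rewrite hM wi vi h1 mulr1.
- by rewrite hM wi vi h1 mulr1.
- by rewrite hM wi' vi' h1 mulr1.
- by rewrite hM wi' vi' h1 mulr1.
- by rewrite hM hZ hM ej !(mulr0, mul0r).
- by rewrite hM hZ hM fj !(mulr0, mul0r).
- by rewrite hM hZ hM ej !(mulr0, mul0r).
- by rewrite hM hZ hM fj !(mulr0, mul0r).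
- by rewrite hB !hM ei fj h0 mulr0 subrr.
- by rewrite hB hZ hB !hM ei fi wi wi' mulr0 !subrr mulr0.
- by rewrite h0; apply: serre0.
- by rewrite h0; apply: serre0.
Qed.

End Relations.

Lemma urel_map (A B : algType K) (h : {lrmorphism A -> B}) (g : gensys n A) x y :
  urel (map_gens h g) x y ->
  exists x' y', [/\ urel g x' y', x = h x' & y = h y'].
Proof.
have hM u v : h u * h v = h (u * v) by rewrite rmorphM.
have hB u v : h u - h v = h (u - v) by rewrite rmorphB.
have hZ c u : c *: h u = h (c *: u) by rewrite linearZ.
have h1 : 1 = h 1 by rewrite rmorph1.
have h0 : 0 = h 0 by rewrite rmorph0.
have hS m (c : 'I_m -> K) a z b a' b' :
    (forall k, a k = h (a' k)) -> (forall k, b k = h (b' k)) ->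
    \sum_k c k *: (a k * h z * b k) = h (\sum_k c k *: (a' k * z * b' k)).
  move=> ea eb; rewrite rmorph_sum; apply: eq_bigr => k _.
  by rewrite /= ea eb hM hM hZ.
case=> [i j|i j|i j|i|i|i|i|i j|i j|i j|i j|i j ij|i|i j ij|i j ij];
  try by rewrite /= ?(hM, hB, hZ, h1) ?h0;
    do 2!eexists; split; [|reflexivity|reflexivity]; constructor.
- exists (\sum_(k < (serre_deg i j).+1) serre_coef i j k *:
            (ge g i ^+ (serre_deg i j - k) * ge g j * ge g i ^+ k)), 0.
  by split=> //; [constructor|apply: hS => k; rewrite rmorphXn].
- exists (\sum_(k < (serre_deg i j).+1) serre_coef i j k *:
            (gf g i ^+ k * gf g j * gf g i ^+ (serre_deg i j - k))), 0.
  by split=> //; [constructor|apply: hS => k; rewrite rmorphXn].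
Qed.

Definition ucounit_gen (g : ugent n) : K :=
  match g with GenE _ | GenF _ => 0 | _ => 1 end.

Lemma ucounit_rel x y :
  urel (free_gens n K) x y -> freechar ucounit_gen x = freechar ucounit_gen y.
Proof. by apply: urel_character => i; split; [split|..]; apply: freechar_gen. Qed.

Definition Uq : algType K := presalg ucounit_rel.

Definition Ugens : gensys n Uq := map_gens (preproj ucounit_rel) (free_gens n K).

Lemma Uq_rel x y : urel Ugens x y -> x = y.
Proof.
by move=> /urel_map[x' [y' [xy -> ->]]]; apply: preproj_rel.
Qed.

Section HopfPairing.
Variables (A : algType K) (g : gensys n A).

(* x ^ m for an integer m, where y is the inverse of x *)
Definition intpow (x y : A) (m : int) : A :=
  match m with Posz k => x ^+ k | Negz k => y ^+ k.+1 end.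

Definition omega (mu : 'rV[int]_n) : A :=
  \prod_(i < n) intpow (gw g i) (gwinv g i) (mu 0 i).
Definition omega' (mu : 'rV[int]_n) : A :=
  \prod_(i < n) intpow (gw' g i) (gw'inv g i) (mu 0 i).

Inductive subalg_gen (S : A -> Prop) : A -> Prop :=
| subalg_in x : S x -> subalg_gen S x
| subalg1 : subalg_gen S 1
| subalgD x y : subalg_gen S x -> subalg_gen S y -> subalg_gen S (x + y)
| subalgZ c x : subalg_gen S x -> subalg_gen S (c *: x)
| subalgM x y : subalg_gen S x -> subalg_gen S y -> subalg_gen S (x * y).

Definition Uge : A -> Prop :=
  subalg_gen (fun x => exists i, [\/ x = ge g i, x = gw g i | x = gwinv g i]).
Definition Ule : A -> Prop :=
  subalg_gen (fun x => exists i, [\/ x = gf g i, x = gw' g i | x = gw'inv g i]).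

Definition coproduct (Delta : {lrmorphism A -> tensor2 A}) : Prop :=
  forall i, [/\ Delta (gw g i) = tens (gw g i) (gw g i),
                Delta (gw' g i) = tens (gw' g i) (gw' g i),
                Delta (ge g i) = tens (ge g i) 1 + tens (gw g i) (ge g i) &
                Delta (gf g i) = tens 1 (gf g i) + tens (gf g i) (gw' g i)].

(* The pairing is only constrained on Ule x Uge.  In hopf_mull and hopf_mulr   *)
(* the right-hand sides are (y (x) y', Delta x) and (Delta y, x' (x) x),       *)
(* computed on any expansion of the coproduct inside the relevant subalgebra.  *)
Record hopf_pairing (Delta : {lrmorphism A -> tensor2 A})
    (B : A -> A -> K) : Prop := HopfPairing {
  hopf_linl : forall c y y' x, Ule y -> Ule y' -> Uge x ->
    B (c *: y + y') x = c * B y x + B y' x;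
  hopf_linr : forall c y x x', Ule y -> Uge x -> Uge x' ->
    B y (c *: x + x') = c * B y x + B y x';
  hopf_mull : forall y y' x (l : seq (A * A)), Ule y -> Ule y' -> Uge x ->
    (forall p, p \in l -> Uge p.1 /\ Uge p.2) ->
    Delta x = \sum_(p <- l) tens p.1 p.2 ->
    B (y * y') x = \sum_(p <- l) B y p.1 * B y' p.2;
  hopf_mulr : forall y x x' (l : seq (A * A)), Ule y -> Uge x -> Uge x' ->
    (forall p, p \in l -> Ule p.1 /\ Ule p.2) ->
    Delta y = \sum_(p <- l) tens p.1 p.2 ->
    B y (x * x') = \sum_(p <- l) B p.1 x' * B p.2 x;
  hopf_fw : forall i j, B (gf g i) (gw g j) = 0;
  hopf_w'e : forall i, B (gw' g i) (ge g i) = 0;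
  hopf_fe : forall i j, B (gf g i) (ge g j) = (i == j)%:R / (s_ i - r_ i);
  hopf_w'w : forall lambda mu, B (omega' lambda) (omega mu) = chi lambda mu
}.

End HopfPairing.

Definition word : Type := seq 'I_n.
HB.instance Definition _ := Choice.on word.

Definition wt (u : word) : 'rV[int]_n := \sum_(i <- u) alpha n i.+1.

Definition wordlt (u v : word) : bool :=
  ((u : seqlexi 'I_n) < (v : seqlexi 'I_n))%O.

(* The space with basis the words; <<c *g u>> is c times the basis vector u. *)
Definition shuf : Type := {malg K[word]}.
HB.instance Definition _ := GRing.Lmodule.on shuf.

Definition wbasis (u : word) : shuf := << u >>.

(* x |-> xi *)
Definition append (i : 'I_n) (x : shuf) : shuf :=
  \sum_(u <- msupp x) x@_u *: wbasis (rcons u i).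

(* Shuffle product of rev u and rev v: the recursion strips the last letters. *)
Fixpoint shuffle_rev (u : word) : word -> shuf :=
  fix aux (v : word) : shuf :=
    match u, v with
    | [::], _ => wbasis (rev v)
    | _, [::] => wbasis (rev u)
    | i :: u', j :: v' =>
        append i (shuffle_rev u' v)
        + (chi (wt u) (alpha n j.+1))^-1 *: append j (aux v')
    end.

Definition shuffle (x y : shuf) : shuf :=
  \sum_(u <- msupp x) \sum_(v <- msupp y)
    (x@_u * y@_v) *: shuffle_rev (rev u) (rev v).

Inductive shufU : shuf -> Prop :=
| shufU_letter i : shufU (wbasis [:: i])
| shufU_one : shufU (wbasis [::])
| shufU_add x y : shufU x -> shufU y -> shufU (x + y)
| shufU_scale c x : shufU x -> shufU (c *: x)
| shufU_mul x y : shufU x -> shufU y -> shufU (shuffle x y).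

Definition dominant (u : word) : Prop :=
  exists x : shuf, [/\ shufU x, u \in msupp x &
    forall v, v \in msupp x -> v != u -> wordlt v u].

Definition lyndon (u : word) : bool :=
  (u != [::]) && all (fun k => wordlt u (drop k u)) (iota 1 (size u).-1).

Definition domlyndon (u : word) : Prop := dominant u /\ lyndon u.

(* Length of the left factor of the costandard factorization. *)
Definition costd (u : word) : nat :=
  (\max_(1 <= k < size u | lyndon (take k u)) k)%N.

(* ell is the inverse of the bijection wt from dominant Lyndon words to        *)
(* positive roots.                                                             *)
Definition inverse_wt (ell : 'rV[int]_n -> word) : Prop :=
  (forall u, domlyndon u -> posroot t (wt u) /\ ell (wt u) = u) /\
  (forall v, posroot t v -> domlyndon (ell v) /\ wt (ell v) = v).

Section RootVectors.
Variables (A : algType K) (g : gensys n A).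

(* Root vectors attached to (dominant Lyndon) words, by recursion on the       *)
(* costandard factorization; m bounds the length of the word.                  *)
Fixpoint evec_rec (m : nat) (u : word) : A :=
  match m, u with
  | _, [::] | 0%N, _ => 0
  | _, [:: i] => ge g i
  | m'.+1, _ =>
      let u1 := take (costd u) u in let u2 := drop (costd u) u in
      evec_rec m' u1 * evec_rec m' u2
      - chi (wt u2) (wt u1) *: (evec_rec m' u2 * evec_rec m' u1)
  end.

Fixpoint fvec_rec (m : nat) (u : word) : A :=
  match m, u with
  | _, [::] | 0%N, _ => 0
  | _, [:: i] => gf g i
  | m'.+1, _ =>
      let u1 := take (costd u) u in let u2 := drop (costd u) u in
      fvec_rec m' u2 * fvec_rec m' u1
      - (chi (wt u1) (wt u2))^-1 *: (fvec_rec m' u1 * fvec_rec m' u2)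
  end.

Variable ell : 'rV[int]_n -> word.

Definition evec (v : 'rV[int]_n) : A := evec_rec (size (ell v)) (ell v).
Definition fvec (v : 'rV[int]_n) : A := fvec_rec (size (ell v)) (ell v).

End RootVectors.

End QuantumGroup.

(* The field C(r, s), as the fraction field of C[r][s]. *)

Definition Crs (R : realType) : fieldType := {fraction {poly {poly R[i]}}}.
Definition varr (R : realType) : Crs R := tofrac (('X : {poly R[i]})%:P).
Definition vars (R : realType) : Crs R := tofrac ('X : {poly {poly R[i]}}).

(* Main.v *)
(* For words w in the letters f_i, the pairing of f_w with a product x x' is a *)
(* shuffle of the pairings with x and x'.  Hence passing from e_u to the       *)
(* q-commutator of e_u with e_j acts on the functional w |-> (f_w, e_u) as the *)
(* q-commutator with the letter j acts on the word u in the shuffle algebra,   *)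
(* up to scalars.  For a word u j attached to a positive root all insertions   *)
(* of j into u but the last one cancel, so that e_(uj) pairs only with f_(uj)  *)
(* and each letter multiplies the pairing of the root vectors by an explicit   *)
(* factor.  The same cancellation in the shuffle algebra puts the word u j     *)
(* itself in U; so these words are dominant, they are visibly Lyndon, and      *)
(* therefore they are the words l(gamma).  Two cases differ: in type D the     *)
(* words containing both n-1 and n come with a companion word in which these   *)
(* letters are exchanged, and in type C the word of beta_ii is m m n with      *)
(* m = i ... n-1, whose costandard factorization is (m)(m n).                  *)

(* Write chi for the bicharacter (omega'_lambda, omega_mu) and f_w for the product of the f_i along
   a word w. The vector e_gamma is studied through the functional w |-> (f_w, e_gamma), and f_gamma
   through its expansion into words f_w. Let u be the word of gamma. If the functional has value k
   at u and vanishes at all other words but possibly one companion u', while f_gamma contains f_u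
   with coefficient c and does not contain f_u', then (f_gamma, e_gamma) = k c. The invariant
   [rootword] records this, together with the fact that u plus a multiple of u' lies in the shuffle
   algebra U.

   The invariant is propagated one last letter j at a time. In a q-commutator with j, the insertion
   of j into u after a prefix b has a weight proportional to 1 - chi(b,j) chi(j,b)
   ([shcoef_comm_shuf], [shcoef_comm_pair]). It vanishes whenever b is orthogonal to j, and the two
   insertions next to a letter j of u give the same word and may cancel. If only the last insertion
   survives, [rootword_closing] multiplies the value by kappa_j (chi(j,u) - chi(u,j)^-1), where
   kappa_j = (f_j, e_j). With R = r^2, S = s^2 in type B and R = r, S = s otherwise, this factor is
   1 along an ascending word of regular nodes ([rootword_gamma]) and 1/(R S) for a letter of a
   descending tail ([rootword_descent]), whence the powers of r s. The end of the diagram needs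
   separate steps: [rootword_double] in type B, [closing_short] in type C, [rootword_fork] in type
   D. The roots beta_ii of type C, whose costandard factorization does not split off a letter, are
   settled by [square_dominant] and [square_pair].

   The map ell is only known as an inverse of the weight map, so a dominant Lyndon word of the right
   weight must be exhibited for each root ([pair_word]). Dominance comes with the invariant. Apart
   from beta_ii, the first letter of each word is strictly smaller than all others, which makes the
   word Lyndon and its costandard factorization split off the last letter ([headmin_lyndon],
   [costd_headmin]). *)
Require Import Defs.
From mathcomp Require Import all_boot all_order all_algebra.
From mathcomp Require Import reals.
From mathcomp Require Import ring zify.
From mathcomp.finmap Require Import finmap.
From mathcomp.multinomials Require Import monalg.

Set Implicit Arguments.
Unset Strict Implicit.
Unset Printing Implicit Defensive.

Import Order.TTheory GRing.Theory Num.Theory.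
Local Open Scope ring_scope.

(* ring does not treat b%:R, with b a boolean, as an atom.                     *)
Ltac ring_atoms :=
  repeat match goal with
  | |- context [ @GRing.natmul ?V ?x (nat_of_bool ?b) ] =>
      generalize (@GRing.natmul V x (nat_of_bool b)); intro
  end; ring.

(** * Shuffle coefficients *)

Section ShuffleCoefficients.
Variables (K : fieldType) (T : eqType) (P : T -> T -> K).
Implicit Types (u v w a b c : seq T).

Definition pairw u v : K := \prod_(i <- u) \prod_(j <- v) P i j.

Lemma pairw0l v : pairw [::] v = 1. Proof. by rewrite /pairw big_nil. Qed.
Lemma pairw0r u : pairw u [::] = 1.
Proof. by rewrite /pairw big1 // => i _; rewrite big_nil. Qed.
Lemma pairw_catl u u' v : pairw (u ++ u') v = pairw u v * pairw u' v.
Proof. by rewrite /pairw big_cat. Qed.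
Lemma pairw_catr u v v' : pairw u (v ++ v') = pairw u v * pairw u v'.
Proof. by rewrite /pairw -big_split; apply: eq_bigr => i _; rewrite big_cat. Qed.
Lemma pairw_consl i u v : pairw (i :: u) v = pairw [:: i] v * pairw u v.
Proof. by rewrite -cat1s pairw_catl. Qed.
Lemma pairw_consr u j v : pairw u (j :: v) = pairw u [:: j] * pairw u v.
Proof. by rewrite -cat1s pairw_catr. Qed.
Lemma pairw_rconsl u i v : pairw (rcons u i) v = pairw u v * pairw [:: i] v.
Proof. by rewrite -cats1 pairw_catl. Qed.
Lemma pairw_rconsr u v j : pairw u (rcons v j) = pairw u v * pairw u [:: j].
Proof. by rewrite -cats1 pairw_catr. Qed.
Lemma pairw11 i j : pairw [:: i] [:: j] = P i j.
Proof. by rewrite /pairw !big_seq1. Qed.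

(* Coefficient of w in the product of u and v: sum over the ways of reading w  *)
(* as a shuffle, each letter i of u preceding a letter j of v weighing P i j.  *)
Fixpoint shcoef w u v : K :=
  if w is h :: w' then
    (if u is i :: u' then (h == i)%:R * pairw [:: i] v * shcoef w' u' v else 0)
    + (if v is j :: v' then (h == j)%:R * shcoef w' u v' else 0)
  else (nilp u && nilp v)%:R.

Lemma shcoef_nill w v : shcoef w [::] v = (w == v)%:R.
Proof.
elim: w v => [|h w IH] [|j v] //=; rewrite ?addr0 // add0r IH eqseq_cons.
by rewrite -natrM mulnb.
Qed.

Lemma shcoef_nilr w u : shcoef w u [::] = (w == u)%:R.
Proof.
elim: w u => [|h w IH] [|i u] //=; rewrite ?addr0 // IH eqseq_cons.
by rewrite pairw0r mulr1 -natrM mulnb.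
Qed.

Lemma shcoef_consl h w i u v : h \notin v -> shcoef (h :: w) (i :: u) v =
  (h == i)%:R * pairw [:: i] v * shcoef w u v.
Proof.
case: v => [|j v] /=; first by rewrite addr0.
by rewrite inE negb_or => /andP[/negbTE-> _]; rewrite mul0r addr0.
Qed.

(* As h does not occur in a, the letters of a can only come from one factor.   *)
Lemma shcoef_prefixl h a b w u v : h \notin a -> size a = size b ->
  shcoef (a ++ w) (b ++ u) (h :: v) = (a == b)%:R * pairw b (h :: v) * shcoef w u (h :: v).
Proof.
elim: a b => [|x a IH] [|y b] //=; first by rewrite pairw0l !mul1r.
rewrite inE negb_or => /andP[hx ha] [sab].
rewrite [x == h]eq_sym (negbTE hx) mul0r addr0 IH // eqseq_cons.
by rewrite (pairw_consl y b) -mulnb natrM; ring_atoms.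
Qed.

Lemma shcoef_prefixr h a b w u v : h \notin a -> size a = size b ->
  shcoef (a ++ w) (h :: u) (b ++ v) = (a == b)%:R * shcoef w (h :: u) v.
Proof.
elim: a b => [|x a IH] [|y b] //=; first by rewrite !mul1r.
rewrite inE negb_or => /andP[hx ha] [sab].
rewrite [x == h]eq_sym (negbTE hx) !mul0r add0r IH // eqseq_cons.
by rewrite -mulnb natrM; ring_atoms.
Qed.

(** [front] is the recursive step of [shcoef], on first letters, as an operator on coefficient
    functions. [back] strips last letters instead; there the weight falls on a last letter of v,
    which all of u precedes. *)
Let front h (f : seq T -> seq T -> K) u v : K :=
  (if u is i :: u' then (h == i)%:R * pairw [:: i] v * f u' v else 0)
  + (if v is j :: v' then (h == j)%:R * f u v' else 0).

Let back k (f : seq T -> seq T -> K) u v : K :=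
  (if rev u is i :: u' then (k == i)%:R * f (rev u') v else 0)
  + (if rev v is j :: v' then (k == j)%:R * pairw u [:: j] * f u (rev v') else 0).

(** Stripping at the front and at the back commute, since each pair of letters from the two factors
    is weighed once in either order. *)
Let front_back h k f u v : front h (back k f) u v = back k (front h f) u v.
Proof.
have case1 (z : seq T) : [\/ z = [::], exists x, z = [:: x]
    | exists x z' y, z = x :: rcons z' y].
  case: z => [|x z]; first by constructor 1.
  by case/lastP: z => [|z y]; [constructor 2; exists x|constructor 3; exists x, z, y].
have revc x z y : rev (x :: rcons z y) = y :: rev (x :: z).
  by rewrite -rcons_cons rev_rcons.
rewrite /front /back; case: (case1 u) => [->|[x ->]|[x [u' [y ->]]]];
  case: (case1 v) => [->|[x' ->]|[x' [v' [y' ->]]]];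
  rewrite ?revc ?rev_rcons /= ?revK /= ?pairw0r ?pairw0l;
  rewrite ?(pairw_consl x (rcons _ _)).
all: try by ring_atoms.
all: rewrite (pairw_consr _ x' (rcons v' y')) (pairw_consr _ x' v') !pairw_rconsr.
all: ring_atoms.
Qed.

(** The shuffle product is defined by recursion on last letters, the coproduct of a word unfolds on
    first letters; this recursion lets [shcoef] serve both. In the induction on w, [front_back]
    carries the last letter past the first. *)
Lemma shcoef_rcons w k u i v j :
  shcoef (rcons w k) (rcons u i) (rcons v j) =
    (k == i)%:R * shcoef w u (rcons v j)
    + (k == j)%:R * pairw (rcons u i) [:: j] * shcoef w (rcons u i) v.
Proof.
suff gen u' v' : shcoef (rcons w k) u' v' = back k (shcoef w) u' v'.
  by rewrite gen /back !rev_rcons !revK.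
elim: w u' v' => [|h w IH] u' v'.
  have nn z (x : seq T) : nilp (rcons x z) = false by case: x.
  rewrite /back; case/lastP: u' => [|u' x]; case/lastP: v' => [|v' y];
    rewrite ?rev_rcons ?revK /= ?nn ?andbF ?shcoef_nill ?shcoef_nilr;
    rewrite ?(addr0, mulr0, add0r) // ?pairw0l.
  - by case: v' => [|z [|? ?]] /=; rewrite ?nn /= ?(mulr0, mulr1).
  - by case: u' => [|z [|? ?]] /=; rewrite ?nn /= ?pairw0r ?(mulr0, mulr1).
  - by case: u' v' => [|? ?] [|? ?] /=; rewrite ?(mulr0, andbF, addr0).
rewrite rcons_cons -[RHS](front_back h k (shcoef w)) /= /front.
by congr (_ + _); [case: u' => // ??|case: v' => // ??]; rewrite IH.
Qed.

Lemma shcoef_insr w u j : shcoef w u [:: j] = \sum_(k < (size u).+1)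
  pairw (take k u) [:: j] * (w == take k u ++ j :: drop k u)%:R.
Proof.
elim: w u => [|h w IH] u.
  rewrite /= andbF big1 // => k _.
  by case: (take k u) => [|? ?]; rewrite mulr0.
case: u => [|i u] /=.
  by rewrite big_ord1 /= shcoef_nill pairw0l mul1r add0r eqseq_cons -natrM mulnb.
rewrite big_ord_recl /= pairw0l mul1r eqseq_cons shcoef_nilr -natrM mulnb addrC.
congr (_ + _); rewrite IH mulr_sumr; apply: eq_bigr => k _ /=.
by rewrite add0n eqseq_cons (pairw_consl i (take _ _)) -mulnb natrM; ring_atoms.
Qed.

Lemma shcoef_insl w u j : shcoef w [:: j] u = \sum_(k < (size u).+1)
  pairw [:: j] (drop k u) * (w == take k u ++ j :: drop k u)%:R.
Proof.
elim: w u => [|h w IH] u.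
  rewrite big1 //= => k _.
  by case: (take k u) => [|? ?]; rewrite mulr0.
case: u => [|i u] /=.
  by rewrite big_ord1 /= shcoef_nill pairw0r mul1r mulr1 addr0 eqseq_cons -natrM mulnb.
rewrite big_ord_recl /= eqseq_cons shcoef_nill -mulnb natrM.
congr (_ + _); first by ring_atoms.
rewrite IH mulr_sumr; apply: eq_bigr => k _ /=.
by rewrite add0n eqseq_cons -mulnb natrM; ring_atoms.
Qed.

End ShuffleCoefficients.

(** * Insertions of one letter into a word *)

Section OneLetter.
Variables (K : fieldType) (T : eqType) (th S : T -> K) (j : T).
Implicit Types (u v w a b c : seq T).

(* Coefficient at w of the combination of the insertions of j into u, the      *)
(* position after a prefix b having weight th(b) (1 - S(b)).                   *)
Definition commcoef u w : K := \sum_(k < (size u).+1)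
  (\prod_(i <- take k u) th i) * (1 - \prod_(i <- take k u) S i)
  * (w == take k u ++ j :: drop k u)%:R.

(** Form of [commcoef] suited to induction on u: the prefix a has been read already, and t and z are
    the products of [th] and [S] accumulated over it. *)
Let comG a t z u w : K := \sum_(k < (size u).+1)
  t * (\prod_(i <- take k u) th i) * (1 - z * \prod_(i <- take k u) S i)
  * (w == a ++ take k u ++ j :: drop k u)%:R.

Let comcE u w : commcoef u w = comG [::] 1 1 u w.
Proof. by apply: eq_bigr => k _; rewrite !mul1r. Qed.

Let comG_nil a t z w : comG a t z [::] w = t * (1 - z) * (w == a ++ [:: j])%:R.
Proof. by rewrite /comG big_ord1 /= !big_nil !mulr1. Qed.

Let comG_cons a t z i u w : comG a t z (i :: u) w =
  t * (1 - z) * (w == a ++ j :: i :: u)%:R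
  + comG (a ++ [:: i]) (t * th i) (z * S i) u w.
Proof.
rewrite /comG big_ord_recl /= !big_nil !mulr1; congr (_ + _).
apply: eq_bigr => k _ /=; rewrite add0n !big_cons -catA /=.
by rewrite (mulrA t) (mulrA z).
Qed.

Definition inert := [pred i | (th i == 1) && (S i == 1)].

Let comG_inert a t b u w : all inert b ->
  comG a t 1 (b ++ u) w = comG (a ++ b) t 1 u w.
Proof.
elim: b a => [|i b IH] a /=; first by rewrite cats0.
move=> /andP[/andP[/eqP ti /eqP si] ib].
by rewrite comG_cons subrr mulr0 mul0r add0r ti si !mulr1 IH // -catA.
Qed.

(** Over an inert prefix the factor 1 - S(b) is zero, so the first position that counts is the one
    after x. *)
Lemma commcoef_last a x w : all inert a ->
  commcoef (a ++ [:: x]) w = th x * (1 - S x) * (w == a ++ [:: x; j])%:R.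
Proof.
move=> ia; rewrite comcE comG_inert // comG_cons comG_nil subrr mulr0 mul0r add0r.
by rewrite -catA !mul1r.
Qed.

(** As S(y) = 1, both positions past x survive. This is the source of the companion words of type
    D. *)
Lemma commcoef_fork a x y w : all inert a -> S y = 1 ->
  commcoef (a ++ [:: x; y]) w = th x * (1 - S x) * (w == a ++ [:: x; j; y])%:R
    + th x * th y * (1 - S x) * (w == a ++ [:: x; y; j])%:R.
Proof.
move=> ia sy; rewrite comcE comG_inert // !comG_cons comG_nil subrr mulr0 mul0r add0r.
by rewrite sy -!catA !mul1r !mulr1.
Qed.

(** The position after j has the factor 1 - S(x) S(j) = 0, so a x j j arises only from the position
    before j. *)
Lemma commcoef_double a x w : all inert a -> S x * S j = 1 ->
  commcoef (a ++ [:: x; j]) w = th x * (1 - S x) * (w == a ++ [:: x; j; j])%:R.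
Proof.
move=> ia sx; rewrite comcE comG_inert // !comG_cons comG_nil subrr mulr0 mul0r add0r.
by rewrite -!catA !mul1r sx subrr mulr0 mul0r addr0.
Qed.

Hypothesis thj : th j ^+ 2 * S j = 1.

(** Inserting j just before or just after a letter j gives the same word; this is the sum of the two
    weights, up to the common factor [th x]. In both scales used later, [th j] is chi(j,j)^-1 and
    [S j] is chi(j,j)^2, whence the hypothesis on [th j]. *)
Let thj_cancel x : S x = th j -> 1 - S x + th j * (1 - S x * S j) = 0.
Proof. by move=> ->; rewrite mulrBr mulrA -expr2 thj mulr1 addrA subrK subrr. Qed.

Lemma commcoef_short a x z w : all inert a -> S x = th j ->
  commcoef (a ++ [:: x; j; z]) w =
    th x * th j * th z * (1 - S x * S j * S z) * (w == a ++ [:: x; j; z; j])%:R.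
Proof.
move=> ia sx; rewrite comcE comG_inert // !comG_cons comG_nil subrr mulr0 mul0r add0r.
by rewrite -!catA !mul1r addrA -mulrDl -mulrA -mulrDr thj_cancel // mulr0 mul0r add0r.
Qed.

(** The two positions around j cancel; then S(x j y) = 1 and c is inert, so nothing counts from
    after y up to before z. *)
Lemma commcoef_long a x y c z w : all inert a -> all inert c ->
  S x = th j -> S x * S j * S y = 1 ->
  commcoef (a ++ [:: x; j; y] ++ c ++ [:: z]) w =
    th x * th j * th y * th z * (1 - S z)
    * (w == a ++ [:: x; j; y] ++ c ++ [:: z; j])%:R.
Proof.
move=> ia ic sx sy; rewrite comcE comG_inert // !comG_cons subrr mulr0 mul0r add0r.
rewrite -!catA !mul1r !sy comG_inert // comG_cons comG_nil subrr mulr0 mul0r add0r.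
by rewrite addrA -!catA -mulrDl -mulrA -mulrDr thj_cancel // mulr0 mul0r add0r !mul1r.
Qed.

End OneLetter.

(** * The bicharacter *)

Section Characters.
Variables (K : fieldType) (r s : K) (t : cltype) (n : nat).
Hypotheses (r0 : r != 0) (s0 : s != 0).
Implicit Types (x y z : 'rV[int]_n) (u v w : word n).

Lemma formDl x y z : Defs.form t (x + y) z = Defs.form t x z + Defs.form t y z.
Proof.
rewrite /Defs.form -big_split; apply: eq_bigr => i _ /=; rewrite -big_split.
by apply: eq_bigr => j _ /=; rewrite mxE -!mulrDl.
Qed.

Lemma formDr x y z : Defs.form t x (y + z) = Defs.form t x y + Defs.form t x z.
Proof.
rewrite /Defs.form -big_split; apply: eq_bigr => i _ /=; rewrite -big_split.
by apply: eq_bigr => j _ /=; rewrite mxE mulrDr mulrDl.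
Qed.

Lemma form0l y : Defs.form t 0 y = 0.
Proof. by apply: (addrI (Defs.form t 0 y)); rewrite -formDl !addr0. Qed.

Lemma form0r y : Defs.form t y 0 = 0.
Proof. by apply: (addrI (Defs.form t y 0)); rewrite -formDr !addr0. Qed.

Lemma form_alpha (i j : 'I_n) :
  Defs.form t (alpha n i.+1) (alpha n j.+1) = simple_form t n i.+1 j.+1.
Proof.
rewrite /Defs.form (bigD1 i) //= (bigD1 j) //= !mxE !eqxx !mul1r.
rewrite [X in _ + X]big1 ?addr0.
  rewrite big1 ?addr0 // => k /negbTE kj.
  by rewrite !mxE eqSS -(inj_eq val_inj) /= in kj *; rewrite kj mulr0 mul0r.
move=> k /negbTE ki; rewrite big1 // => l _.
by rewrite !mxE eqSS -(inj_eq val_inj) /= in ki *; rewrite ki !mul0r.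
Qed.

Lemma chiDl x y z : chi r s t (x + y) z = chi r s t x z * chi r s t y z.
Proof. by rewrite /chi /rspow formDl formDr opprD !expfzDr // mulrACA. Qed.

Lemma chiDr x y z : chi r s t x (y + z) = chi r s t x y * chi r s t x z.
Proof. by rewrite /chi /rspow formDl formDr opprD !expfzDr // mulrACA. Qed.

Lemma chi0l y : chi r s t 0 y = 1.
Proof. by rewrite /chi /rspow form0l form0r oppr0 !expr0z mulr1. Qed.

Lemma chi0r y : chi r s t y 0 = 1.
Proof. by rewrite /chi /rspow form0l form0r oppr0 !expr0z mulr1. Qed.

Lemma chi_neq0 x y : chi r s t x y != 0.
Proof. by rewrite mulf_neq0 // expfz_neq0. Qed.

Definition chis (i j : 'I_n) : K := chi r s t (alpha n i.+1) (alpha n j.+1).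

Lemma chisE i j :
  chis i j = rspow r s (simple_form t n i.+1 j.+1) (- simple_form t n j.+1 i.+1).
Proof. by rewrite /chis /chi !form_alpha. Qed.

Lemma chis_neq0 i j : chis i j != 0. Proof. exact: chi_neq0. Qed.

Lemma wt_cons i u : wt (i :: u) = alpha n i.+1 + wt u.
Proof. exact: big_cons. Qed.
Lemma wt1 i : wt [:: i] = alpha n i.+1.
Proof. exact: big_seq1. Qed.

Lemma chi_wt u v : chi r s t (wt u) (wt v) = pairw chis u v.
Proof.
elim: u => [|i u IH]; first by rewrite pairw0l /wt big_nil chi0l.
rewrite wt_cons chiDl IH pairw_consl; congr (_ * _).
elim: v {IH} => [|j v IHv]; first by rewrite pairw0r /wt big_nil chi0r.
by rewrite wt_cons chiDr IHv pairw_consr pairw11.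
Qed.

Definition chisV (i j : 'I_n) : K := (chis i j)^-1.

Lemma pairwV u v : pairw chisV u v = (pairw chis u v)^-1.
Proof. by rewrite /pairw -prodfV; apply: eq_bigr => i _; rewrite prodfV. Qed.

Lemma pairw_neq0 u v : pairw chis u v != 0.
Proof. by rewrite -chi_wt chi_neq0. Qed.

(* The two scales in which commutators with the letter j are expanded: in the  *)
(* shuffle algebra, and for the values of the Hopf pairing.                    *)
Definition symc (j i : 'I_n) : K := chis i j * chis j i.
Definition scl_shuf (j i : 'I_n) : K := (chis i j)^-1.
Definition scl_pair (j i : 'I_n) : K := (chis j i)^-1.

Lemma prod_symc j u : \prod_(i <- u) symc j i = pairw chis u [:: j] * pairw chis [:: j] u.
Proof.
rewrite big_split /pairw big_seq1; congr (_ * _).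
by apply: eq_bigr => i _; rewrite big_seq1.
Qed.
Lemma prod_scl_shuf j u : \prod_(i <- u) scl_shuf j i = (pairw chis u [:: j])^-1.
Proof.
by rewrite /pairw -prodfV; apply: eq_bigr => i _; rewrite big_seq1.
Qed.
Lemma prod_scl_pair j u : \prod_(i <- u) scl_pair j i = (pairw chis [:: j] u)^-1.
Proof. by rewrite /pairw big_seq1 prodfV. Qed.

(** For u = b d, the insertion of j after b has weight chi(b,j)^-1 - chi(j,u) chi(j,d)^-1 =
    chi(b,j)^-1 (1 - chi(b,j) chi(j,b)). *)
Lemma shcoef_comm_shuf w u j :
  shcoef chisV w u [:: j] - pairw chis [:: j] u * shcoef chisV w [:: j] u
  = commcoef (scl_shuf j) (symc j) j u w.
Proof.
rewrite shcoef_insr shcoef_insl mulr_sumr -sumrB; apply: eq_bigr => k _.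
rewrite prod_scl_shuf prod_symc !pairwV.
have -> : pairw chis [:: j] u = pairw chis [:: j] (take k u) * pairw chis [:: j] (drop k u).
  by rewrite -pairw_catr cat_take_drop.
have := pairw_neq0 (take k u) [:: j]; have := pairw_neq0 [:: j] (drop k u).
by move=> ? ?; rewrite mulrA -mulrBl; congr (_ * _); field; apply/andP.
Qed.

(** The factors are reversed because (y, x x') is computed against x' (x) x. For u = b d the weight
    is chi(j,d) - chi(j,u) chi(b,j) = chi(j,u) chi(j,b)^-1 (1 - chi(b,j) chi(j,b)). *)
Lemma shcoef_comm_pair w u j :
  shcoef chis w [:: j] u - pairw chis [:: j] u * shcoef chis w u [:: j]
  = pairw chis [:: j] u * commcoef (scl_pair j) (symc j) j u w.
Proof.
rewrite shcoef_insr shcoef_insl !mulr_sumr -sumrB; apply: eq_bigr => k _.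
rewrite prod_scl_pair prod_symc.
have -> : pairw chis [:: j] u = pairw chis [:: j] (take k u) * pairw chis [:: j] (drop k u).
  by rewrite -pairw_catr cat_take_drop.
have := pairw_neq0 [:: j] (take k u) => ?.
by rewrite !mulrA -mulrBl; congr (_ * _); field.
Qed.

End Characters.

(** * The shuffle algebra *)

Section ShuffleAlgebra.
Variables (K : fieldType) (r s : K) (t : cltype) (n : nat).
Hypotheses (r0 : r != 0) (s0 : s != 0).
Implicit Types (u v w : word n) (x y : shuf K n).

Notation chis := (@chis K r s t n).
Notation chisV := (@chisV K r s t n).

Definition linext (f : word n -> K) x : K := \sum_(u <- msupp x) x@_u * f u.

Lemma linext_sub (D : {fset (word n)}) f x : (msupp x `<=` D)%fset ->
  linext f x = \sum_(u <- D) x@_u * f u.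
Proof.
move=> sub; rewrite /linext (big_fset_incl _ sub) // => u _ /mcoeff_outdom ->.
by rewrite mul0r.
Qed.

Lemma linextD f x y : linext f (x + y) = linext f x + linext f y.
Proof.
rewrite (linext_sub f (msuppD_le x y)).
rewrite (linext_sub f (fsubsetUl (msupp x) (msupp y))).
rewrite (linext_sub f (fsubsetUr (msupp x) (msupp y))) -big_split.
by apply: eq_bigr => u _; rewrite mcoeffD mulrDl.
Qed.

Lemma linextZ f c x : linext f (c *: x) = c * linext f x.
Proof.
rewrite (linext_sub f (msuppZ_le c x)) /linext mulr_sumr.
by apply: eq_bigr => u _; rewrite mcoeffZ mulrA.
Qed.

Lemma linextU f u : linext f (wbasis K u) = f u.
Proof.
rewrite (linext_sub f msuppU_le) big_seq_fset1 mcoeffUU mul1r //.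
Qed.

Lemma wbasisE u v : (wbasis K u)@_v = (v == u)%:R.
Proof. by rewrite mcoeffU eq_sym. Qed.

Lemma append_nil i x : (append i x)@_[::] = 0.
Proof.
rewrite /append raddf_sum big1 // => u _ /=.
by rewrite mcoeffZ wbasisE; case: u => [|? ?]; rewrite mulr0.
Qed.

Lemma append_rcons i x w k : (append i x)@_(rcons w k) = (k == i)%:R * x@_w.
Proof.
rewrite /append raddf_sum /= (eq_bigr (fun u => (k == i)%:R * (x@_u * (w == u)%:R))).
  rewrite -mulr_sumr -/(linext _ x); congr (_ * _).
  rewrite {2}(monalgE x) raddf_sum; apply: eq_bigr => u _ /=.
  by rewrite mcoeffU (eq_sym u) mulr_natr.
by move=> u _; rewrite mcoeffZ wbasisE eqseq_rcons -mulnb natrM [_%:R * _%:R]mulrC mulrCA.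
Qed.

Lemma shuffle_rev_nill v : shuffle_rev r s t [::] v = wbasis K (rev v).
Proof. by case: v. Qed.
Lemma shuffle_rev_nilr u : shuffle_rev r s t u [::] = wbasis K (rev u).
Proof. by case: u. Qed.

Lemma shuffle_rev_cons i u j v : shuffle_rev r s t (i :: u) (j :: v) =
  append i (shuffle_rev r s t u (j :: v))
  + (chi r s t (wt (i :: u)) (alpha n j.+1))^-1
      *: append j (shuffle_rev r s t (i :: u) v).
Proof. by []. Qed.

Lemma wt_rev u : wt (rev u) = wt u.
Proof. by apply: perm_big; rewrite perm_rev. Qed.

(** Both sides obey the same recursion on last letters, the right-hand side by [shcoef_rcons]. *)
Lemma shuffle_revE u v w : (shuffle_rev r s t (rev u) (rev v))@_w = shcoef chisV w u v.
Proof.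
elim/last_ind: w u v => [|w k IH] u v.
  case/lastP: u => [|u i]; first by rewrite shuffle_rev_nill revK wbasisE shcoef_nill.
  case/lastP: v => [|v j]; first by rewrite shuffle_rev_nilr revK wbasisE shcoef_nilr.
  rewrite !rev_rcons shuffle_rev_cons mcoeffD mcoeffZ !append_nil mulr0 addr0.
  by case: (u).
case/lastP: u => [|u i]; first by rewrite shuffle_rev_nill revK wbasisE shcoef_nill.
case/lastP: v => [|v j]; first by rewrite shuffle_rev_nilr revK wbasisE shcoef_nilr.
rewrite !rev_rcons shuffle_rev_cons mcoeffD mcoeffZ !append_rcons -!rev_rcons !IH shcoef_rcons.
by rewrite wt_rev -wt1 chi_wt // -pairwV mulrCA mulrA.
Qed.

Lemma shuffleE x y w : (shuffle r s t x y)@_w =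
  linext (fun u => linext (fun v => shcoef chisV w u v) y) x.
Proof.
rewrite raddf_sum; apply: eq_bigr => u _; rewrite raddf_sum mulr_sumr.
by apply: eq_bigr => v _ /=; rewrite mcoeffZ shuffle_revE mulrA.
Qed.

Lemma shuffle_wbasis u v w : (shuffle r s t (wbasis K u) (wbasis K v))@_w =
  shcoef chisV w u v.
Proof. by rewrite shuffleE !linextU. Qed.

Lemma shufU_sub x y : shufU r s t x -> shufU r s t y -> shufU r s t (x - y).
Proof. by move=> Ux Uy; rewrite -scaleN1r; apply/shufU_add/shufU_scale. Qed.

(* Two words are carried along because in type D the dominant words have a     *)
(* companion in which the commuting letters n-1 and n are exchanged.           *)
Lemma shufU_comm u u' b j :
  shufU r s t (wbasis K u + b *: wbasis K u') ->
  pairw chis [:: j] u' = pairw chis [:: j] u ->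
  exists2 y, shufU r s t y & forall w, y@_w =
    commcoef (scl_shuf r s t j) (symc r s t j) j u w
    + b * commcoef (scl_shuf r s t j) (symc r s t j) j u' w.
Proof.
move=> Ux euu'; set x := _ + _ in Ux.
have Uj := shufU_letter r s t j.
have Ucomm := shufU_sub (shufU_mul Ux Uj)
  (shufU_scale (pairw chis [:: j] u) (shufU_mul Uj Ux)).
exists (shuffle r s t x (wbasis K [:: j])
    - pairw chis [:: j] u *: shuffle r s t (wbasis K [:: j]) x) => // w.
rewrite mcoeffB mcoeffZ !shuffleE linextD linextZ !linextU linextD linextZ !linextU.
by rewrite -!shcoef_comm_shuf // euu'; ring.
Qed.

(** The commutator with j is k times the new element. Both words carry the same k, so the ratio b
    persists. *)
Lemma shufU_adjoin u u' b k j : k != 0 ->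
  shufU r s t (wbasis K u + b *: wbasis K u') ->
  pairw chis [:: j] u' = pairw chis [:: j] u ->
  (forall w, commcoef (scl_shuf r s t j) (symc r s t j) j u w = k * (w == rcons u j)%:R) ->
  (forall w, commcoef (scl_shuf r s t j) (symc r s t j) j u' w = k * (w == rcons u' j)%:R) ->
  shufU r s t (wbasis K (rcons u j) + b *: wbasis K (rcons u' j)).
Proof.
move=> k0 Ux euu' cu cu'; have [y /(shufU_scale k^-1) Uy Ey] := shufU_comm Ux euu'.
suff -> : wbasis K (rcons u j) + b *: wbasis K (rcons u' j) = k^-1 *: y by [].
apply/malgP => w; rewrite mcoeffZ mcoeffD mcoeffZ !wbasisE Ey cu cu'.
by rewrite mulrCA -mulrDr mulrA mulVf // mul1r.
Qed.

(** The case u' = u with b = 0 encodes a word without companion. *)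
Lemma dominant_pair u u' b :
  shufU r s t (wbasis K u + b *: wbasis K u') ->
  (if u' == u then b == 0 else wordlt u' u) -> dominant r s t u.
Proof.
move=> Ux uu'; exists (wbasis K u + b *: wbasis K u'); split=> // [|v].
  rewrite -mcoeff_neq0 mcoeffD mcoeffZ !wbasisE eqxx (eq_sym u).
  by case: eqP uu' => [_ /eqP->|_ _]; rewrite ?mul0r ?mulr0 addr0 oner_neq0.
rewrite -mcoeff_neq0 mcoeffD mcoeffZ !wbasisE => vx /negbTE vu; move: vx uu'.
rewrite vu add0r; have [->|_] := v =P u'; last by rewrite mulr0 eqxx.
by case: ifP => [_ + /eqP b0|//]; rewrite b0 mul0r eqxx.
Qed.

End ShuffleAlgebra.

(** * Lyndon words *)

Section LyndonWords.
Variable n : nat.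
Implicit Types (i j : 'I_n) (a u v w : word n).

Lemma wordlt_cons i j u v :
  wordlt (i :: u) (j :: v) = (i < j)%N || (i == j) && wordlt u v.
Proof.
rewrite /wordlt ltxi_cons !leEord -val_eqE /=.
by case: ltngtP.
Qed.

Lemma wordlt_cat a u v : wordlt (a ++ u) (a ++ v) = wordlt u v.
Proof. by elim: a => [//|i a IH]; rewrite wordlt_cons ltnn eqxx. Qed.

Lemma wordlt_nil u : wordlt u [::] = false.
Proof. exact: ltxis0. Qed.

(** A criterion for Lyndon words that, unlike the Lyndon property, passes to nonempty prefixes. It
    holds for the words of all roots except beta_ii in type C. *)
Definition headmin u := if u is i :: v then all (fun k : 'I_n => i < k)%N v else false.

Lemma headmin_lyndon u : headmin u -> lyndon u.
Proof.
case: u => // i v /allP iv; apply/andP; split=> //; apply/allP => k.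
rewrite mem_iota => /andP[k0 /=]; rewrite add1n ltnS => kv.
case: k k0 kv => // k _ kv; rewrite /= (drop_nth i) // wordlt_cons.
by rewrite iv ?mem_nth.
Qed.

Lemma headmin_take k u : (0 < k)%N -> headmin u -> headmin (take k u).
Proof.
case: k u => // k [|i v] //= _ /allP iv; apply/allP => x /mem_take; exact: iv.
Qed.

Lemma costd_bounds u : (1 < size u)%N -> (0 < costd u < size u)%N.
Proof.
move=> u1; apply/andP; split; last first.
  rewrite -[X in (_ < X)%N](prednK (ltnW u1)) ltnS.
  by apply/bigmax_leqP_seq => k; rewrite mem_index_iota => /andP[_]; lia.
apply: (@leq_bigmax_seq _ _ _ _ 1%N); first by rewrite mem_index_iota u1.
by case: (u) u1 => // i v _; rewrite /= take0.
Qed.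

(** All nonempty prefixes of such a word are Lyndon, so the longest proper one is the left
    factor. *)
Lemma costd_headmin u j : u != [::] -> headmin (rcons u j) -> costd (rcons u j) = size u.
Proof.
move=> u0 hu; apply/eqP; rewrite eqn_leq; apply/andP; split.
  apply/bigmax_leqP_seq => k; rewrite mem_index_iota size_rcons ltnS => /andP[_ ks] _.
  exact: ks.
apply: (@leq_bigmax_seq _ _ _ _ (size u));
  first by rewrite mem_index_iota size_rcons ltnSn lt0n size_eq0 u0.
by apply/headmin_lyndon/headmin_take => //; rewrite lt0n size_eq0.
Qed.

(** A proper suffix that starts neither with m nor at the head of the word begins with a letter
    above the head of m. The remaining suffix m j exceeds m m j because j exceeds the head of m. *)
Lemma lyndon_square m j : headmin m -> all (fun k : 'I_n => k < j)%N m ->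
  lyndon (m ++ m ++ [:: j]).
Proof.
case: m => // i m im mj; have ij : (i < j)%N by case/andP: mj.
have im' : all (fun k : 'I_n => i < k)%N (m ++ [:: j]).
  by rewrite all_cat; apply/andP; split; [exact: im|rewrite /= ij].
apply/andP; split=> //; apply/allP => k; rewrite mem_iota => /andP[k0 kl].
set u := (i :: m) ++ _ in kl *.
have big k' x : headmin (i :: x) -> (k' < size x)%N -> forall v,
    wordlt u (drop k' x ++ v).
  move=> /allP ix kx v; rewrite (drop_nth i kx) cat_cons wordlt_cons ix ?mem_nth //.
have us : size u = (size m + (size m).+2).+1 by rewrite /u !size_cat /=; lia.
rewrite us /= add1n ltnS in kl.
case: k k0 kl => // k _ kl; rewrite /u [drop _ _]/= drop_cat.
case: ltnP => [km|mk]; first exact: big.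
have [->|k0] := eqVneq (k - size m)%N 0%N.
  by rewrite drop0 wordlt_cat /= wordlt_cons ij.
case E: (k - size m)%N k0 => [//|l] _; rewrite /= -[drop l _]cats0; apply: big => //.
rewrite size_cat /= addn1. lia.
Qed.

(** A longer proper prefix is m p with p a nonempty prefix of m; its suffix p is also a prefix of
    it, hence smaller, so m p is not Lyndon. *)
Lemma costd_square m j : headmin m -> costd (m ++ m ++ [:: j]) = size m.
Proof.
move=> hm; have m0 : (0 < size m)%N by case: (m) hm.
apply/eqP; rewrite eqn_leq; apply/andP; split.
  apply/bigmax_leqP_seq => k; rewrite mem_index_iota !size_cat addn1 addnS ltnS.
  move=> /andP[k0 kl]; case: (leqP k (size m)) => // mk.
  have -> : take k (m ++ m ++ [:: j]) = m ++ take (k - size m) m.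
    rewrite take_cat ltnNge (ltnW mk) /= take_cat; case: ltnP => // e.
    have -> : (k - size m - size m = 0)%N by lia.
    by rewrite take0 take_oversize // cats0.
  set p := take _ m => /andP[_ /allP/(_ (size m))].
  have p0 : (0 < size p)%N by rewrite size_take; case: ifP; lia.
  rewrite mem_iota m0 size_cat /= add1n drop_size_cat //.
  have -> : (size m < (size m + size p).-1.+1)%N by lia.
  move/(_ isT); rewrite -{1}(cat_take_drop (k - size m) m) -/p -[X in wordlt _ X]cats0.
  by rewrite -catA wordlt_cat wordlt_nil.
apply: (@leq_bigmax_seq _ _ _ _ (size m)); first by rewrite mem_index_iota !size_cat m0 /=; lia.
by rewrite take_size_cat // headmin_lyndon.
Qed.

End LyndonWords.

(** * The form on simple roots *)

Section RootForms.
Variables (t : cltype) (n : nat).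
Implicit Types (u v w : 'rV[int]_n.+1).

(** The squared length of the eps_i, which is also the value of the form at a regular simple root
    paired with itself. *)
Let c : int := if t is TypeB then 2 else 1.

Lemma innerC u v : inner t u v = inner t v u.
Proof. by congr (_ * _); apply: eq_bigr => k _; rewrite mulrC. Qed.

Lemma innerBl u v w : inner t (u - v) w = inner t u w - inner t v w.
Proof.
rewrite /inner -mulrBr -sumrB; congr (_ * _); apply: eq_bigr => k _.
by rewrite !mxE mulrBl.
Qed.

Lemma innerDl u v w : inner t (u + v) w = inner t u w + inner t v w.
Proof.
rewrite /inner -mulrDr -big_split; congr (_ * _); apply: eq_bigr => k _.
by rewrite !mxE mulrDl.
Qed.

Lemma innerBr u v w : inner t w (u - v) = inner t w u - inner t w v.
Proof. by rewrite innerC innerBl !(innerC w). Qed.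

Lemma innerDr u v w : inner t w (u + v) = inner t w u + inner t w v.
Proof. by rewrite innerC innerDl !(innerC w). Qed.

Lemma inner_eps i j : (0 < i <= n.+1)%N ->
  inner t (epsv n i) (epsv n j) = c * (i == j)%:R.
Proof.
case: i => // i /=; rewrite ltnS => lt_i; rewrite /inner; congr (_ * _).
rewrite (bigD1 (Ordinal (lt_i : i < n.+1)%N)) //= !mxE /= eqxx mul1r.
rewrite big1 ?addr0 // => k; rewrite -val_eqE !mxE /= eqSS => /negbTE->.
by rewrite mul0r.
Qed.

(* i is not the exceptional last node of types B, C and D                      *)
Definition regular i := (0 < i)%N && (if t is TypeA then i <= n else i < n)%N.

Let simple_vec_reg i : regular i -> simple_vec t n i = epsv n i - epsv n i.+1.
Proof. by rewrite /simple_vec /regular; case: (t) => // /andP[_ ->]. Qed.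

Let reg_bounds i : regular i -> (0 < i <= n.+1)%N && (0 < i.+1 <= n.+1)%N.
Proof. by rewrite /regular; case: (t); lia. Qed.

Lemma simple_inner_reg i j : regular i -> regular j ->
  simple_inner t n i j = c * ((i == j)%:R *+ 2 - (i == j.+1)%:R - (i.+1 == j)%:R).
Proof.
move=> ri rj; have /andP[i1 i2] := reg_bounds ri.
rewrite /simple_inner !simple_vec_reg // innerBl !innerBr !inner_eps // eqSS; ring.
Qed.

Let not_special i j : regular i -> regular j ->
  ((if t is TypeD then (i == n.-1) && (j == n) else false) = false) *
  ((if t is TypeD then (i == n) && (j == n.-1) else false) = false).
Proof.
rewrite /regular; case: (t) => // /andP[_ i1] /andP[_ j1].
by rewrite (ltn_eqF i1) (ltn_eqF j1) andbF.
Qed.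

Let cE : c = 1 \/ c = 2. Proof. by rewrite /c; case: t; [left|right|left|left]. Qed.

Lemma simple_form_reg i j : regular i -> regular j ->
  simple_form t n i j = if i == j then c else if i.+1 == j then - c else 0.
Proof.
move=> ri rj; have [s1 s2] := not_special ri rj; rewrite /simple_form s1 s2.
rewrite /symd /cartan !simple_inner_reg // eqxx ltn_eqF // gtn_eqF //.
have [->|ij] := eqVneq i j; first by rewrite ltnn; case: cE => ->.
case: ltnP => [lt_ij|le_ji].
  rewrite (ltn_eqF (ltnW lt_ij : (i < j.+1)%N)).
  by case: eqP => _; case: cE => ->.
by rewrite gtn_eqF.
Qed.

End RootForms.

(** * The form at the last node of types B, C and D *)

Section LastNode.
Variable n : nat.

Let svB i t : (0 < i < n)%N -> t <> TypeA -> simple_vec t n i = epsv n i - epsv n i.+1.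
Proof. by case: t => // /andP[_ i1] _; rewrite /simple_vec i1. Qed.

Let svBn : simple_vec TypeB n n = epsv n n. Proof. by rewrite /simple_vec ltnn. Qed.
Let svCn : simple_vec TypeC n n = epsv n n + epsv n n.
Proof. by rewrite /simple_vec ltnn mulr2n. Qed.
Let svDn : simple_vec TypeD n n = epsv n n.-1 + epsv n n.
Proof. by rewrite /simple_vec ltnn. Qed.

Lemma simple_form_lastB i : (0 < i < n)%N ->
  simple_form TypeB n i n = (if i.+1 == n then - 2 else 0) /\ simple_form TypeB n n i = 0.
Proof.
move=> /andP[i0 i1]; rewrite /simple_form i1 ltnNge (ltnW i1) /= [n == i]gtn_eqF //; split=> //.
rewrite /symd /cartan /simple_inner svB ?i0 // ?svBn
  !innerBl !innerBr !inner_eps ?i0 ?ltnS ?(ltnW i1) //=; try lia.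
have [e1 e2 e3] : [/\ (i == i.+1) = false, (i.+1 == i) = false & (i == n) = false].
  by split; lia.
rewrite !eqxx e1 e2 e3.
by case: eqP.
Qed.

Lemma simple_form_lastBB : (0 < n)%N -> simple_form TypeB n n n = 1.
Proof.
move=> n0; rewrite /simple_form ltnn eqxx /symd /simple_inner svBn inner_eps ?n0 ?leqnSn //.
by rewrite eqxx.
Qed.

Lemma simple_form_lastC i : (0 < i < n)%N ->
  simple_form TypeC n i n = (if i.+1 == n then - 2 else 0) /\ simple_form TypeC n n i = 0.
Proof.
move=> /andP[i0 i1]; rewrite /simple_form i1 ltnNge (ltnW i1) /= [n == i]gtn_eqF //; split=> //.
rewrite /symd /cartan /simple_inner svB ?i0 // ?svCn
  !innerBl !innerBr !innerDr !inner_eps ?i0 ?ltnS ?(ltnW i1) //=; try lia.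
have [e1 e2 e3] : [/\ (i == i.+1) = false, (i.+1 == i) = false & (i == n) = false].
  by split; lia.
rewrite !eqxx e1 e2 e3.
by case: eqP.
Qed.

Lemma simple_form_lastCC : (0 < n)%N -> simple_form TypeC n n n = 2.
Proof.
move=> n0; rewrite /simple_form ltnn eqxx /symd /simple_inner svCn innerDl !innerDr.
by rewrite inner_eps ?n0 ?leqnSn // eqxx.
Qed.

(** The node n is joined to n-2. The values at the orthogonal nodes n-1 and n are the two
    exceptional ones of the form. *)
Lemma simple_form_lastD i : (0 < i < n)%N ->
  simple_form TypeD n i n = (if (i.+1 == n) || (i.+2 == n) then - 1 else 0) /\
  simple_form TypeD n n i = (if i.+1 == n then 1 else 0).
Proof.
move=> /andP[i0 i1]; rewrite /simple_form eqxx i1 ltnNge (ltnW i1) /= andbT.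
rewrite [n == n.-1]gtn_eqF ?prednK ?(leq_trans i0 (ltnW i1)) // andbF.
have -> : (i == n.-1) = (i.+1 == n) by lia.
rewrite [n == i]gtn_eqF //; split; case: ifP => // i2.
rewrite /symd /cartan /simple_inner svB ?i0 // ?svDn
  !innerBl !innerBr !innerDr !inner_eps ?i0 ?ltnS ?(ltnW i1) //=; try lia.
have [e1 e2 e3] : [/\ (i == i.+1) = false, (i.+1 == i) = false & (i == n) = false].
  by split; lia.
rewrite !eqxx e1 e2 e3 i2.
have -> : (i == n.-1) = false by lia.
have -> : (i.+1 == n.-1) = (i.+2 == n) by lia.
by case: eqP.
Qed.

Lemma simple_form_lastDD : (1 < n)%N -> simple_form TypeD n n n = 1.
Proof.
move=> n1; rewrite /simple_form ltnn eqxx andbT [n == n.-1]gtn_eqF; last by lia.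
rewrite /= /symd /simple_inner svDn innerDl !innerDr !inner_eps; lia.
Qed.

End LastNode.

(** * The Hopf pairing *)

Section HopfPairing.
Variables (K : fieldType) (r s : K) (t : cltype) (n : nat).
Hypotheses (r0 : r != 0) (s0 : s != 0).
Variables (A : algType K) (g : gensys n A).
Hypothesis Hrel : forall x y, urel r s t g x y -> x = y.
Variable Delta : {lrmorphism A -> tensor2 A}.
Hypothesis hDelta : coproduct g Delta.
Variable B : A -> A -> K.
Hypothesis hB : hopf_pairing r s t g Delta B.
Implicit Types (i j : 'I_n) (u v w : seq 'I_n) (x y : A).

Notation chis := (@chis K r s t n).
Notation e := (ge g).
Notation f := (gf g).
Notation Ule := (Ule g).
Notation Uge := (Uge g).

Definition fword w : A := \prod_(i <- w) f i.
Definition wword w : A := \prod_(i <- w) gw' g i.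

Lemma fword_cons i w : fword (i :: w) = f i * fword w. Proof. exact: big_cons. Qed.
Lemma wword_cons i w : wword (i :: w) = gw' g i * wword w. Proof. exact: big_cons. Qed.
Lemma fword1 i : fword [:: i] = f i. Proof. exact: big_seq1. Qed.
Lemma fword_cat u v : fword (u ++ v) = fword u * fword v. Proof. exact: big_cat. Qed.
Lemma wword_cat u v : wword (u ++ v) = wword u * wword v. Proof. exact: big_cat. Qed.

Lemma Ule_f i : Ule (f i). Proof. by apply: subalg_in; exists i; constructor 1. Qed.
Lemma Ule_w' i : Ule (gw' g i). Proof. by apply: subalg_in; exists i; constructor 2. Qed.
Lemma Ule1 : Ule 1. Proof. exact: subalg1. Qed.
Lemma UleM x y : Ule x -> Ule y -> Ule (x * y). Proof. exact: subalgM. Qed.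
Lemma UleZ c x : Ule x -> Ule (c *: x). Proof. exact: subalgZ. Qed.
Lemma UleB x y : Ule x -> Ule y -> Ule (x - y).
Proof. by move=> Ux Uy; rewrite -scaleN1r; apply/subalgD/UleZ. Qed.
Lemma Ule_fword w : Ule (fword w).
Proof. by apply: big_ind => [|x y|i _]; [exact: Ule1|exact: UleM|exact: Ule_f]. Qed.
Lemma Ule_wword w : Ule (wword w).
Proof. by apply: big_ind => [|x y|i _]; [exact: Ule1|exact: UleM|exact: Ule_w']. Qed.

Lemma Uge_e i : Uge (e i). Proof. by apply: subalg_in; exists i; constructor 1. Qed.
Lemma Uge_w i : Uge (gw g i). Proof. by apply: subalg_in; exists i; constructor 2. Qed.
Lemma Uge1 : Uge 1. Proof. exact: subalg1. Qed.
Lemma UgeM x y : Uge x -> Uge y -> Uge (x * y). Proof. exact: subalgM. Qed.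
Lemma UgeZ c x : Uge x -> Uge (c *: x). Proof. exact: subalgZ. Qed.
Lemma UgeB x y : Uge x -> Uge y -> Uge (x - y).
Proof. by move=> Ux Uy; rewrite -scaleN1r; apply/subalgD/UgeZ. Qed.

(** Linearity is available for c y + y' only, so the vanishing at 0 is extracted first. *)
Lemma pairZl c y x : Ule y -> Uge x -> B (c *: y) x = c * B y x.
Proof.
move=> Uy Ux.
have B0 : B 0 x = 0.
  have := hopf_linl hB (-1) Ule1 Ule1 Ux; rewrite scaleN1r addNr => ->.
  by rewrite mulN1r addNr.
have U0 : Ule 0 by rewrite -(scale0r 1); apply/UleZ/Ule1.
by have := hopf_linl hB c Uy U0 Ux; rewrite B0 !addr0.
Qed.

Lemma pairBr y x x' c : Ule y -> Uge x -> Uge x' ->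
  B y (x - c *: x') = B y x - c * B y x'.
Proof.
move=> Uy Ux Ux'; rewrite addrC -scaleNr (hopf_linr hB) //; ring.
Qed.

Let prod_delta (F : 'I_n -> A) i : \prod_(k < n) (if k == i then F k else 1) = F i.
Proof. by rewrite -big_mkcond big_pred1_eq. Qed.

Lemma omega0 : omega g 0 = 1.
Proof. by apply: big1 => i _; rewrite mxE. Qed.
Lemma omega'0 : omega' g 0 = 1.
Proof. by apply: big1 => i _; rewrite mxE. Qed.
Lemma omega_alpha i : omega g (alpha n i.+1) = gw g i.
Proof.
rewrite -[RHS](prod_delta (gw g)); apply: eq_bigr => k _.
by rewrite mxE eqSS -val_eqE; case: eqP => _ //=; rewrite expr1.
Qed.
Lemma omega'_alpha i : omega' g (alpha n i.+1) = gw' g i.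
Proof.
rewrite -[RHS](prod_delta (gw' g)); apply: eq_bigr => k _.
by rewrite mxE eqSS -val_eqE; case: eqP => _ //=; rewrite expr1.
Qed.

Lemma pair11 : B 1 1 = 1.
Proof. by rewrite -{1}omega'0 -omega0 (hopf_w'w hB) chi0l. Qed.
Lemma pair1w j : B 1 (gw g j) = 1.
Proof. by rewrite -omega'0 -omega_alpha (hopf_w'w hB) chi0l. Qed.
Lemma pairw1 i : B (gw' g i) 1 = 1.
Proof. by rewrite -omega'_alpha -omega0 (hopf_w'w hB) chi0r. Qed.
Lemma pairww i j : B (gw' g i) (gw g j) = chis i j.
Proof. by rewrite -omega'_alpha -omega_alpha (hopf_w'w hB). Qed.

Lemma pairM1 y y' : Ule y -> Ule y' -> B (y * y') 1 = B y 1 * B y' 1.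
Proof.
move=> Uy Uy'; rewrite (hopf_mull hB (l := [:: (1, 1)]) Uy Uy' Uge1) ?big_seq1 //.
  by move=> p; rewrite inE => /eqP->; split; exact: Uge1.
by rewrite rmorph1.
Qed.

Lemma pairMe y y' j : Ule y -> Ule y' ->
  B (y * y') (e j) = B y (e j) * B y' 1 + B y (gw g j) * B y' (e j).
Proof.
move=> Uy Uy'.
rewrite (hopf_mull hB (l := [:: (e j, 1); (gw g j, e j)]) Uy Uy' (Uge_e j)).
- by rewrite big_cons big_seq1.
- move=> p; rewrite !inE => /orP[] /eqP->; split; first exact: Uge_e.
  + exact: Uge1.
  + exact: Uge_w.
  + exact: Uge_e.
- by rewrite big_cons big_seq1; case: (hDelta j).
Qed.

(** Computing (f_i, 1) as the pairing with the product 1 1, through the coproduct of f_i, gives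
    twice the same value. *)
Lemma pairf1 i : B (f i) 1 = 0.
Proof.
suff E : B (f i) (1 * 1) = B (f i) 1 + B (f i) 1.
  by apply: (addrI (B (f i) 1)); rewrite addr0 -E mulr1.
rewrite (hopf_mulr hB (l := [:: (1, f i); (f i, gw' g i)]) (Ule_f i) Uge1 Uge1).
- by rewrite big_cons big_seq1 /= pairw1 pair11 mul1r mulr1.
- move=> p; rewrite !inE => /orP[] /eqP->; split; first exact: Ule1.
  + exact: Ule_f.
  + exact: Ule_f.
  + exact: Ule_w'.
- by rewrite big_cons big_seq1; case: (hDelta i).
Qed.

Lemma pair1e j : B 1 (e j) = 0.
Proof.
have := pairMe j Ule1 Ule1; rewrite mulr1 pair11 pair1w mulr1 mul1r => E.
by apply: (addrI (B 1 (e j))); rewrite addr0 -E.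
Qed.

Lemma pairM_w' i x x' : Uge x -> Uge x' ->
  B (gw' g i) (x * x') = B (gw' g i) x' * B (gw' g i) x.
Proof.
move=> Ux Ux'.
rewrite (hopf_mulr hB (l := [:: (gw' g i, gw' g i)]) (Ule_w' i) Ux Ux').
- by rewrite big_seq1.
- by move=> p; rewrite inE => /eqP->; split; exact: Ule_w'.
- by rewrite big_seq1; case: (hDelta i).
Qed.

Lemma pairw'e i j : chis j j != 1 -> B (gw' g i) (e j) = 0.
Proof.
move=> jj; have := Hrel (rel_we r s t g j j).
move=> /(congr1 (B (gw' g i))); rewrite pairM_w'; [|exact: Uge_w|exact: Uge_e].
have Uew := UgeM (Uge_e j) (Uge_w j).
(* The scalar is split as (c - 1) + 1 to fit the shape c x + x' in which linearity is given. *)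
have := hopf_linr hB (rspow r s (aform t j j) (- aform t j j) - 1) (Ule_w' i) Uew Uew.
rewrite scalerBl scale1r subrK => ->; rewrite pairM_w' ?pairww; [|exact: Uge_e|exact: Uge_w].
rewrite /aform form_alpha -chisE mulrBl mul1r subrK [X in _ = X]mulrCA mulrC.
move/(mulfI (chis_neq0 t r0 s0 i j)) => E.
have /eqP : (1 - chis j j) * B (gw' g i) (e j) = 0 by rewrite mulrBl mul1r -E subrr.
by rewrite mulf_eq0 subr_eq0 eq_sym (negbTE jj) => /eqP.
Qed.

(** The terms of the coproduct of f_w: a scalar, the word on the left, and the word on the right
    without its factors omega'. *)
Fixpoint splits w : seq (K * seq 'I_n * seq 'I_n) :=
  if w is i :: w' then
    [seq (p.1.1, p.1.2, i :: p.2) | p <- splits w'] ++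
    [seq (p.1.1 * pairw chis [:: i] p.2, i :: p.1.2, p.2) | p <- splits w']
  else [:: (1, [::], [::])].

Lemma sum_splits w u v :
  \sum_(p <- splits w) p.1.1 * (p.1.2 == u)%:R * (p.2 == v)%:R = shcoef chis w u v.
Proof.
elim: w u v => [|i w IH] u v /=.
  by rewrite big_seq1 /= mul1r -natrM mulnb; case: u v => [|? ?] [|? ?].
rewrite big_cat !big_map addrC; congr (_ + _).
  case: v => [|j v]; first by rewrite big1 // => p _ /=; rewrite mulr0.
  rewrite -IH mulr_sumr; apply: eq_bigr => p _ /=.
  by rewrite eqseq_cons -mulnb natrM; ring_atoms.
case: u => [|j u]; first by rewrite big1 // => p _ /=; rewrite mulr0 mul0r.
rewrite -IH mulr_sumr; apply: eq_bigr => p _ /=.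
rewrite eqseq_cons; have [<-|_] := p.2 =P v; last by rewrite !mulr0.
by have [<-|_] := i =P j; rewrite ?mulr0 ?mul0r //=; ring_atoms.
Qed.

Lemma w'_fword i w : gw' g i * fword w = pairw chis [:: i] w *: (fword w * gw' g i).
Proof.
elim: w => [|j w IH]; first by rewrite /fword big_nil mulr1 mul1r pairw0r scale1r.
rewrite fword_cons mulrA (Hrel (rel_w'f r s t g i j)) /aform !form_alpha -chisE.
by rewrite -scalerAl -!mulrA IH -scalerAr scalerA (pairw_consr _ _ j) pairw11.
Qed.

Definition splits_tens w : seq (A * A) :=
  [seq (p.1.1 *: fword p.1.2, fword p.2 * wword p.1.2) | p <- splits w].

(** Multiplying out the 1 (x) f_i + f_i (x) omega'_i and moving each omega'_i to the right of the
    letters f produces the scalars of [splits]. *)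
Lemma Delta_fword w : Delta (fword w) = \sum_(p <- splits_tens w) tens p.1 p.2.
Proof.
elim: w => [|i w IH].
  by rewrite big_map big_seq1 /= /fword /wword !big_nil mulr1 scale1r rmorph1.
rewrite fword_cons rmorphM /= IH; have [_ _ _ ->] := hDelta i.
rewrite /splits_tens /= map_cat big_cat !big_map /= mulr_sumr -big_split /=.
apply: eq_bigr => p _; rewrite mulrDl !tens_mul mul1r fword_cons mulrA; congr (_ + _).
have tZ c a b : tens a (c *: b) = tens (c *: a) b :> tensor2 A.
  have [tl tr] := tens_bilinear A.
  have t0l b' : tens 0 b' = 0 :> tensor2 A.
    by have := tl b' (-1) 0 0; rewrite /= scaler0 addr0 scaleN1r addNr.
  have t0r a' : tens a' 0 = 0 :> tensor2 A.
    by have := tr a' (-1) 0 0; rewrite /= scaler0 addr0 scaleN1r addNr.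
  have := tr a c b 0; have := tl b c a 0; rewrite /= !addr0 t0l t0r !addr0.
  by move=> -> ->.
rewrite mulrA w'_fword -scalerAl tZ !fword_cons wword_cons -scalerAr scalerA mulrC.
by rewrite mulrA.
Qed.

Lemma splits_Ule w p : p \in splits_tens w -> Ule p.1 /\ Ule p.2.
Proof.
case/mapP => q _ ->; split; first exact/UleZ/Ule_fword.
by apply: UleM; [exact: Ule_fword|exact: Ule_wword].
Qed.

Lemma Delta_wword v : Delta (wword v) = tens (wword v) (wword v).
Proof.
elim: v => [|i v IH]; first by rewrite /wword big_nil rmorph1.
by rewrite wword_cons rmorphM /= IH; have [_ -> _ _] := hDelta i; rewrite tens_mul.
Qed.

(* Elements of U^>= on which factors omega' to the right of a word in the f_i  *)
(* are invisible.                                                              *)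
Definition w'free x := Uge x /\ forall w v, B (fword w * wword v) x = B (fword w) x.

(** The group-like factor omega' enters both legs of the coproduct, where x and x' ignore it along
    with the omega' produced by [splits]. *)
Let pair_fwordM_aux w v x x' : w'free x -> w'free x' ->
  B (fword w * wword v) (x * x') =
    \sum_(p <- splits w) p.1.1 * B (fword p.1.2) x' * B (fword p.2) x.
Proof.
move=> [Ux Hx] [Ux' Hx'].
have Uv := Ule_wword v.
rewrite (hopf_mulr hB (l := [seq (p.1 * wword v, p.2 * wword v) | p <- splits_tens w]) _ Ux Ux').
- rewrite -map_comp big_map; apply: eq_bigr => p _ /=.
  rewrite -scalerAl pairZl ?Hx' //; last exact/UleM/Uv/Ule_fword.
  by rewrite -mulrA -wword_cat Hx.
- by apply/UleM/Uv/Ule_fword.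
- move=> _ /mapP[p /splits_Ule[U1 U2] ->]; split; exact: UleM.
- rewrite rmorphM /= Delta_fword Delta_wword mulr_suml big_map.
  by apply: eq_bigr => p _; rewrite tens_mul.
Qed.

Lemma w'freeM x x' : w'free x -> w'free x' -> w'free (x * x').
Proof.
move=> fx fx'; split; first by apply: UgeM; [case: fx|case: fx'].
move=> w v; rewrite pair_fwordM_aux //.
by have := pair_fwordM_aux w [::] fx fx'; rewrite {1}/wword big_nil mulr1 => ->.
Qed.

Lemma pair_fwordM w x x' : w'free x -> w'free x' -> B (fword w) (x * x') =
    \sum_(p <- splits w) p.1.1 * B (fword p.1.2) x' * B (fword p.2) x.
Proof.
move=> fx fx'; have := pair_fwordM_aux w [::] fx fx'.
by rewrite {1}/wword big_nil mulr1.
Qed.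

Lemma w'freeB c x x' : w'free x -> w'free x' -> w'free (x - c *: x').
Proof.
move=> [Ux fx] [Ux' fx']; split; first exact/UgeB/UgeZ.
have U w v := UleM (Ule_fword w) (Ule_wword v).
by move=> w v; rewrite !pairBr ?fx ?fx' //; exact: Ule_fword.
Qed.

Hypothesis chis_diag : forall j, chis j j != 1.

Lemma pair_wword_e v j : B (wword v) (e j) = 0.
Proof.
elim: v => [|i v IH]; first by rewrite /wword big_nil pair1e.
rewrite wword_cons pairMe; [|exact: Ule_w'|exact: Ule_wword].
by rewrite pairw'e // IH mul0r mulr0 addr0.
Qed.

Lemma pair_wword1 v : B (wword v) 1 = 1.
Proof.
elim: v => [|i v IH]; first by rewrite /wword big_nil pair11.
rewrite wword_cons pairM1; [|exact: Ule_w'|exact: Ule_wword].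
by rewrite pairw1 IH mulr1.
Qed.

Lemma w'free_e j : w'free (e j).
Proof.
split=> [|w v]; first exact: Uge_e.
rewrite pairMe; [|exact: Ule_fword|exact: Ule_wword].
by rewrite pair_wword_e pair_wword1 mulr1 mulr0 addr0.
Qed.

Definition kappa j : K := (s_ s t j - r_ r t j)^-1.

Lemma pair_fword1 w : B (fword w) 1 = (w == [::])%:R.
Proof.
case: w => [|i w]; first by rewrite /fword big_nil pair11.
rewrite fword_cons pairM1; [|exact: Ule_f|exact: Ule_fword].
by rewrite pairf1 mul0r.
Qed.

Lemma pair_fword_e w j : B (fword w) (e j) = kappa j * (w == [:: j])%:R.
Proof.
case: w => [|i w]; first by rewrite /fword big_nil pair1e mulr0.
rewrite fword_cons pairMe; [|exact: Ule_f|exact: Ule_fword].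
rewrite (hopf_fw hB) mul0r addr0 (hopf_fe hB) pair_fword1 eqseq_cons -mulnb natrM.
by have [->|_] := i =P j; rewrite /kappa ?(mul0r, mulr0) // mul1r mul1r.
Qed.

(** * Support of the functionals of the e and coefficients of the f *)

Definition pairs_as u u' b k x :=
  w'free x /\ forall w, B (fword w) x = k * ((w == u)%:R + b * (w == u')%:R).

(** A product with e_j turns into a shuffle with the letter j by [pair_fwordM] and [sum_splits]. As
    u and u' have equal characters against j, one scalar in the commutator fits both words. *)
Lemma pairs_as_comm u u' b k x j : pairs_as u u' b k x ->
    pairw chis [:: j] u' = pairw chis [:: j] u -> forall w,
  B (fword w) (x * e j - pairw chis [:: j] u *: (e j * x)) =
    k * kappa j * pairw chis [:: j] u * (commcoef (scl_pair r s t j) (symc r s t j) j u w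
      + b * commcoef (scl_pair r s t j) (symc r s t j) j u' w).
Proof.
move=> [fx Ex] euu' w; have fj := w'free_e j.
have Uxj := w'freeM fx fj; have Ujx := w'freeM fj fx.
rewrite pairBr ?pair_fwordM //; [|exact: Ule_fword|by case: Uxj|by case: Ujx].
have -> : \sum_(p <- splits w) p.1.1 * B (fword p.1.2) (e j) * B (fword p.2) x =
    k * kappa j * (shcoef chis w [:: j] u + b * shcoef chis w [:: j] u').
  rewrite -!sum_splits mulr_sumr -big_split mulr_sumr; apply: eq_bigr => p _.
  by rewrite pair_fword_e Ex /=; ring_atoms.
have -> : \sum_(p <- splits w) p.1.1 * B (fword p.1.2) x * B (fword p.2) (e j) =
    k * kappa j * (shcoef chis w u [:: j] + b * shcoef chis w u' [:: j]).
  rewrite -!sum_splits mulr_sumr -big_split mulr_sumr; apply: eq_bigr => p _.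
  by rewrite pair_fword_e Ex /=; ring_atoms.
have := shcoef_comm_pair t r0 s0 w u j; have := shcoef_comm_pair t r0 s0 w u' j.
rewrite euu' => E1 E2.
rewrite -[RHS]mulrA [X in _ = _ * X]mulrDr (mulrCA (pairw _ _ _) b) -E1 -E2; ring.
Qed.

Definition Ule_linear (L : A -> K) := forall c y y', Ule y -> Ule y' ->
  L (c *: y + y') = c * L y + L y'.

(* y is a combination of words in the f_i in which u has coefficient c and u'  *)
(* does not occur.                                                             *)
Definition fcoef u u' c y := Ule y /\ forall L, Ule_linear L ->
  (forall w, perm_eq w u -> w != u -> w != u' -> L (fword w) = 0) ->
  L y = c * L (fword u).

Lemma Ule_linear_subZ L c y y' : Ule_linear L -> Ule y -> Ule y' ->
  L (y - c *: y') = L y - c * L y'.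
Proof. by move=> HL Uy Uy'; rewrite addrC -scaleNr HL // addrC mulNr. Qed.

Lemma Ule_linear_mulr L z : Ule z -> Ule_linear L -> Ule_linear (fun y => L (y * z)).
Proof.
by move=> Uz HL c y y' Uy Uy'; rewrite mulrDl -scalerAl HL //; exact: UleM.
Qed.

Lemma Ule_linear_mull L z : Ule z -> Ule_linear L -> Ule_linear (fun y => L (z * y)).
Proof.
by move=> Uz HL c y y' Uy Uy'; rewrite mulrDr -scalerAr HL //; exact: UleM.
Qed.

Lemma Ule_linear_pair x : Uge x -> Ule_linear (B^~ x).
Proof. by move=> Ux c y y' Uy Uy'; rewrite (hopf_linl hB). Qed.

Lemma fcoef_letter j : fcoef [:: j] [:: j] 1 (f j).
Proof. by split=> [|L _ _]; [exact: Ule_f|rewrite fword1 mul1r]. Qed.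

(** Words of f_j y begin with j, unlike u j and v, so the coefficient of u j comes from - k y f_j
    alone; there v could only arise from u', which y does not contain. *)
Lemma fcoef_comm u u' v c k y j : fcoef u u' c y ->
    (forall w, j :: w <> rcons u j) -> (forall w, j :: w <> v) ->
    (forall w, rcons w j = v -> w = u') ->
  fcoef (rcons u j) v (- k * c) (f j * y - k *: (y * f j)).
Proof.
move=> [Uy Hy] ju jv vj; have Uj := Ule_f j.
have [Ujy Uyj] := (UleM Uj Uy, UleM Uy Uj).
split=> [|L HL L0]; first exact/UleB/UleZ.
rewrite Ule_linear_subZ // (Hy _ (Ule_linear_mull Uj HL)); last first.
  move=> w wu _ _; rewrite -fword_cons L0 //; last by apply/eqP/jv.
    by rewrite perm_sym perm_rcons perm_cons perm_sym.
  exact/eqP/ju.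
rewrite (Hy _ (Ule_linear_mulr Uj HL)) => [|w wu nwu nwu'].
  rewrite -fword_cons L0; first by rewrite -cats1 fword_cat fword1; ring.
  - by rewrite perm_sym perm_rcons.
  - exact/eqP/ju.
  - exact/eqP/jv.
rewrite -fword1 -fword_cat cats1 L0 //.
- by rewrite perm_rcons perm_sym perm_rcons perm_cons perm_sym.
- by apply: contra nwu => /eqP/rcons_inj[->].
- by apply: contra nwu' => /eqP e; rewrite (vj _ e).
Qed.

(** The functional of x lives on u and u', and of these only u occurs in y. *)
Lemma pair_fcoef u u' b k c x y : pairs_as u u' b k x -> fcoef u u' c y ->
  (u' = u -> b = 0) -> B y x = k * c.
Proof.
move=> [[Ux _] Ex] [_ Hy] b0; rewrite (Hy _ (Ule_linear_pair Ux)) => [|w _ wu wu'].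
  rewrite Ex eqxx; have [/esym/b0->|_] := u =P u'; rewrite /=; ring.
by rewrite Ex (negbTE wu) (negbTE wu') /=; ring.
Qed.

Definition ew u := evec_rec r s t g (size u) u.
Definition fw u := fvec_rec r s t g (size u) u.

Lemma size_costd u m : (1 < size u)%N -> (size u <= m.+1)%N ->
  (size (take (costd u) u) <= m)%N /\ (size (drop (costd u) u) <= m)%N.
Proof.
by move=> /costd_bounds/andP[c0 c1] um; rewrite size_take size_drop c1; split; lia.
Qed.

Lemma evec_rec_step m u : (1 < size u)%N -> evec_rec r s t g m.+1 u =
  let u1 := take (costd u) u in let u2 := drop (costd u) u in
  evec_rec r s t g m u1 * evec_rec r s t g m u2
  - pairw chis u2 u1 *: (evec_rec r s t g m u2 * evec_rec r s t g m u1).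
Proof. by case: u => [|i [|j u]] // _; rewrite /= chi_wt. Qed.

Lemma fvec_rec_step m u : (1 < size u)%N -> fvec_rec r s t g m.+1 u =
  let u1 := take (costd u) u in let u2 := drop (costd u) u in
  fvec_rec r s t g m u2 * fvec_rec r s t g m u1
  - (pairw chis u1 u2)^-1 *: (fvec_rec r s t g m u1 * fvec_rec r s t g m u2).
Proof. by case: u => [|i [|j u]] // _; rewrite /= chi_wt. Qed.

(** Both costandard factors are shorter than u, so any bound that reaches the length gives the same
    value. *)
Lemma ew_fuel m u : (size u <= m)%N -> evec_rec r s t g m u = ew u.
Proof.
elim/ltn_ind: m u => -[|m] IH u um; first by case: (u) um.
case: (ltnP 1 (size u)) => [u1|]; last by case: (u) => [|i [|j v]].
rewrite /ew; case E: (size u) => [|k]; first by rewrite E in u1.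
rewrite !evec_rec_step //; have [s1 s2] := size_costd u1 um.
have [s3 s4] := size_costd u1 (eq_leq E).
by rewrite /= !(IH m) // !(IH k) // -E.
Qed.

Lemma fw_fuel m u : (size u <= m)%N -> fvec_rec r s t g m u = fw u.
Proof.
elim/ltn_ind: m u => -[|m] IH u um; first by case: (u) um.
case: (ltnP 1 (size u)) => [u1|]; last by case: (u) => [|i [|j v]].
rewrite /fw; case E: (size u) => [|k]; first by rewrite E in u1.
rewrite !fvec_rec_step //; have [s1 s2] := size_costd u1 um.
have [s3 s4] := size_costd u1 (eq_leq E).
by rewrite /= !(IH m) // !(IH k) // -E.
Qed.

Lemma ewE u : (1 < size u)%N ->
  let u1 := take (costd u) u in let u2 := drop (costd u) u in
  ew u = ew u1 * ew u2 - pairw chis u2 u1 *: (ew u2 * ew u1).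
Proof.
move=> u1; have [s1 s2] := size_costd u1 (leqnSn _).
by rewrite -(ew_fuel (leqnSn _)) evec_rec_step //= !ew_fuel.
Qed.

Lemma fwE u : (1 < size u)%N ->
  let u1 := take (costd u) u in let u2 := drop (costd u) u in
  fw u = fw u2 * fw u1 - (pairw chis u1 u2)^-1 *: (fw u1 * fw u2).
Proof.
move=> u1; have [s1 s2] := size_costd u1 (leqnSn _).
by rewrite -(fw_fuel (leqnSn _)) fvec_rec_step //= !fw_fuel.
Qed.

Lemma ew_rcons u j : u != [::] -> headmin (rcons u j) ->
  ew (rcons u j) = ew u * e j - pairw chis [:: j] u *: (e j * ew u).
Proof.
move=> u0 hu; have u1 : (1 < size (rcons u j))%N.
  by rewrite size_rcons ltnS lt0n size_eq0.
by rewrite ewE //= costd_headmin // -cats1 take_size_cat // drop_size_cat.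
Qed.

Lemma fw_rcons u j : u != [::] -> headmin (rcons u j) ->
  fw (rcons u j) = f j * fw u - (pairw chis u [:: j])^-1 *: (fw u * f j).
Proof.
move=> u0 hu; have u1 : (1 < size (rcons u j))%N.
  by rewrite size_rcons ltnS lt0n size_eq0.
by rewrite fwE //= costd_headmin // -cats1 take_size_cat // drop_size_cat.
Qed.

(** * Adjoining a last letter *)

Implicit Types (a : seq 'I_n).

(* u is dominant and N is the pairing of its root vectors, in a form that      *)
(* survives the adjunction of a last letter; u' is the companion word in type  *)
(* D, and u' = u otherwise.                                                    *)
Definition rootword u u' (N : K) := exists b0 b k c,
  [/\ u' = u -> b0 = 0 /\ b = 0,
      shufU r s t (wbasis K u + b0 *: wbasis K u'),
      pairs_as u u' b k (ew u), fcoef u u' c (fw u) & N = k * c].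

Lemma rootword_pair u u' N : rootword u u' N -> B (fw u) (ew u) = N.
Proof.
by case=> [b0 [b [k [c [E _ Ru Fu ->]]]]]; apply: (pair_fcoef Ru Fu) => /E[].
Qed.

Lemma rootword_dominant u u' N : rootword u u' N -> (u' != u -> wordlt u' u) ->
  dominant r s t u.
Proof.
case=> [b0 [b [k [c [E Su _ _ _]]]]] uu'; apply: (dominant_pair Su).
by case: eqP uu' => [/E[-> _]|_ ->].
Qed.

Lemma rootword_letter j : rootword [:: j] [:: j] (kappa j).
Proof.
exists 0, 0, (kappa j), 1; split=> //; last by rewrite mulr1.
- by rewrite scale0r addr0; apply: shufU_letter.
- split; first exact: w'free_e.
  by move=> w; rewrite /ew /= pair_fword_e mul0r addr0.
- exact: fcoef_letter.
Qed.

Definition adjoins j u k (th : 'I_n -> K) := forall w,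
  commcoef th (symc r s t j) j u w = k * (w == rcons u j)%:R.

Lemma headmin_rcons_neq u j w : u != [::] -> headmin (rcons u j) -> j :: w <> rcons u j.
Proof. by case: u => //= i u _ + [ji _]; rewrite -ji all_rcons ltnn. Qed.

(** The functional of e gains kappa_j chi(j,u) k and the coefficient in f gains - chi(u,j)^-1. The
    scalar k0 is the analogue of k in the shuffle algebra, where it only has to be invertible. *)
Lemma rootword_adjoin u u' N j k0 k : rootword u u' N ->
    u != [::] -> headmin (rcons u j) -> u' != [::] -> headmin (rcons u' j) ->
    perm_eq u' u -> k0 != 0 ->
    adjoins j u k0 (scl_shuf r s t j) -> adjoins j u' k0 (scl_shuf r s t j) ->
    adjoins j u k (scl_pair r s t j) -> adjoins j u' k (scl_pair r s t j) ->
  rootword (rcons u j) (rcons u' j)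
    (- (N * kappa j * k * pairw chis [:: j] u / pairw chis u [:: j])).
Proof.
case=> [b0 [b [kx [c [E Su Ru Fu ->]]]]] u0 hu u'0 hu' uu' k00 A0 A0' A1 A1'.
have euu' : pairw chis [:: j] u' = pairw chis [:: j] u.
  by rewrite /pairw !big_seq1; apply: perm_big.
exists b0, b, (kx * kappa j * pairw chis [:: j] u * k), (- (pairw chis u [:: j])^-1 * c).
split.
- by move=> /rcons_inj[/E].
- exact: shufU_adjoin Su euu' A0 A0'.
- have [fx _] := Ru; split.
    by rewrite ew_rcons //; apply: w'freeB; apply: w'freeM => //; apply: w'free_e.
  move=> w; rewrite ew_rcons // (pairs_as_comm Ru) // A1 A1'; ring_atoms.
- rewrite fw_rcons //; apply: fcoef_comm Fu _ _ _.
  + by move=> w; apply: headmin_rcons_neq.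
  + by move=> w; apply: headmin_rcons_neq.
  + by move=> w /rcons_inj[].
- ring.
Qed.

Definition orth j := [pred i | (chis i j == 1) && (chis j i == 1)].

Lemma orth_inert_shuf j a : all (orth j) a ->
  all (inert (scl_shuf r s t j) (symc r s t j)) a.
Proof.
apply: sub_all => i /andP[/eqP ij /eqP ji].
by rewrite inE /scl_shuf /symc ij ji invr1 mulr1 !eqxx.
Qed.

Lemma orth_inert_pair j a : all (orth j) a ->
  all (inert (scl_pair r s t j) (symc r s t j)) a.
Proof.
apply: sub_all => i /andP[/eqP ij /eqP ji].
by rewrite inE /scl_pair /symc ij ji invr1 mulr1 !eqxx.
Qed.

Lemma orth_pairw j a : all (orth j) a ->
  pairw chis a [:: j] = 1 /\ pairw chis [:: j] a = 1.
Proof.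
elim: a => [|i a IH] /=; first by rewrite pairw0l pairw0r.
move=> /andP[/andP[/eqP ij /eqP ji] /IH[ea ea']].
by rewrite pairw_consl (pairw_consr _ _ i) !pairw11 ij ji ea ea' !mulr1.
Qed.

(* Commuting with the letter j turns the word u into the word uj.              *)
Definition closing j u :=
  let S := pairw chis u [:: j] * pairw chis [:: j] u in
  adjoins j u ((pairw chis u [:: j])^-1 * (1 - S)) (scl_shuf r s t j) /\
  adjoins j u ((pairw chis [:: j] u)^-1 * (1 - S)) (scl_pair r s t j).

Lemma closing_last j a (x : 'I_n) : all (orth j) a -> closing j (a ++ [:: x]).
Proof.
move=> oa; have [ea ea'] := orth_pairw oa.
rewrite /closing pairw_catl pairw_catr ea ea' !mul1r !pairw11.
split=> w; rewrite commcoef_last -?cats1 -?catA //.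
  exact: orth_inert_shuf.
exact: orth_inert_pair.
Qed.

Local Ltac chis_atoms nz := repeat match goal with |- context [ chis ?i ?j ] =>
  move: (nz n i j); generalize (chis i j) => ? ? end.

Let diag_shuf j : scl_shuf r s t j j ^+ 2 * symc r s t j j = 1.
Proof. by have := chis_neq0 t r0 s0 j j => ?; rewrite /scl_shuf /symc; field. Qed.
Let diag_pair j : scl_pair r s t j j ^+ 2 * symc r s t j j = 1.
Proof. by have := chis_neq0 t r0 s0 j j => ?; rewrite /scl_pair /symc; field. Qed.

(** The condition on x makes the insertions around the letter j cancel. This serves the first
    descending letter in type C, with z the last node. *)
Lemma closing_short j a (x z : 'I_n) : all (orth j) a -> symc r s t j x = (chis j j)^-1 ->
  closing j (a ++ [:: x; j; z]).
Proof.
move=> oa sx; have [ea ea'] := orth_pairw oa.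
have e1 : pairw chis [:: x; j; z] [:: j] = chis x j * chis j j * chis z j.
  by rewrite (pairw_consl _ x) (pairw_consl _ j) !pairw11 mulrA.
have e2 : pairw chis [:: j] [:: x; j; z] = chis j x * chis j j * chis j z.
  by rewrite (pairw_consr _ _ x) (pairw_consr _ _ j) !pairw11 mulrA.
rewrite /closing pairw_catl pairw_catr ea ea' !mul1r e1 e2.
have nz := chis_neq0 t r0 s0.
split=> w.
  rewrite commcoef_short; [|exact: diag_shuf|exact: orth_inert_shuf|exact: sx].
  rewrite -cats1 -catA; congr (_ * _); rewrite /scl_shuf /symc.
  by chis_atoms nz; field; do ?[apply/andP; split].
rewrite commcoef_short; [|exact: diag_pair|exact: orth_inert_pair|exact: sx].
rewrite -cats1 -catA; congr (_ * _); rewrite /scl_pair /symc.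
by chis_atoms nz; field; do ?[apply/andP; split].
Qed.

(** The neighbours x and y of j both satisfy chi(x,j) chi(j,x) = chi(j,j)^-1. Hence the insertions
    around j cancel and x j y has total symmetric character 1 against j, so only z remains to
    count. *)
Lemma closing_long j a (x y : 'I_n) (c : seq 'I_n) (z : 'I_n) : all (orth j) a -> all (orth j) c ->
    symc r s t j x = (chis j j)^-1 -> symc r s t j y = (chis j j)^-1 ->
  closing j (a ++ [:: x; j; y] ++ c ++ [:: z]).
Proof.
move=> oa oc sx sy; have [ea ea'] := orth_pairw oa; have [ec ec'] := orth_pairw oc.
have nz := chis_neq0 t r0 s0.
have e1 : pairw chis [:: x; j; y] [:: j] = chis x j * chis j j * chis y j.
  by rewrite (pairw_consl _ x) (pairw_consl _ j) !pairw11 mulrA.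
have e2 : pairw chis [:: j] [:: x; j; y] = chis j x * chis j j * chis j y.
  by rewrite (pairw_consr _ _ x) (pairw_consr _ _ j) !pairw11 mulrA.
have sxy : symc r s t j x * symc r s t j j * symc r s t j y = 1.
  by rewrite sx sy /symc; field; rewrite nz.
have sE : chis x j * chis j j * chis y j * (chis j x * chis j j * chis j y) = 1.
  by rewrite -[RHS]sxy /symc; ring.
rewrite /closing !pairw_catl !pairw_catr ea ea' ec ec' !mul1r e1 e2 !pairw11.
rewrite [X in 1 - X](_ : _ = symc r s t j z); last first.
  by rewrite mulrACA sE mul1r.
split=> w.
  rewrite commcoef_long; [|exact: diag_shuf|exact: orth_inert_shuf|exact: orth_inert_shuf
    |exact: sx|exact: sxy].
  rewrite -cats1 -!catA; congr (_ * _); rewrite /scl_shuf.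
  by move: (symc _ _ _ _ _) => ?; chis_atoms nz; field; do ?[apply/andP; split].
rewrite commcoef_long; [|exact: diag_pair|exact: orth_inert_pair|exact: orth_inert_pair
  |exact: sx|exact: sxy].
rewrite -cats1 -!catA; congr (_ * _); rewrite /scl_pair.
by move: (symc _ _ _ _ _) => ?; chis_atoms nz; field; do ?[apply/andP; split].
Qed.

(** Here k = chi(j,u)^-1 (1 - chi(u,j) chi(j,u)), and the factor of [rootword_adjoin] simplifies. *)
Lemma rootword_closing u u' N j : rootword u u' N ->
    u != [::] -> headmin (rcons u j) -> perm_eq u' u -> headmin (rcons u' j) ->
    pairw chis u [:: j] * pairw chis [:: j] u != 1 -> closing j u -> closing j u' ->
  rootword (rcons u j) (rcons u' j)
    (N * kappa j * (pairw chis [:: j] u - (pairw chis u [:: j])^-1)).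
Proof.
move=> Ru u0 hu uu' hu' S1 [A0 A1] [A0' A1'].
have u'0 : u' != [::] by rewrite -size_eq0 (perm_size uu') size_eq0.
have e1 : pairw chis u' [:: j] = pairw chis u [:: j] by apply: perm_big.
have e2 : pairw chis [:: j] u' = pairw chis [:: j] u.
  by rewrite /pairw !big_seq1; apply: perm_big.
rewrite e1 e2 in A0' A1'.
have nz1 := pairw_neq0 t r0 s0 u [:: j]; have nz2 := pairw_neq0 t r0 s0 [:: j] u.
have k0 : (pairw chis u [:: j])^-1 * (1 - pairw chis u [:: j] * pairw chis [:: j] u) != 0.
  by rewrite mulf_neq0 ?invr_neq0 // subr_eq0 eq_sym.
have := rootword_adjoin Ru u0 hu u'0 hu' uu' k0 A0 A0' A1 A1'.
by congr rootword; field; apply/andP.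
Qed.

(** The surviving insertion follows x, so the scale is that of x alone, and the letter j already
    present drops out of chi(j,u) / chi(u,j). *)
Lemma rootword_double a (x j : 'I_n) N : rootword (a ++ [:: x; j]) (a ++ [:: x; j]) N ->
    headmin (a ++ [:: x; j; j]) -> all (orth j) a ->
    symc r s t j x * symc r s t j j = 1 -> symc r s t j x != 1 ->
  rootword (a ++ [:: x; j; j]) (a ++ [:: x; j; j])
    (N * kappa j * (chis j x - (chis x j)^-1)).
Proof.
move=> Ru hu oa sxj sx1; have [ea ea'] := orth_pairw oa.
have nz := chis_neq0 t r0 s0.
have e : a ++ [:: x; j; j] = rcons (a ++ [:: x; j]) j by rewrite -cats1 -catA.
have u0 : a ++ [:: x; j] != [::] by case: (a).
have k00 : scl_shuf r s t j x * (1 - symc r s t j x) != 0.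
  by rewrite mulf_neq0 ?invr_neq0 // subr_eq0 eq_sym.
rewrite e in hu *; have := rootword_adjoin Ru u0 hu u0 hu (perm_refl _) k00.
move=> /(_ (scl_pair r s t j x * (1 - symc r s t j x))).
have A0 : adjoins j (a ++ [:: x; j]) (scl_shuf r s t j x * (1 - symc r s t j x)) (scl_shuf r s t j).
  by move=> w; rewrite commcoef_double -?e //; apply: orth_inert_shuf.
have A1 : adjoins j (a ++ [:: x; j]) (scl_pair r s t j x * (1 - symc r s t j x)) (scl_pair r s t j).
  by move=> w; rewrite commcoef_double -?e //; apply: orth_inert_pair.
move=> /(_ A0 A0 A1 A1); congr rootword.
rewrite pairw_catl pairw_catr ea ea' !mul1r.
rewrite (pairw_consl _ x) (pairw_consr _ _ x) !pairw11 /scl_pair /symc.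
by field; rewrite !nz.
Qed.

(** A word without companion acquires one here: y and j have trivial symmetric character, so j may
    be inserted on either side of y. *)
Lemma rootword_fork a (x y j : 'I_n) N : rootword (a ++ [:: x; y]) (a ++ [:: x; y]) N ->
    headmin (a ++ [:: x; y; j]) -> all (orth j) a -> x != j -> y != j ->
    symc r s t j y = 1 -> symc r s t j x != 1 ->
  let u := a ++ [:: x; y] in
  rootword (a ++ [:: x; y; j]) (a ++ [:: x; j; y])
    (N * kappa j * (pairw chis [:: j] u - (pairw chis u [:: j])^-1)).
Proof.
move=> [b0 [b [k [c [E Su Ru Fu ->]]]]] hu oa xj yj sy sx u; have [ea ea'] := orth_pairw oa.
have [b00 b1] := E erefl; rewrite {}b00 {}b1 in Su Ru.
have nz := chis_neq0 t r0 s0.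
have e : a ++ [:: x; y; j] = rcons u j by rewrite -cats1 -catA.
have u0 : u != [::] by rewrite /u; case: (a).
have eu1 : pairw chis u [:: j] = chis x j * chis y j.
  by rewrite pairw_catl ea mul1r (pairw_consl _ x) !pairw11.
have eu2 : pairw chis [:: j] u = chis j x * chis j y.
  by rewrite pairw_catr ea' mul1r (pairw_consr _ _ x) !pairw11.
have sxn : (1 - symc r s t j x) != 0 by rewrite subr_eq0 eq_sym.
(* The ratio of the two surviving weights is the inverse of [th y], in the shuffle scale and in the
   pairing scale respectively. *)
exists (chis y j), (chis j y),
  (k * kappa j * pairw chis [:: j] u *
    (scl_pair r s t j x * scl_pair r s t j y * (1 - symc r s t j x))),
  (- (pairw chis u [:: j])^-1 * c); split.
- move=> /eqP; rewrite eqseq_cat // eqxx /= eqseq_cons.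
  by rewrite eqseq_cons [j == y]eq_sym (negbTE yj) andbF.
- have [z Uz Ez] := shufU_comm r0 s0 Su (erefl (pairw chis [:: j] u)).
  have := shufU_scale (scl_shuf r s t j x * scl_shuf r s t j y * (1 - symc r s t j x))^-1 Uz.
  congr shufU; apply/malgP => w; rewrite mcoeffZ mcoeffD mcoeffZ !wbasisE Ez.
  rewrite mul0r addr0 commcoef_fork //; last exact: orth_inert_shuf.
  by rewrite /scl_shuf; field; rewrite !nz sxn.
- have [fx _] := Ru; rewrite e; split.
    by rewrite ew_rcons -?e //; apply: w'freeB; apply: w'freeM => //; apply: w'free_e.
  move=> w; rewrite ew_rcons -?e // (pairs_as_comm Ru) // mul0r addr0.
  rewrite commcoef_fork //; last exact: orth_inert_pair.
  by rewrite /scl_pair; field; rewrite !nz.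
- have hu' : headmin (rcons u j) by rewrite -e.
  rewrite e fw_rcons //; apply: (fcoef_comm _ Fu).
  + by move=> w; apply: headmin_rcons_neq.
  + move=> w; case: (a) hu => [|i a'] /= hu.
      by move=> [xj' _]; rewrite xj' eqxx in xj.
    move=> [ji _]; move: hu; rewrite all_cat /= -ji => /andP[_].
    by rewrite ltnn !andbF.
  + move=> w; rewrite -[[:: x; j; y]]/(rcons [:: x; j] y) -rcons_cat => /rcons_inj[_ jy].
    by rewrite jy eqxx in yj.
- rewrite eu1 eu2 /symc /scl_pair.
  have : chis y j = (chis j y)^-1 by apply: (mulIf (nz _ j y)); rewrite mulVf ?nz.
  by move=> ->; field; rewrite !nz.
Qed.

(** * The word m m j, for beta_ii in type C *)

Section Square.
Variables (m : seq 'I_n) (j : 'I_n) (Na Nb : K).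
Hypotheses (hm : headmin m) (mj : all (fun k : 'I_n => k < j)%N m).
Hypotheses (Rm : rootword m m Na) (Rmj : rootword (m ++ [:: j]) (m ++ [:: j]) Nb).
Hypothesis cl : closing j m.
Hypothesis mm1 : 1 + pairw chis m m != 0.
Hypothesis mmj1 : 1 - pairw chis m m * pairw chis m [:: j] * pairw chis [:: j] m != 0.

Let M := m ++ m ++ [:: j].

Let jm : j \notin m.
Proof. by apply/negP => /(allP mj); rewrite ltnn. Qed.

Let m_cons : exists i m', [/\ m = i :: m', i \notin m', i != j
  & all (fun k : 'I_n => i < k)%N m'].
Proof.
case: m hm mj => // i m' im' /andP[ij _]; exists i, m'; split=> //.
  by apply/negP => /(allP im'); rewrite ltnn.
by rewrite -val_eqE neq_ltn ij.
Qed.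

(** The head i of m occurs once in w. Once one factor has supplied it, the other factor still starts
    with i and cannot contribute to the rest of w, so w is read off a single factor. *)
Let shcoef_square P w u v z : perm_eq w m ->
  shcoef P (w ++ z) (m ++ u) (m ++ v) = (w == m)%:R *
    (pairw P m (m ++ v) * shcoef P z u (m ++ v) + shcoef P z (m ++ u) v) :> K.
Proof.
have [i [m' [-> im' _ _]]] := m_cons; case: w => [|h w]; first by move/perm_size.
move=> wm /=; rewrite eqseq_cons; move: wm; have [->|_] := h =P i; last first.
  by rewrite !mul0r addr0.
rewrite perm_cons => wm; have iw : i \notin w by rewrite (perm_mem wm).
rewrite !mul1r shcoef_prefixl ?shcoef_prefixr ?(perm_size wm) //=.
by rewrite (pairw_consl _ i m'); ring_atoms.
Qed.

(** Before a is exhausted, w can leave it only by ending or by taking the head i of the other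
    factor, which is below every letter of a. *)
Let lex_prefix P (i : 'I_n) a w u v : all (fun k : 'I_n => i < k)%N a ->
  shcoef P w (a ++ u) (i :: v) != 0 :> K \/ shcoef P w (i :: v) (a ++ u) != 0 :> K ->
  (exists z, w = a ++ z) \/ forall z, wordlt w (a ++ z).
Proof.
elim: a w => [|x a IH] [|h w] /=; [by left; exists [::]|by left; exists (h :: w)| |].
  by move=> _ _; right.
move=> /andP[ix ia] nz; have [hx|hx] := eqVneq h x.
  have hi : (h == i) = false by rewrite hx -val_eqE gtn_eqF.
  case: (IH w ia).
  - by case: nz; rewrite hi !mul0r ?addr0 ?add0r => nz; [left|right];
      apply: contraNneq nz => ->; rewrite mulr0.
  - by case=> z ->; left; exists z; rewrite hx.
  - by move=> wz; right => z; rewrite wordlt_cons hx eqxx wz orbT.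
have hi : h = i.
  apply/eqP; case: nz; rewrite (negbTE hx) !mul0r ?addr0 ?add0r; apply: contraNT.
    by move=> /negbTE->; rewrite mul0r eqxx.
  by move=> /negbTE->; rewrite !mul0r eqxx.
by right => z; rewrite wordlt_cons hi ix.
Qed.

(** For the leading word of a shuffle only words starting with m matter, and their coefficients are
    given by [shcoef_square]. *)
Let lex_square P w u v : shcoef P w (m ++ u) (m ++ v) != 0 :> K ->
  (exists z, w = m ++ z) \/ forall z, wordlt w (m ++ z).
Proof.
have [i [m' [-> _ _ im']]] := m_cons; case: w => [|h w]; first by right.
have [->|hi] := eqVneq h i; last by rewrite /= (negbTE hi) !mul0r addr0 eqxx.
rewrite [shcoef _ _ _ _]/= eqxx !mul1r => nz.
have : (exists z, w = m' ++ z) \/ forall z, wordlt w (m' ++ z).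
  have [e|] := eqVneq (shcoef P w (m' ++ u) (i :: m' ++ v)) 0; last first.
    by move=> ?; apply: (lex_prefix (P := P) (u := u) (v := m' ++ v) im'); left.
  apply: (lex_prefix (P := P) (u := v) (v := m' ++ u) im'); right.
  by move: nz; rewrite e mulr0 add0r.
by case=> [[z ->]|wz]; [left; exists z|right => z; rewrite wordlt_cons eqxx wz orbT].
Qed.

(** The q-commutator of m and m j is used. At words m z its coefficients reduce to those of the
    commutator of m with the letter j, which [cl] concentrates at z = m j. *)
Lemma square_dominant : dominant r s t M.
Proof.
case: Rm => b0 [b [k [c [/(_ erefl)[-> _] Sm _ _ _]]]].
case: Rmj => b0' [b' [k' [c' [/(_ erefl)[-> _] Smj _ _ _]]]].
rewrite scale0r addr0 in Sm; rewrite scale0r addr0 in Smj.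
pose x := shuffle r s t (wbasis K m) (wbasis K (m ++ [:: j]))
  - pairw chis (m ++ [:: j]) m *: shuffle r s t (wbasis K (m ++ [:: j])) (wbasis K m).
have Ux : shufU r s t x by apply: shufU_sub; [|apply: shufU_scale]; apply: shufU_mul.
have Ex w : x@_w = shcoef (chisV r s t (n := n)) w m (m ++ [:: j])
    - pairw chis (m ++ [:: j]) m * shcoef (chisV r s t (n := n)) w (m ++ [:: j]) m.
  by rewrite mcoeffB mcoeffZ !shuffle_wbasis.
have nz1 := pairw_neq0 t r0 s0 m m; have nz2 := pairw_neq0 t r0 s0 m [:: j].
have Em z : x@_(m ++ z) = (1 + pairw chis m m)
    * (1 - pairw chis m m * pairw chis m [:: j] * pairw chis [:: j] m)
    / (pairw chis m m * pairw chis m [:: j]) * (z == rcons m j)%:R.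
  rewrite Ex.
  have := shcoef_square (chisV r s t (n := n)) [::] [:: j] z (perm_refl m).
  have := shcoef_square (chisV r s t (n := n)) [:: j] [::] z (perm_refl m).
  rewrite !cats0 eqxx !mul1r => -> ->; rewrite shcoef_nill shcoef_nilr.
  have := shcoef_comm_shuf t r0 s0 z m j; rewrite cl.1 => /eqP; rewrite subr_eq => /eqP->.
  rewrite cats1 pairw_rconsl !pairwV pairw_rconsr.
  by set q := (z == _)%:R; field; apply/andP.
exists x; split=> //.
  rewrite -mcoeff_neq0 Em -cats1 eqxx mulr1 !mulf_neq0 ?invr_neq0 //.
  by rewrite mulf_neq0.
move=> w; rewrite -mcoeff_neq0 => xw wM.
have : (exists z, w = m ++ z) \/ forall z, wordlt w (m ++ z).
  have [e|] := eqVneq (shcoef (chisV r s t (n := n)) w m (m ++ [:: j])) 0; last first.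
    by rewrite -{1}(cats0 m); apply: lex_square.
  have := xw; rewrite Ex e sub0r oppr_eq0 mulf_eq0 negb_or => /andP[_].
  by rewrite -{2}(cats0 m); apply: lex_square.
case=> [[z ez]|]; last by move=> /(_ (m ++ [:: j])).
move: xw wM; rewrite ez Em /M eqseq_cat // eqxx -cats1 /=.
by have [->|] := z =P _; rewrite ?eqxx // mulr0 eqxx.
Qed.

(** The two occurrences of y are expanded one after the other; whenever a slot holds a word other
    than m, the value is 0. *)
Let two_slots L p q v c y : Ule_linear L -> fcoef m m c y ->
    (forall w w', perm_eq w m -> perm_eq w' m -> (w == m) && (w' == m) = false ->
      L (fword (p ++ w ++ q ++ w' ++ v)) = 0) ->
  L (fword p * y * fword q * y * fword v) = c ^+ 2 * L (fword (p ++ m ++ q ++ m ++ v)).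
Proof.
move=> HL [Uy Fy] L0.
have U := Ule_fword.
have sand (a1 a2 : A) : Ule a1 -> Ule a2 -> Ule_linear (fun z => L (a1 * z * a2)).
  move=> Ua Ub c' z z' Uz Uz'.
  by rewrite mulrDr mulrDl -scalerAr -scalerAl HL //; apply: UleM => //; apply: UleM.
have E2 w : perm_eq w m -> L (fword p * fword w * fword q * y * fword v) =
    (w == m)%:R * c * L (fword (p ++ m ++ q ++ m ++ v)).
  move=> wm; rewrite (Fy _ (sand _ _ (UleM (UleM (U p) (U w)) (U q)) (U v))).
    rewrite -!fword_cat -!catA; have [->|wm'] := w =P m; first by rewrite mul1r.
    by rewrite L0 ?mulr0 ?mul0r //; apply/andP => -[/eqP].
  by move=> w' wm' nw' _; rewrite -!fword_cat -!catA L0 // (negbTE nw') andbF.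
have Fz : L (fword p * y * (fword q * y * fword v)) =
    c * L (fword p * fword m * (fword q * y * fword v)).
  apply: (Fy _ (sand _ _ (U p) (UleM (UleM (U q) Uy) (U v)))).
  by move=> w wm nw _; rewrite !mulrA E2 // (negbTE nw) !mul0r.
by move: Fz; rewrite !mulrA => ->; rewrite E2 // eqxx mul1r mulrA expr2.
Qed.

(** Expanding f_(mj) = f_j f_m - k f_m f_j turns f_M into terms of the shapes j m m, m j m and m m
    j. The first two pair to 0 with e_M, so only m m j counts, with coefficient k k'. *)
Lemma square_pair : B (fw M) (ew M) = - (Na * Nb) * (1 + pairw chis m m)
    * (1 - pairw chis m m * pairw chis m [:: j] * pairw chis [:: j] m)
    / (pairw chis m m * pairw chis m [:: j]).
Proof.
have [i [m' [em im' ij im]]] := m_cons.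
have m0 : m != [::] by rewrite em.
have hmj : headmin (rcons m j).
  by rewrite em /= all_rcons im andbT; move: mj; rewrite em => /andP[].
case: Rm => b0 [b [ka [ca [/(_ erefl)[_ ->] _ Pm Fm ENa]]]].
have ENb := rootword_pair Rmj.
case: Rmj => b0' [b' [kb [cb [/(_ erefl)[_ ->] _ Pmj _ _]]]].
set k := (pairw chis m [:: j])^-1.
have Fmj : fcoef (rcons m j) (rcons m j) (- k * ca) (fw (rcons m j)).
  rewrite fw_rcons //; apply: (fcoef_comm _ Fm) => w.
  - exact: headmin_rcons_neq.
  - exact: headmin_rcons_neq.
  - by case/rcons_inj.
have {}ENb : Nb = kb * (- k * ca).
  by rewrite -ENb; apply: (pair_fcoef Pmj) => //; rewrite cats1.
have M1 : (1 < size M)%N by rewrite /M !size_cat addn1 addnS ltnS; case: (m) m0.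
have [fm Em] := Pm; have [fmj Emj] := Pmj.
have eM : ew M = ew m * ew (m ++ [:: j])
    - pairw chis (m ++ [:: j]) m *: (ew (m ++ [:: j]) * ew m).
  by rewrite ewE //= costd_square // take_size_cat // drop_size_cat.
have fM : fw M = fw (m ++ [:: j]) * fw m
    - (pairw chis m (m ++ [:: j]))^-1 *: (fw m * fw (m ++ [:: j])).
  by rewrite fwE //= costd_square // take_size_cat // drop_size_cat.
have free1 := w'freeM fm fmj; have free2 := w'freeM fmj fm.
have UM : Uge (ew M) by rewrite eM; case: (w'freeB (pairw chis (m ++ [:: j]) m) free1 free2).
have HL := Ule_linear_pair UM; set L := B^~ _ in HL.
have PsiE w : L (fword w) = ka * kb * (shcoef chis w (m ++ [:: j]) m
    - pairw chis (m ++ [:: j]) m * shcoef chis w m (m ++ [:: j])).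
  rewrite /L eM pairBr ?pair_fwordM //; [|exact: Ule_fword|by case: free1|by case: free2].
  rewrite -!sum_splits mulrBr mulrCA !mulr_sumr.
  by congr (_ - _); apply: eq_bigr => p _; rewrite Em Emj !mul0r !addr0; ring_atoms.
have eMm : pairw chis (m ++ [:: j]) m = pairw chis m m * pairw chis [:: j] m.
  exact: pairw_catl.
have shj w v : shcoef chis (j :: w) m v =
    (if v is x :: v' then (j == x)%:R * shcoef chis w m v' else 0) :> K.
  by rewrite em /= eq_sym (negbTE ij) !mul0r add0r.
have jw w : perm_eq w m -> j \notin w by move=> wm; rewrite (perm_mem wm).
have shjm w v : perm_eq w m -> shcoef chis (w ++ [:: j]) [:: j] m = (w == m)%:R.
  move=> wm; rewrite -{1}(cats0 m) shcoef_prefixr ?(perm_size wm) ?jw //.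
  by rewrite shcoef_nilr eqxx mulr1.
have shmj w v : perm_eq w m ->
    shcoef chis (w ++ [:: j]) m [:: j] = (w == m)%:R * pairw chis m [:: j].
  move=> wm; rewrite -{1}(cats0 m) shcoef_prefixl ?(perm_size wm) ?jw //.
  by rewrite shcoef_nill eqxx mulr1.
(* Neither m nor m j begins with j, hence no shuffle of them does. *)
have Psi1 w w' : L (fword ([:: j] ++ w ++ [::] ++ w' ++ [::])) = 0.
  by rewrite PsiE [_ ++ _]/= em /= ![j == i]eq_sym (negbTE ij) !mul0r !addr0 mulr0 subrr mulr0.
have sq w w' z : perm_eq w m -> perm_eq w' m ->
  (forall u v, shcoef chis (w ++ z) (m ++ u) (m ++ v) = (w == m)%:R *
    (pairw chis m (m ++ v) * shcoef chis z u (m ++ v) + shcoef chis z (m ++ u) v)).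
  by move=> wm _ u v; apply: shcoef_square.
(* For w = w' = m, both products contribute chi(m,m) chi(j,m), and the contributions cancel. *)
have Psi2 w w' : perm_eq w m -> perm_eq w' m -> L (fword ([::] ++ w ++ [:: j] ++ w' ++ [::])) = 0.
  move=> wm wm'; rewrite PsiE cats0.
  have := sq _ _ (j :: w') wm wm' [:: j] [::]; have := sq _ _ (j :: w') wm wm' [::] [:: j].
  rewrite !cats0 => -> ->; rewrite !shcoef_nill !shcoef_nilr shcoef_consl // eqxx shcoef_nill.
  rewrite shj eqxx shcoef_nilr em !eqseq_cons [j == i]eq_sym (negbTE ij) -em eMm.
  by case: (w == m) (w' == m) => [] [] /=; ring.
have Psi3 w w' : perm_eq w m -> perm_eq w' m ->
    L (fword ([::] ++ w ++ [::] ++ w' ++ [:: j])) = (w == m)%:R * (w' == m)%:R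
    * (ka * kb * (1 + pairw chis m m)
        * (1 - pairw chis m m * pairw chis m [:: j] * pairw chis [:: j] m)).
  move=> wm wm'; rewrite PsiE !cat0s.
  have := sq _ _ (w' ++ [:: j]) wm wm' [:: j] [::].
  have := sq _ _ (w' ++ [:: j]) wm wm' [::] [:: j].
  rewrite !cats0 => -> ->; rewrite !shcoef_nill !shcoef_nilr shjm // shmj // eMm.
  rewrite eqseq_cat ?(perm_size wm') // eqxx andbT pairw_catr.
  by case: (w == m) (w' == m) => [] [] /=; ring.
have Uj := Ule_f j; have [Um _] := Fm.
have fmjE : fw (m ++ [:: j]) = f j * fw m - k *: (fw m * f j) by rewrite cats1 fw_rcons.
set k' := (pairw chis m (m ++ [:: j]))^-1 in fM.
(* Empty words fill the slots so that every term has the shape of [two_slots]. *)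
have fME : fw M = fword [:: j] * fw m * fword [::] * fw m * fword [::]
  - k *: (fword [::] * fw m * fword [:: j] * fw m * fword [::])
  - k' *: (fword [::] * fw m * fword [:: j] * fw m * fword [::]
      - k *: (fword [::] * fw m * fword [::] * fw m * fword [:: j])).
  rewrite fM fmjE !fword1 /fword !big_nil !mul1r !mulr1.
  by rewrite mulrBl mulrBr -scalerAl -scalerAr !mulrA.
have UU p q v : Ule (fword p * fw m * fword q * fw m * fword v).
  by have U := Ule_fword; do !apply: UleM.
rewrite -/(L (fw M)) fME !Ule_linear_subZ //; try by do ?[apply: UleB|apply: UleZ].
have Psi3' w w' : perm_eq w m -> perm_eq w' m -> (w == m) && (w' == m) = false ->
    L (fword ([::] ++ w ++ [::] ++ w' ++ [:: j])) = 0.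
  by move=> wm wm'; rewrite Psi3 //; case: (w == m) (w' == m) => [] [] //= _; ring.
rewrite (two_slots HL Fm (fun w w' _ _ _ => Psi1 w w')).
rewrite (two_slots HL Fm (fun w w' wm wm' _ => Psi2 w w' wm wm')).
rewrite (two_slots HL Fm Psi3').
rewrite Psi1 Psi2 // Psi3 // eqxx ENa ENb /k' pairw_catr /k.
have nz1 := pairw_neq0 t r0 s0 m m; have nz2 := pairw_neq0 t r0 s0 m [:: j].
by rewrite /=; field; rewrite nz1 nz2.
Qed.

End Square.

Local Ltac natlia := clear; lia.

(** * Words on the regular nodes *)

Hypotheses (neq_rs : r != s) (neq_rNs : r + s != 0).

(** At a regular node i one has r_i = R and s_i = S. *)
Let c : int := if t is TypeB then 2 else 1.
Let R := r ^ c.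
Let S := s ^ c.

Let R0 : R != 0. Proof. exact: expfz_neq0. Qed.
Let S0 : S != 0. Proof. exact: expfz_neq0. Qed.
Let sqr_neq : s ^+ 2 - r ^+ 2 != 0.
Proof. by rewrite subr_sqr mulf_neq0 // ?[s + r]addrC // subr_eq0 eq_sym. Qed.
Let SR0 : S - R != 0.
Proof. by rewrite /S /R /c; case: (t); rewrite ?expr1z // subr_eq0 eq_sym. Qed.

Let reg (i : 'I_n) := regular t n i.+1.

Let chis_reg_diag (i : 'I_n) : reg i -> chis i i = R / S.
Proof. by move=> ri; rewrite chisE simple_form_reg // eqxx /rspow -invr_expz. Qed.

Let chis_reg_far (i j : 'I_n) : reg i -> reg j -> (i.+1 < j)%N || (j.+1 < i)%N ->
  chis i j = 1 /\ chis j i = 1.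
Proof.
move=> ri rj ij; rewrite !chisE !simple_form_reg // !eqSS.
have [e1 e2 e3 e4] : [/\ (i == j :> nat) = false, (j == i :> nat) = false,
   (i.+1 == j) = false & (j.+1 == i) = false] by move: ij; clear; split; lia.
by rewrite e1 e2 e3 e4 /rspow !oppr0 !expr0z mulr1.
Qed.

(* x precedes j in the Dynkin diagram, in a piece of it without the irregular  *)
(* edges.                                                                      *)
Definition nbr (x j : 'I_n) := chis x j = R^-1 /\ chis j x = S.

Let nbr_reg (i j : 'I_n) : reg i -> reg j -> i.+1 = j -> nbr i j.
Proof.
move=> ri rj ij; rewrite /nbr !chisE !simple_form_reg // !eqSS ij.
have [e1 e2 e3 e4] : [/\ (i == j :> nat) = false, (j == i :> nat) = false,
   (i.+1 == j) = true & (j.+1 == i) = false] by move: ij; clear; split; lia.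
by rewrite -ij eqxx ij e1 e2 e4 /rspow oppr0 opprK expr0z mulr1 mul1r invr_expz.
Qed.

Let kapE (i : 'I_n) d : simple_form t n i.+1 i.+1 = d -> kappa i = (s ^ d - r ^ d)^-1.
Proof.
rewrite /kappa /s_ /r_ /simple_form ltnn eqxx.
have -> : (if t is TypeD then (i.+1 == n.-1) && (i.+1 == n) else false) = false.
  by case: (t) => //; apply/andP; natlia.
have -> : (if t is TypeD then (i.+1 == n) && (i.+1 == n.-1) else false) = false.
  by case: (t) => //; apply/andP; natlia.
by move=> ->.
Qed.

Let kap_reg (i : 'I_n) : reg i -> kappa i = (S - R)^-1.
Proof. by move=> ri; apply: kapE; rewrite simple_form_reg // eqxx. Qed.

(* Words are written with plain numbers in order to use index_iota; letters    *)
(* outside 'I_n are dropped.                                                   *)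
Definition ordword (w : seq nat) : seq 'I_n := pmap insub w.

Lemma ordword_cat (w w' : seq nat) : ordword (w ++ w') = ordword w ++ ordword w'.
Proof. exact: pmap_cat. Qed.

Lemma ordword_cons (i : 'I_n) (w : seq nat) : ordword (val i :: w) = i :: ordword w.
Proof. by rewrite /ordword /= valK. Qed.

Lemma mem_ordword (i : 'I_n) (w : seq nat) : (i \in ordword w) = (val i \in w).
Proof. exact: mem_pmap_sub. Qed.

Lemma headmin_ordword (i : 'I_n) (w : seq nat) :
  (forall k, k \in w -> (i < k)%N) -> headmin (ordword (val i :: w)).
Proof. by move=> iw; rewrite ordword_cons; apply/allP => k; rewrite mem_ordword => /iw. Qed.

Lemma wt_ordword (w : seq nat) : all (gtn n) w -> wt (ordword w) = \sum_(k <- w) alpha n k.+1.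
Proof.
elim: w => [|k w IH]; first by rewrite /wt !big_nil.
move=> /andP[kn /IH wk]; rewrite big_cons -wk.
by rewrite -[k :: w]/(val (Ordinal (kn : (k < n)%N)) :: w) ordword_cons wt_cons.
Qed.

Let cat_iota (a b d : nat) : (a <= b <= d)%N -> index_iota a d = index_iota a b ++ index_iota b d.
Proof.
move=> /andP[ab bd]; rewrite /index_iota -{2}(subnKC ab) -iotaD; congr iota; move: ab bd; natlia.
Qed.

Let iota1 (a : nat) : index_iota a a.+1 = [:: a].
Proof. by rewrite /index_iota subSnn. Qed.

Let rootword_append a (x j : 'I_n) N : rootword (a ++ [:: x]) (a ++ [:: x]) N ->
    headmin (a ++ [:: x; j]) -> all (orth j) a -> chis x j * chis j x != 1 ->
  rootword (a ++ [:: x; j]) (a ++ [:: x; j]) (N * kappa j * (chis j x - (chis x j)^-1)).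
Proof.
move=> Ru hu oa xj; have [ea ea'] := orth_pairw oa.
have e : a ++ [:: x; j] = rcons (a ++ [:: x]) j by rewrite -cats1 -catA.
have e1 : pairw chis (a ++ [:: x]) [:: j] = chis x j by rewrite pairw_catl ea mul1r pairw11.
have e2 : pairw chis [:: j] (a ++ [:: x]) = chis j x by rewrite pairw_catr ea' mul1r pairw11.
rewrite e in hu *; have := rootword_closing Ru _ hu (perm_refl _) hu.
by rewrite e1 e2; apply; [case: (a)| |exact: closing_last|exact: closing_last].
Qed.

Let nbr_neq1 (x j : 'I_n) : nbr x j -> chis x j * chis j x != 1.
Proof.
move=> [-> ->]; apply: contra SR0 => /eqP E.
by rewrite subr_eq0 -[X in _ == X]mulr1 -E mulVKf.
Qed.

Let reg_pred k (hk : (k < n)%N) (hk1 : (k.+1 < n)%N) :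
  reg (Ordinal hk1) -> reg (Ordinal hk).
Proof. by rewrite /reg /regular /=; move: hk hk1; case: (t); natlia. Qed.

Let reg_le (i j : 'I_n) : (i <= j)%N -> reg j -> reg i.
Proof. by rewrite /reg /regular /=; case: (t); natlia. Qed.

Let ow1 k (hk : (k < n)%N) : ordword [:: k] = [:: Ordinal hk].
Proof. by rewrite -[[:: k]]/[:: val (Ordinal hk)] ordword_cons. Qed.

Let ordword_iotaS i k (hk : (k < n)%N) : (i <= k)%N ->
  ordword (index_iota i k.+1) = ordword (index_iota i k) ++ [:: Ordinal hk].
Proof.
by move=> ik; rewrite (@cat_iota i k) ?ik ?leqnSn // iota1 ordword_cat (ow1 hk).
Qed.

Let headmin_iota (i : 'I_n) k (w : seq nat) : (i < k)%N ->
  (forall z, z \in w -> (i < z)%N) -> headmin (ordword (index_iota i k ++ w)).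
Proof.
move=> ik iw; rewrite (@cat_iota i i.+1) ?leqnSn ?ik // iota1.
apply: headmin_ordword => z; rewrite mem_cat mem_index_iota => /orP[/andP[]//|].
exact: iw.
Qed.

(** Only the preceding letter interacts with a new letter j, and along a regular edge the factor is
    kappa_j (S - R) = 1. *)
Lemma rootword_gamma (i k : 'I_n) : (i <= k)%N -> reg k ->
  rootword (ordword (index_iota i k.+1)) (ordword (index_iota i k.+1)) (S - R)^-1.
Proof.
case: k => k /=; elim: k => [|k IH] hk ik rk.
  have -> : i = Ordinal hk by apply/val_inj/eqP; rewrite /= -leqn0.
  by rewrite iota1 (ow1 hk) -(kap_reg rk); apply: rootword_letter.
have [{}ik|ki] := ltnP i k.+1; last first.
  have -> : i = Ordinal hk by apply/val_inj/eqP; rewrite eqn_leq ik.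
  by rewrite iota1 (ow1 hk) -(kap_reg rk); apply: rootword_letter.
have hk' := ltnW hk; have := IH hk' ik (reg_pred hk' rk); rewrite ltnS in ik.
rewrite (ordword_iotaS hk) ?(ordword_iotaS hk') //; last exact: leqW.
rewrite -catA /=; set x := Ordinal hk'; set j := Ordinal hk => Ru.
have nxj : nbr x j := nbr_reg (reg_pred hk' rk) rk erefl.
have := @rootword_append (ordword (index_iota i k)) x j _ Ru.
rewrite kap_reg //; have [-> ->] := nxj; rewrite invrK mulfVK //; apply.
- rewrite -[_ ++ _](_ : ordword (index_iota i k ++ [:: k; k.+1]) = _); last first.
    by rewrite ordword_cat -[[:: k; _]]/[:: val x; val j] !ordword_cons.
  have -> : index_iota i k ++ [:: k; k.+1] = index_iota i k.+1 ++ [:: k.+1].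
    by rewrite (@cat_iota i k k.+1) ?ik ?leqnSn // iota1 -catA.
  by apply: headmin_iota => [|z]; rewrite ?inE; [|move=> /eqP->]; rewrite ltnS.
- apply/allP => z; rewrite mem_ordword mem_index_iota => /andP[_ zk] /=.
  have zj : (z <= j)%N by apply/ltnW/ltnW.
  have [|-> ->] := @chis_reg_far z j (reg_le zj rk) rk; last by rewrite !eqxx.
  by rewrite /= ltnS zk.
- by have := nbr_neq1 nxj; have [-> ->] := nxj.
Qed.
(** Here chi(u,j) = S and chi(j,u) = R^-1, so the factor is (S - R)^-1 (R^-1 - S^-1) = 1/(R S). The
    companion has its own y' and z', since in type D the last two nodes may be exchanged there. *)
Let rootword_long a (x y z y' z' j : 'I_n) (d d' : seq 'I_n) N :
  let u := a ++ [:: x; j; y] ++ d ++ [:: z] in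
  let u' := a ++ [:: x; j; y'] ++ d' ++ [:: z'] in
  rootword u u' N -> perm_eq u' u -> headmin (rcons u j) -> headmin (rcons u' j) ->
  all (orth j) a -> all (orth j) d -> all (orth j) d' ->
  nbr x j -> [/\ nbr j y, nbr j z, nbr j y' & nbr j z'] ->
  chis j j = R / S -> kappa j = (S - R)^-1 ->
  rootword (rcons u j) (rcons u' j) (N / (R * S)).
Proof.
move=> u u' Ru uu' hu hu' oa od od' [xj jx] [[jy yj] [jz zj] [jy' yj'] [jz' zj']] jj kj.
have [ea ea'] := orth_pairw oa; have [ed ed'] := orth_pairw od.
have sx : symc r s t j x = (chis j j)^-1.
  by rewrite /symc xj jx jj; field; rewrite R0 S0.
have sy : symc r s t j y = (chis j j)^-1.
  by rewrite /symc yj jy jj; field; rewrite R0 S0.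
have sy' : symc r s t j y' = (chis j j)^-1.
  by rewrite /symc yj' jy' jj; field; rewrite R0 S0.
have c1 : closing j u := closing_long _ oa od sx sy.
have c2 : closing j u' := closing_long _ oa od' sx sy'.
have e1 : pairw chis u [:: j] = S.
  rewrite !pairw_catl ea ed (pairw_consl _ x) (pairw_consl _ j) !pairw11 xj jj yj zj.
  by field; rewrite R0 S0.
have e2 : pairw chis [:: j] u = R^-1.
  rewrite !pairw_catr ea' ed' (pairw_consr _ _ x) (pairw_consr _ _ j) !pairw11 jx jj jy jz.
  by field; rewrite R0 S0.
have u0 : u != [::] by rewrite /u; case: (a).
have SR1 : pairw chis u [:: j] * pairw chis [:: j] u != 1.
  rewrite e1 e2; apply: contra SR0 => /eqP E.
  by rewrite subr_eq0 -[X in _ == X]mul1r -E mulfVK.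
have := rootword_closing Ru u0 hu uu' hu' SR1 c1 c2; rewrite e1 e2 kj.
by congr rootword; field; rewrite R0 S0 SR0.
Qed.

Let ordword_rev1 k (hk : (k < n)%N) M : (k < M)%N ->
  ordword (rev (index_iota k M)) = rcons (ordword (rev (index_iota k.+1 M))) (Ordinal hk).
Proof.
move=> kM; rewrite (@cat_iota k k.+1) ?leqnSn // iota1 rev_cat ordword_cat -cats1.
by rewrite -[rev [:: k]]/[:: k] (ow1 hk).
Qed.

(** * Descending tails *)

Section Descent.
Variables (i : 'I_n) (M : nat) (mid mid' : seq nat).
Hypotheses (Mn : (M <= n)%N) (midM : forall k, k \in mid -> (M <= k < n)%N).
Hypothesis mid_perm : perm_eq mid' mid.
Hypothesis regM : forall j : 'I_n, (j.+1 < M)%N -> reg j.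
Hypothesis nbrM : forall j k : 'I_n, (k < M)%N -> j.+1 = k -> nbr j k.
Hypothesis orthM : forall j k : 'I_n, (j.+1 < M)%N ->
  (j.+1 < k)%N && ((k < M)%N || (val k \in mid)) -> orth j k.

(** The word i, ..., M-1, m, M-1, ..., j, with letters numbered from 0. The middle m is empty in
    type B, the last node in type C, and the last two nodes in either order in type D. *)
Let W m (j : nat) := ordword (index_iota i M ++ m ++ rev (index_iota j M)).

(** The new j has an earlier occurrence between j-1 and j+1 and now follows a second j+1; all
    letters between the two occurrences of j+1 are orthogonal to j. This is [rootword_long] with z =
    y = j+1. *)
Let descent_step (j : nat) N : (i < j)%N -> (j.+1 < M)%N ->
  rootword (W mid j.+1) (W mid' j.+1) N -> rootword (W mid j) (W mid' j) (N / (R * S)).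
Proof.
move=> ij jM; have jn : (j < n)%N := leq_trans (ltnW jM) Mn.
have j1n : (j.+1 < n)%N := leq_trans jM Mn.
have jpn : (j.-1 < n)%N := leq_ltn_trans (leq_pred j) jn.
have jp : j.-1.+1 = j by case: (j) ij.
pose x := Ordinal jpn; pose jj := Ordinal jn; pose y := Ordinal j1n.
pose D m := ordword (index_iota j.+2 M ++ m ++ rev (index_iota j.+2 M)).
have IE : ordword (index_iota i M) =
    ordword (index_iota i j.-1) ++ [:: x; jj; y] ++ ordword (index_iota j.+2 M).
  rewrite (@cat_iota i j.-1); last by rewrite -ltnS jp ij (leq_trans (leq_pred j)) // ltnW // ltnW.
  rewrite (@cat_iota j.-1 j); last by rewrite leq_pred ltnW // ltnW.
  rewrite (@cat_iota j j.+1); last by rewrite leqnSn ltnW.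
  rewrite (@cat_iota j.+1 j.+2); last by rewrite leqnSn jM.
  have -> : index_iota j.-1 j = [:: j.-1] by rewrite -{2}jp iota1.
  by rewrite !iota1 !ordword_cat (ow1 jpn) (ow1 jn) (ow1 j1n).
have WE m : W m j.+1 = ordword (index_iota i j.-1) ++ [:: x; jj; y] ++ D m ++ [:: y].
  by rewrite /W /D !ordword_cat IE (ordword_rev1 j1n) // -cats1 -!catA.
have WS m : W m j = rcons (W m j.+1) jj.
  rewrite /W !ordword_cat (ordword_rev1 jn); last exact: ltnW.
  by rewrite -!cats1 -!catA.
have mid'M k : k \in mid' -> (M <= k < n)%N by rewrite (perm_mem mid_perm) => /midM.
have iM : (i < M)%N := leq_trans ij (ltnW (ltnW jM)).
have hd m : (forall k, k \in m -> (M <= k < n)%N) -> headmin (W m j).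
  move=> mM; apply: headmin_iota => // z; rewrite mem_cat mem_rev mem_index_iota.
  case/orP => [/mM/andP[Mz _]|/andP[jz _]]; first exact: leq_trans Mz.
  exact: leq_trans jz.
have od m : {subset m <= mid} -> all (orth jj) (D m).
  move=> sm; apply/allP => k; rewrite mem_ordword !mem_cat mem_rev mem_index_iota orbCA orbb.
  move=> km; apply: orthM => //=; case/orP: km => [km|/andP[-> ->]//].
  by have /andP[Mk _] := midM (sm _ km); rewrite (leq_trans jM Mk) (sm _ km) orbT.
rewrite !WS !WE => Ru; apply: rootword_long (Ru) _ _ _ _ _ _ _ _ _ _.
- rewrite !perm_cat2l -!/(D _) perm_cat2r /D /ordword perm_pmap // !perm_cat2l perm_cat2r //.
- by rewrite -WE -WS; apply: hd.
- by rewrite -WE -WS; apply: hd.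
- apply/allP => k; rewrite mem_ordword mem_index_iota => /andP[_ kj] /=.
  have rj : reg jj by apply: regM.
  have kjj : (k <= jj)%N by apply: leq_trans (ltnW kj) (leq_pred _).
  have [|-> ->] := chis_reg_far (reg_le kjj rj) rj; last by rewrite !eqxx.
  by apply/orP; left; have : (k.+1 < j.-1.+1)%N := kj; rewrite jp.
- exact: od.
- by apply: od => k; rewrite (perm_mem mid_perm).
- by apply: nbrM => //=; apply: ltnW.
- by split; apply: nbrM.
- exact/chis_reg_diag/regM.
- exact/kap_reg/regM.
Qed.

Lemma rootword_descent (J j : nat) N : (i < j <= J)%N -> (J < M)%N ->
  rootword (W mid J) (W mid' J) N ->
  rootword (W mid j) (W mid' j) (N / (R * S) ^+ (J - j)).
Proof.
move=> /andP[ij jJ] JM RJ; have [d Ed] : exists d, (J - j)%N = d by exists (J - j)%N.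
elim: d j ij jJ Ed => [|d IH] j ij jJ Ed.
  by have -> : j = J by [move: jJ Ed; natlia]; rewrite subnn expr0 divr1.
rewrite Ed exprSr invfM mulrA; apply: descent_step => //; first by move: Ed JM; natlia.
have Ed' : (J - j.+1)%N = d by move: Ed; natlia.
by rewrite -Ed'; apply: IH => //; [exact: ltnW|move: Ed; natlia].
Qed.

End Descent.

(** * The last node *)

Section LastLetter.
Variable l : 'I_n.
Hypothesis ln : l.+1 = n.

Let lt_l (i : 'I_n) : i != l -> (i < l)%N.
Proof. by rewrite -val_eqE => il; rewrite ltn_neqAle il -ltnS ln /=. Qed.

Let reg_lt (i : 'I_n) : (i < l)%N -> reg i.
Proof. by rewrite /reg /regular -ltnS ln => il; case: (t) => //=; apply: ltnW. Qed.

Let succ_lt (i : 'I_n) : (i < l)%N -> (0 < i.+1 < n)%N.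
Proof. by rewrite -ltnS ln. Qed.

Let qint2 : qint r s 2 = r + s.
Proof. by rewrite /qint subr_sqr mulrAC mulfV ?mul1r // subr_eq0. Qed.

Let sqr_inv : (s - r)^-1 * (s - r)^-1 * (s ^+ 2 - r ^+ 2) =
  qint r s 2 ^+ 2 / (s ^+ 2 - r ^+ 2).
Proof.
have n1 : s - r != 0 by rewrite subr_eq0 eq_sym.
by rewrite qint2 subr_sqr (addrC s r); field; rewrite n1 neq_rNs.
Qed.

Let neq_n (i : 'I_n) : (i.+1 < l)%N -> (i.+2 == n) = false.
Proof.
by move=> il; have <- : (i.+2 == l.+1) = false; [rewrite eqSS ltn_eqF|rewrite ln].
Qed.

Let ltS_n (k : nat) : (k.+1 < n)%N = (k < l)%N.
Proof. by rewrite -[RHS]ltnS ln. Qed.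

Let iotan (a : nat) : index_iota a n = index_iota a l.+1.
Proof. by rewrite ln. Qed.

Let ordword_letter : ordword [:: val l] = [:: l].
Proof. by rewrite ordword_cons. Qed.

Let orth_iota (i x j : 'I_n) : (x < j)%N -> reg j -> all (orth j) (ordword (index_iota i x)).
Proof.
move=> xj rj; apply/allP => k; rewrite mem_ordword mem_index_iota => /andP[_ kx] /=.
have [|-> ->] := chis_reg_far (reg_le (ltnW (ltn_trans kx xj)) rj) rj.
  by rewrite (leq_ltn_trans kx xj).
by rewrite !eqxx.
Qed.

Let ordword_iotaX (i x : 'I_n) : (i <= x)%N ->
  ordword (index_iota i x.+1) = ordword (index_iota i x) ++ [:: x].
Proof.
move=> ix; rewrite (ordword_iotaS (ltn_ord x)) //; congr (_ ++ [:: _]); exact/val_inj.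
Qed.

(** The last letter is attached to its neighbour x in the diagram: the preceding node in types B and
    C, and node n-2 in type D, where n-1 is skipped. *)
Let rootword_skip (i x : 'I_n) : (i <= x < l)%N -> chis x l * chis l x != 1 ->
    (forall k : 'I_n, (k < x)%N -> orth l k) ->
  rootword (ordword (index_iota i x.+1 ++ [:: val l])) (ordword (index_iota i x.+1 ++ [:: val l]))
    ((S - R)^-1 * kappa l * (chis l x - (chis x l)^-1)).
Proof.
move=> /andP[ix xl] xl1 ol; have := rootword_gamma ix (reg_lt xl).
have -> : ordword (index_iota i x.+1 ++ [:: val l]) = ordword (index_iota i x) ++ [:: x; l].
  by rewrite ordword_cat ordword_letter ordword_iotaX // -catA.
rewrite ordword_iotaX //.
move=> Rx; apply: rootword_append => //.
  have -> : ordword (index_iota i x) ++ [:: x; l] = ordword (index_iota i x ++ [:: val x; val l]).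
    by rewrite ordword_cat !ordword_cons.
  have -> : index_iota i x ++ [:: val x; val l] = index_iota i x.+1 ++ [:: val l].
    by rewrite (@cat_iota i x x.+1) ?ix ?leqnSn // iota1 -catA.
  by apply: headmin_iota => // z; rewrite inE => /eqP->; apply: leq_ltn_trans xl.
by apply/allP => k; rewrite mem_ordword mem_index_iota => /andP[_ /ol].
Qed.

Let pred_ord (i : 'I_n) : (i < l)%N -> exists2 x : 'I_n, x.+1 = l & (i <= x)%N.
Proof.
move=> il; have ll : l.-1.+1 = l by case: (val l) il.
have ln' : (l.-1 < n)%N by apply: leq_ltn_trans (leq_pred _) (ltn_ord l).
by exists (Ordinal ln') => //=; rewrite -ltnS ll.
Qed.

Let iota_last i : (i <= l)%N -> ordword (index_iota i l ++ [:: val l]) = ordword (index_iota i n).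
Proof.
by move=> il; rewrite iotan (@cat_iota i l l.+1) ?il ?leqnSn // iota1.
Qed.

Let rootword_last_letter : rootword (ordword (index_iota l n)) (ordword (index_iota l n)) (kappa l).
Proof. by rewrite iotan iota1 ordword_letter; apply: rootword_letter. Qed.

(** * Type B: doubling the last letter *)

Section TypeB.
Hypothesis et : t = TypeB.

Let RB : R = r ^+ 2. Proof. by rewrite /R /c et. Qed.
Let SB : S = s ^+ 2. Proof. by rewrite /S /c et. Qed.

Let diagB : chis l l = r / s.
Proof. by rewrite chisE ln et simple_form_lastBB // -ln. Qed.

Let kapB : kappa l = (s - r)^-1.
Proof. by rewrite (@kapE l 1) // ln et simple_form_lastBB // -ln. Qed.

Let nbrB (i : 'I_n) : i.+1 = l -> nbr i l.
Proof.
move=> il; have i_lt : (i < l)%N by rewrite -il.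
have [f1 f2] := simple_form_lastB (succ_lt i_lt).
by rewrite /nbr !chisE ln et f1 f2 il ln eqxx /rspow oppr0 expr0z mulr1 mul1r opprK RB SB.
Qed.

Let orthB (i : 'I_n) : (i.+1 < l)%N -> chis i l = 1 /\ chis l i = 1.
Proof.
move=> il; have [f1 f2] := simple_form_lastB (succ_lt (ltnW il)).
have il' := neq_n il.
by rewrite !chisE ln et f1 f2 il' /rspow oppr0 !expr0z mulr1.
Qed.

Lemma rootword_gammaB (i : 'I_n) :
  rootword (ordword (index_iota i n)) (ordword (index_iota i n)) (s - r)^-1.
Proof.
have [->|/lt_l il] := eqVneq i l; first by rewrite -kapB; exact: rootword_last_letter.
have [x xl ix] := pred_ord il; have nx := nbrB xl.
have := @rootword_skip i x; rewrite ix -xl ltnSn => /(_ isT (nbr_neq1 nx)).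
have [-> ->] := nx; rewrite invrK xl iota_last ?(ltnW il) // mulrAC mulVf // mul1r kapB.
apply=> k kx; rewrite inE /=; have [|-> ->] := @orthB k; last by rewrite eqxx.
by rewrite -xl ltnS.
Qed.

(** Doubling the last letter contributes (s - r)^-1 (s^2 - r^2); each further descending letter
    contributes 1/(R S) with R = r^2 and S = s^2. *)
Lemma rootword_betaB (i : 'I_n) j : (i < j <= l)%N ->
  let u := ordword (index_iota i n ++ rev (index_iota j n)) in
  rootword u u (qint r s 2 ^+ 2 / (s ^+ 2 - r ^+ 2) / (r ^+ 2 * s ^+ 2) ^+ (l - j)).
Proof.
move=> /andP[ij jl] /=; have il := leq_trans ij jl.
have [x xl ix] := pred_ord il; have [nx nx'] := nbrB xl.
have base : rootword (ordword (index_iota i n ++ [::] ++ rev (index_iota l n)))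
    (ordword (index_iota i n ++ [::] ++ rev (index_iota l n)))
    (qint r s 2 ^+ 2 / (s ^+ 2 - r ^+ 2)).
  have E : ordword (index_iota i n) = ordword (index_iota i x) ++ [:: x; l].
    by rewrite -iota_last ?(ltnW il) // ordword_cat ordword_letter -xl ordword_iotaX // -catA.
  have E' : ordword (index_iota i n ++ [::] ++ rev (index_iota l n)) =
      ordword (index_iota i x) ++ [:: x; l; l].
    by rewrite ordword_cat E iotan iota1 -catA; congr (_ ++ _ :: _ :: _); rewrite -ordword_letter.
  have := rootword_gammaB i; rewrite E => RE.
  have hd : headmin (ordword (index_iota i x) ++ [:: x; l; l]).
    rewrite -E'; apply: headmin_iota => [|z]; first exact: ltn_ord.
    by rewrite iotan iota1 inE => /eqP->.
  rewrite E'; have := rootword_double RE hd.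
  rewrite kapB nx nx' invrK RB SB sqr_inv; apply.
  - apply/allP => k; rewrite mem_ordword mem_index_iota => /andP[_ kx] /=.
    by have [|-> ->] := @orthB k; [rewrite -xl ltnS|rewrite eqxx].
  - by rewrite /symc nx nx' diagB RB SB; field; rewrite r0 s0.
  - by have := nbr_neq1 (nbrB xl); rewrite /symc.
have := @rootword_descent i n [::] [::] (leqnn n) _ (perm_refl _) _ _ _ l j
  (qint r s 2 ^+ 2 / (s ^+ 2 - r ^+ 2)).
rewrite RB SB ij jl ltn_ord /=; apply=> //.
- by move=> k; rewrite ltS_n; apply: reg_lt.
- move=> k k' _ kk'; have [k'l|k'l] := eqVneq k' l; first by rewrite k'l in kk' *; apply: nbrB.
  have k'l' := lt_l k'l; apply: (nbr_reg _ (reg_lt k'l') kk'); apply: reg_lt.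
  by apply: leq_trans k'l'; rewrite -kk'.
- move=> k k' kn /andP[kk' _] /=.
  have [k'l|k'l] := eqVneq k' l.
    by rewrite k'l in kk' *; have [|-> ->] := @orthB k; rewrite ?eqxx.
  have k'l' := lt_l k'l; have [||-> ->] := @chis_reg_far k k' _ (reg_lt k'l').
  + by apply: reg_lt; rewrite -ltS_n.
  + by rewrite kk'.
  + by rewrite !eqxx.
Qed.

End TypeB.

(** * Type C: the double edge and the roots beta_ii *)

Section TypeC.
Hypothesis et : t = TypeC.

Let RC : R = r. Proof. by rewrite /R /c et expr1z. Qed.
Let SC : S = s. Proof. by rewrite /S /c et expr1z. Qed.

Let kapC : kappa l = (s ^+ 2 - r ^+ 2)^-1.
Proof. by rewrite (@kapE l 2) // ln et simple_form_lastCC // -ln. Qed.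

Let edgeC (i : 'I_n) : i.+1 = l -> chis i l = (r ^+ 2)^-1 /\ chis l i = s ^+ 2.
Proof.
move=> il; have i_lt : (i < l)%N by rewrite -il.
have [f1 f2] := simple_form_lastC (succ_lt i_lt).
by rewrite !chisE ln et f1 f2 il ln eqxx /rspow oppr0 expr0z mulr1 mul1r opprK.
Qed.

Let orthC (i : 'I_n) : (i.+1 < l)%N -> chis i l = 1 /\ chis l i = 1.
Proof.
move=> il; have [f1 f2] := simple_form_lastC (succ_lt (ltnW il)).
have il' := neq_n il.
by rewrite !chisE ln et f1 f2 il' /rspow oppr0 !expr0z mulr1.
Qed.

Let edgeC_neq1 (x : 'I_n) : x.+1 = l -> chis x l * chis l x != 1.
Proof.
move=> /edgeC[-> ->]; apply: contra sqr_neq => /eqP E.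
by rewrite subr_eq0 -[X in _ == X]mulr1 -E mulVKf // expf_neq0.
Qed.

Lemma rootword_gammaC (i : 'I_n) : (i < l)%N ->
  rootword (ordword (index_iota i n)) (ordword (index_iota i n)) (s - r)^-1.
Proof.
move=> il; have [x xl ix] := pred_ord il.
have := @rootword_skip i x; rewrite ix -xl ltnSn => /(_ isT (edgeC_neq1 xl)).
have [-> ->] := edgeC xl; rewrite invrK xl iota_last ?(ltnW il) // RC SC kapC.
rewrite mulfVK //; apply=> k kx.
rewrite inE /=; have [|-> ->] := @orthC k; last by rewrite eqxx.
by rewrite -xl ltnS.
Qed.

Lemma rootword_gammaCn : rootword (ordword [:: val l]) (ordword [:: val l]) (s ^+ 2 - r ^+ 2)^-1.
Proof. by rewrite -kapC ordword_letter; apply: rootword_letter. Qed.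

(** The first descending letter x comes right after the last node. There chi(u,x) = s and chi(x,u) =
    r^-1 for u = i ... n, which already gives the factor 1/(r s); the rest is a regular descent. *)
Lemma rootword_betaC (i : 'I_n) j : (i < j < l)%N ->
  let u := ordword (index_iota i l ++ [:: val l] ++ rev (index_iota j l)) in
  rootword u u ((s - r)^-1 / (r * s) ^+ (l - j)).
Proof.
move=> /andP[ij jl] /=; have il := ltn_trans ij jl.
have [x xl ix] := pred_ord il.
have jx : (j <= x)%N by rewrite -ltnS xl.
have ix' : (i < x)%N := leq_trans ij jx.
have xl' : (x < l)%N by rewrite -xl.
have rx := reg_lt xl'.
have px : x.-1.+1 = x by case: (val x) ix'.
have xn : (x.-1 < n)%N := leq_ltn_trans (leq_pred _) (ltn_ord x).
pose y := Ordinal xn.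
have ny : nbr y x by apply: nbr_reg => //; apply: reg_le rx; apply: leq_pred.
have [yx xy] := ny; have [xl1 xl2] := edgeC xl.
have iy : (i <= y)%N by rewrite -ltnS px.
have E : ordword (index_iota i n) = ordword (index_iota i y) ++ [:: y; x; l].
  rewrite -iota_last ?(ltnW il) // ordword_cat ordword_letter -xl ordword_iotaX //
    -[in index_iota i x]px.
  by rewrite (@ordword_iotaX i y) // -!catA.
have oy : all (orth x) (ordword (index_iota i y)).
  by apply: orth_iota => //=; rewrite -[X in (_ < X)%N]px.
have [ea ea'] := orth_pairw oy.
have e1 : pairw chis (ordword (index_iota i n)) [:: x] = s.
  rewrite E pairw_catl ea (pairw_consl _ y) (pairw_consl _ x) !pairw11 yx xl2 chis_reg_diag //.
  by rewrite RC SC; field; rewrite r0 s0.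
have e2 : pairw chis [:: x] (ordword (index_iota i n)) = r^-1.
  rewrite E pairw_catr ea' (pairw_consr _ _ y) (pairw_consr _ _ x) !pairw11 xy xl1 chis_reg_diag //.
  by rewrite RC SC; field; rewrite r0 s0.
have E' : ordword (index_iota i l ++ [:: val l] ++ rev (index_iota x l)) =
      rcons (ordword (index_iota i n)) x.
  rewrite catA ordword_cat iota_last ?(ltnW il) // -cats1; congr (_ ++ _).
  by rewrite -xl iota1 ordword_cons.
have base : rootword (ordword (index_iota i l ++ [:: val l] ++ rev (index_iota x l)))
    (ordword (index_iota i l ++ [:: val l] ++ rev (index_iota x l))) ((s - r)^-1 / (r * s)).
  have hd : headmin (rcons (ordword (index_iota i n)) x).
    rewrite -E'; apply: headmin_iota => // z; rewrite mem_cat mem_rev inE -xl iota1 inE.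
    by case/orP => /eqP-> //; rewrite xl.
  rewrite E'; have := rootword_closing (rootword_gammaC il) _ hd (perm_refl _) hd.
  rewrite e1 e2 kap_reg // RC SC => RW.
  have := RW _ _ _ _; rewrite (_ : _ * _ * (r^-1 - s^-1) = (s - r)^-1 / (r * s)).
    apply.
    - by rewrite E; case: (ordword _).
    - apply: contra SR0 => /eqP E1; rewrite RC SC subr_eq0.
      by rewrite -[X in _ == X]mul1r -E1 mulfVK.
    - rewrite E; apply: closing_short => //; rewrite /symc yx xy chis_reg_diag //.
      by rewrite RC SC; field; rewrite r0 s0.
    - rewrite E; apply: closing_short => //; rewrite /symc yx xy chis_reg_diag //.
      by rewrite RC SC; field; rewrite r0 s0.
  have n1 : s - r != 0 by rewrite subr_eq0 eq_sym.
  by field; rewrite r0 s0 n1.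
have := @rootword_descent i l [:: val l] [:: val l] (ltnW (ltn_ord l)) _ (perm_refl _) _ _ _ x j
  ((s - r)^-1 / (r * s)).
rewrite RC SC ij jx xl' /= => RD.
have -> : (s - r)^-1 / (r * s) ^+ (l - j) = (s - r)^-1 / (r * s) / (r * s) ^+ (x - j).
  by rewrite -xl subSn // exprS invfM mulrA.
apply: RD => //.
- by move=> k; rewrite inE => /eqP->; rewrite leqnn ltn_ord.
- by move=> k kl; apply/reg_lt/ltnW.
- move=> k k' k'l kk'; apply: (nbr_reg _ (reg_lt k'l) kk'); apply: reg_lt.
  by apply: leq_trans k'l; rewrite -kk'.
- move=> k k' kl /andP[kk'] /=; rewrite !inE /= => /orP[k'l|/eqP/val_inj->].
    have [||-> ->] := @chis_reg_far k k' _ (reg_lt k'l); last by rewrite !eqxx.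
    + exact/reg_lt/ltnW.
    + by rewrite kk'.
  by have [|-> ->] := @orthC k; rewrite ?eqxx.
Qed.

(** Appending a letter multiplies by R^-1 and S for the cross terms and by r/s for the diagonal,
    hence by 1. *)
Let pairw_diag (i : 'I_n) k : (k < l)%N -> (i <= k)%N ->
  pairw chis (ordword (index_iota i k.+1)) (ordword (index_iota i k.+1)) = r / s.
Proof.
move=> kl ik; have kn : (k < n)%N := ltn_trans kl (ltn_ord l).
elim: k ik kl kn => [|k IH] ik kl kn.
  have -> : i = Ordinal kn by apply/val_inj/eqP; rewrite /= -leqn0.
  by rewrite iota1 (ow1 kn) pairw11 chis_reg_diag ?RC ?SC //; apply: reg_lt.
have [{}ik|ki] := ltnP i k.+1; last first.
  have -> : i = Ordinal kn by apply/val_inj/eqP; rewrite eqn_leq ik.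
  by rewrite iota1 (ow1 kn) pairw11 chis_reg_diag ?RC ?SC //; apply: reg_lt.
have kn' := ltnW kn; have kl' := ltnW kl; rewrite ltnS in ik.
pose x := Ordinal kn'; pose j := Ordinal kn.
have [xj jx] : nbr x j by apply: nbr_reg => //; apply: reg_lt.
have oj : all (orth j) (ordword (index_iota i x)) by apply: orth_iota => //; apply: reg_lt.
have [ea ea'] := orth_pairw oj.
have e1 : pairw chis (ordword (index_iota i k.+1)) [:: j] = R^-1.
  by rewrite (@ordword_iotaX i x) // pairw_catl ea mul1r pairw11.
have e2 : pairw chis [:: j] (ordword (index_iota i k.+1)) = S.
  by rewrite (@ordword_iotaX i x) // pairw_catr ea' mul1r pairw11.
rewrite (@ordword_iotaX i j) ?(leqW ik) // pairw_catl !pairw_catr e1 e2 pairw11.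
rewrite IH // chis_reg_diag ?RC ?SC; last exact: reg_lt.
by field; rewrite r0 s0.
Qed.

Let last_iota (i : 'I_n) : (i < l)%N ->
  [/\ headmin (ordword (index_iota i l)), all (fun k : 'I_n => k < l)%N (ordword (index_iota i l))
     & closing l (ordword (index_iota i l))] /\
  [/\ pairw chis (ordword (index_iota i l)) (ordword (index_iota i l)) = r / s,
     pairw chis (ordword (index_iota i l)) [:: l] = (r ^+ 2)^-1
     & pairw chis [:: l] (ordword (index_iota i l)) = s ^+ 2].
Proof.
move=> il; have [x xl ix] := pred_ord il; have xl' : (x < l)%N by rewrite -xl.
have ol : all (orth l) (ordword (index_iota i x)).
  apply/allP => k; rewrite mem_ordword mem_index_iota => /andP[_ kx] /=.
  by have [|-> ->] := @orthC k; [rewrite -xl ltnS|rewrite eqxx].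
have [ea ea'] := orth_pairw ol; have [xl1 xl2] := edgeC xl.
split; split.
- by rewrite -[index_iota _ _]cats0; apply: headmin_iota.
- by apply/allP => k; rewrite mem_ordword mem_index_iota => /andP[].
- by rewrite -xl ordword_iotaX //; apply: closing_last.
- by rewrite -xl pairw_diag.
- by rewrite -xl ordword_iotaX // pairw_catl ea mul1r pairw11.
- by rewrite -xl ordword_iotaX // pairw_catr ea' mul1r pairw11.
Qed.

Let square_word (i : 'I_n) : ordword (index_iota i l ++ index_iota i l ++ [:: val l]) =
  ordword (index_iota i l) ++ ordword (index_iota i l) ++ [:: l].
Proof. by rewrite !ordword_cat ordword_letter. Qed.

Let squareC (i : 'I_n) : (i < l)%N ->
  [/\ rootword (ordword (index_iota i l)) (ordword (index_iota i l)) (s - r)^-1,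
    rootword (ordword (index_iota i l) ++ [:: l]) (ordword (index_iota i l) ++ [:: l]) (s - r)^-1,
    1 + r / s != 0 & 1 - r / s * (r ^+ 2)^-1 * s ^+ 2 != 0].
Proof.
move=> il; have [x xl ix] := pred_ord il; split.
- by rewrite -xl -RC -SC; apply: rootword_gamma => //; apply: reg_lt; rewrite -xl.
- by rewrite -ordword_letter -ordword_cat iota_last ?(ltnW il) //; apply: rootword_gammaC.
- have -> : 1 + r / s = (r + s) / s by field.
  by rewrite mulf_neq0 ?invr_neq0.
- have -> : 1 - r / s * (r ^+ 2)^-1 * s ^+ 2 = (r - s) / r by field; rewrite r0 s0.
  by rewrite mulf_neq0 ?invr_neq0 // subr_eq0.
Qed.

Lemma dominant_betaCii (i : 'I_n) : (i < l)%N ->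
  dominant r s t (ordword (index_iota i l ++ index_iota i l ++ [:: val l])).
Proof.
move=> il; have [[h1 h2 h3] [e1 e2 e3]] := last_iota il; have [R1 R2 n1 n2] := squareC il.
by rewrite square_word; apply: square_dominant R1 R2 _ _ _ => //; rewrite ?e1 ?e2 ?e3.
Qed.

Lemma lyndon_betaCii (i : 'I_n) : (i < l)%N ->
  lyndon (ordword (index_iota i l ++ index_iota i l ++ [:: val l])).
Proof. by move=> /last_iota[[h1 h2 _] _]; rewrite square_word lyndon_square. Qed.

Lemma pair_square_word (i : 'I_n) : (i < l)%N ->
  let u := ordword (index_iota i l ++ index_iota i l ++ [:: val l]) in
  B (fw u) (ew u) = qint r s 2 ^+ 2 / (s ^+ 2 - r ^+ 2).
Proof.
move=> il; have [[h1 h2 h3] [e1 e2 e3]] := last_iota il; have [R1 R2 n1 n2] := squareC il.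
rewrite /= square_word (square_pair h1 h2 R1 R2) e1 e2 e3 qint2 subr_sqr (addrC s r).
have n3 : s - r != 0 by rewrite subr_eq0 eq_sym.
by field; rewrite r0 s0 n3 neq_rNs oner_neq0.
Qed.

End TypeC.

(** * Type D: the fork *)

Section TypeD.
Hypothesis et : t = TypeD.
Hypothesis n2 : (1 < n)%N.

Let RD : R = r. Proof. by rewrite /R /c et expr1z. Qed.
Let SD : S = s. Proof. by rewrite /S /c et expr1z. Qed.

Let kapD : kappa l = (s - r)^-1.
Proof. by rewrite (@kapE l 1) // ln et simple_form_lastDD. Qed.

(** The orthogonal nodes n-1 and n have nontrivial characters, because of the exceptional values of
    the form, but trivial symmetric character. *)
Let twinD (i : 'I_n) : i.+1 = l -> chis i l = (r * s)^-1 /\ chis l i = r * s.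
Proof.
move=> il; have i_lt : (i < l)%N by rewrite -il.
have [f1 f2] := simple_form_lastD (succ_lt i_lt).
by rewrite !chisE ln et f1 f2 il ln eqxx /rspow /= opprK expr1z -!exprnN !expr1z invfM.
Qed.

Let nbrD (i : 'I_n) : i.+2 = l -> nbr i l.
Proof.
move=> il; have i_lt : (i.+1 < l)%N by rewrite -il.
have [f1 f2] := simple_form_lastD (succ_lt (ltnW i_lt)).
rewrite /nbr !chisE ln et f1 f2 (neq_n i_lt) il ln eqxx /rspow /=.
by rewrite oppr0 expr0z mulr1 mul1r opprK RD SD.
Qed.

Let orthD (i : 'I_n) : (i.+2 < l)%N -> chis i l = 1 /\ chis l i = 1.
Proof.
move=> il; have [f1 f2] := simple_form_lastD (succ_lt (ltnW (ltnW il))).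
have il' : (i.+3 == n) = false.
  by have <- : (i.+3 == l.+1) = false; [rewrite eqSS ltn_eqF|rewrite ln].
by rewrite !chisE ln et f1 f2 (neq_n (ltnW il)) il' /rspow oppr0 !expr0z mulr1.
Qed.

Lemma rootword_betaDn (i : 'I_n) : (i < l)%N ->
  let u := ordword (index_iota i l.-1 ++ [:: val l]) in rootword u u (s - r)^-1.
Proof.
move=> il u; rewrite {}/u; have [x xl ix] := pred_ord il; have -> : l.-1 = x by rewrite -xl.
(* If i = x the ascending part is empty and the root is the last simple root. *)
move: ix; rewrite leq_eqVlt => /orP[/eqP ix|ix].
  by rewrite /index_iota ix subnn [iota _ 0]/= cat0s ordword_letter -kapD; exact: rootword_letter.
have px : x.-1.+1 = x by rewrite prednK // (leq_ltn_trans _ ix).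
have yn : (x.-1 < n)%N := leq_ltn_trans (leq_pred _) (ltn_ord x).
pose y := Ordinal yn.
have yl : y.+2 = l by rewrite /= px.
have ny := nbrD yl; have iy : (i <= y)%N by rewrite -ltnS px.
have iyl : (i <= y < l)%N by rewrite iy -yl ltnS leqnSn.
have := rootword_skip iyl (nbr_neq1 ny).
have [-> ->] := ny; rewrite invrK mulrAC mulVf // mul1r kapD /= px; apply=> k ky.
by have [|-> ->] := @orthD k; [rewrite -yl !ltnS|rewrite eqxx].
Qed.

(** Adjoining n-1 to i ... n-2 n by [rootword_fork]: both orders of n-1 and n survive, and the
    larger one, with n first, is the word of the root. *)
Lemma rootword_betaDn1 (i : 'I_n) : (i < l.-1)%N ->
  rootword (ordword (index_iota i l.-1 ++ [:: val l; l.-1]))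
    (ordword (index_iota i l.-1 ++ [:: l.-1; val l]))
    ((s - r)^-1 / (r * s)).
Proof.
move=> il1; have il : (i < l)%N := leq_trans il1 (leq_pred _).
have [x xl ix] := pred_ord il; have lx1 : l.-1 = x by rewrite -xl.
rewrite lx1 in il1 *; have rx : reg x by apply: reg_lt; rewrite -xl.
have px : x.-1.+1 = x by rewrite prednK // (leq_ltn_trans _ il1).
have yn : (x.-1 < n)%N := leq_ltn_trans (leq_pred _) (ltn_ord x).
pose y := Ordinal yn.
have yl : y.+2 = l by rewrite /= px.
have iy : (i <= y)%N by rewrite -ltnS px.
have ny : nbr y x by apply: nbr_reg => //; apply: reg_le rx; apply: leq_pred.
have [yx xy] := ny; have [lx xl'] := twinD xl.
have E : ordword (index_iota i x) = ordword (index_iota i y) ++ [:: y].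
  by rewrite -[in index_iota i x]px (@ordword_iotaX i y).
have Eu (w : seq 'I_n) : ordword (index_iota i x ++ [seq val k | k <- w]) =
    ordword (index_iota i y) ++ y :: w.
  rewrite ordword_cat E -catA; congr (_ ++ _ :: _).
  by elim: w => [//|k w IH]; rewrite -[map _ _]/(val k :: map val w) ordword_cons IH.
have E1 : ordword (index_iota i x ++ [:: val l]) = _ := Eu [:: l].
have E2 : ordword (index_iota i x ++ [:: val l; x : nat]) = _ := Eu [:: l; x].
have E3 : ordword (index_iota i x ++ [:: x : nat; val l]) = _ := Eu [:: x; l].
have Rl := rootword_betaDn il; cbv zeta in Rl; rewrite lx1 E1 in Rl.
rewrite E2 E3; have oy : all (orth x) (ordword (index_iota i y)).
  by apply: orth_iota => //=; rewrite -[X in (_ < X)%N]px.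
have [ea ea'] := orth_pairw oy.
have hd : headmin (ordword (index_iota i y) ++ [:: y; l; x]).
  by rewrite -E2; apply: headmin_iota => // z; rewrite !inE => /orP[] /eqP->.
have yx' : y != x by rewrite -val_eqE /= -[X in _ == X]px ltn_eqF.
have lx' : l != x by rewrite -val_eqE /= -xl gtn_eqF.
have := rootword_fork Rl hd oy yx' lx' _ _.
rewrite /= pairw_catl pairw_catr ea ea' (pairw_consl _ y) (pairw_consr _ _ y) !pairw11.
rewrite /symc lx xl' yx xy => RF.
have := RF _ _; rewrite kap_reg // RD SD.
rewrite (_ : _ * _ * (1 * (s * (r * s)^-1) - _) = (s - r)^-1 / (r * s)); last first.
  have n1 : s - r != 0 by rewrite subr_eq0 eq_sym.
  by field; rewrite r0 s0 n1.
apply; first by rewrite mulfV // mulf_neq0.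
by have := nbr_neq1 ny; rewrite yx xy RD SD.
Qed.

(** The first descending letter n-2 is adjacent to both n-1 and n. For it, [rootword_long] is
    applied with these two as y and z, in opposite orders in the word and its companion; below it
    the descent is regular. *)
Lemma rootword_betaD (i : 'I_n) (j : nat) : (i < j)%N -> (j < l.-1)%N ->
  rootword (ordword (index_iota i l.-1 ++ [:: val l; l.-1] ++ rev (index_iota j l.-1)))
    (ordword (index_iota i l.-1 ++ [:: l.-1; val l] ++ rev (index_iota j l.-1)))
    ((s - r)^-1 / (r * s) / (r * s) ^+ (l.-1 - j)).
Proof.
move=> ij jl1; have il1 := ltn_trans ij jl1.
have il : (i < l)%N := leq_trans il1 (leq_pred _).
have [x xl ix] := pred_ord il; have lx1 : l.-1 = x by rewrite -xl.
have := rootword_betaDn1 il1; rewrite lx1 in il1 jl1 *.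
have xl1 : (x < l)%N by rewrite -xl.
have rx : reg x := reg_lt xl1.
have px : x.-1.+1 = x by rewrite prednK // (leq_ltn_trans _ il1).
have yn : (x.-1 < n)%N := leq_ltn_trans (leq_pred _) (ltn_ord x).
pose y := Ordinal yn.
have yl : y.+2 = l by rewrite /= px.
have yx : (y < x)%N by rewrite -[X in (_ < X)%N]px.
have jy : (j <= y)%N by rewrite -ltnS px.
have iy : (i < y)%N := leq_trans ij jy.
have py : y.-1.+1 = y by rewrite prednK // (leq_ltn_trans _ iy).
have zn : (y.-1 < n)%N := leq_ltn_trans (leq_pred _) (ltn_ord y).
pose z := Ordinal zn.
have iz : (i <= z)%N by rewrite -ltnS py.
have ry : reg y by apply: reg_le rx; exact: ltnW.
have rz : reg z by apply: reg_le ry; exact: leq_pred.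
have nzy : nbr z y by apply: nbr_reg.
have nyx : nbr y x by apply: nbr_reg.
have nyl : nbr y l := nbrD yl.
have E : ordword (index_iota i x) = ordword (index_iota i z) ++ [:: z; y].
  rewrite -[in index_iota i x]px (@ordword_iotaX i y) ?(ltnW iy) //.
  by rewrite -[in index_iota i y]py (@ordword_iotaX i z) // -catA.
have E1 : ordword (index_iota i x ++ [:: val l; x : nat]) =
    ordword (index_iota i z) ++ [:: z; y; l] ++ [::] ++ [:: x].
  by rewrite ordword_cat E -catA -[[:: val l; _]]/[:: val l; val x] !ordword_cons.
have E2 : ordword (index_iota i x ++ [:: x : nat; val l]) =
    ordword (index_iota i z) ++ [:: z; y; x] ++ [::] ++ [:: l].
  by rewrite ordword_cat E -catA -[[:: _; val l]]/[:: val x; val l] !ordword_cons.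
have revy : rev (index_iota y x) = [:: val y] by rewrite -[in index_iota y x]px iota1.
have F1 : ordword (index_iota i x ++ [:: val l; x : nat] ++ rev (index_iota y x)) =
    rcons (ordword (index_iota i z) ++ [:: z; y; l] ++ [::] ++ [:: x]) y.
  by rewrite catA ordword_cat E1 revy ordword_cons -[RHS]cats1.
have F2 : ordword (index_iota i x ++ [:: x : nat; val l] ++ rev (index_iota y x)) =
    rcons (ordword (index_iota i z) ++ [:: z; y; x] ++ [::] ++ [:: l]) y.
  by rewrite catA ordword_cat E2 revy ordword_cons -[RHS]cats1.
have mids k : k \in [:: val l; x : nat] -> (x <= k < n)%N.
  by rewrite !inE => /orP[] /eqP->; rewrite ?ltn_ord ?andbT // ltnW.
have hd (m : seq nat) : (forall k, k \in m -> (x <= k < n)%N) ->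
    headmin (ordword (index_iota i x ++ m ++ rev (index_iota y x))).
  move=> mM; apply: headmin_iota => // k; rewrite mem_cat revy inE => /orP[|/eqP->//].
  by move=> /mM/andP[xk _]; apply: leq_trans xk.
have perm2 : perm_eq [:: x : nat; val l] [:: val l; x : nat] by apply/permP => p /=; rewrite addnCA.
rewrite E1 E2 => RN.
have base : rootword (ordword (index_iota i x ++ [:: val l; x : nat] ++ rev (index_iota y x)))
    (ordword (index_iota i x ++ [:: x : nat; val l] ++ rev (index_iota y x)))
    ((s - r)^-1 / (r * s) / (r * s)).
  have := rootword_long RN; rewrite -F1 -F2 RD SD; apply=> //.
  - by rewrite perm_cat2l; apply/permP => p /=; rewrite !addn0 [(p x + p l)%N]addnC.
  - exact: (hd _ mids).
  - by apply: hd => k; rewrite (perm_mem perm2) => /mids.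
  - by apply: orth_iota => //=; rewrite -[X in (_ < X)%N]py.
  - by have := chis_reg_diag ry; rewrite RD SD.
  - by have := kap_reg ry; rewrite RD SD.
have regx (k : 'I_n) : (k.+1 < x)%N -> reg k.
  by move=> kx; apply: reg_le rx; apply: ltnW; apply: ltnW.
have nbrx (k k' : 'I_n) : (k' < x)%N -> k.+1 = k' -> nbr k k'.
  move=> k'x kk'; apply: (nbr_reg _ _ kk'); last by apply: reg_le rx; exact: ltnW.
  by apply: reg_le rx; rewrite ltnW // (leq_ltn_trans _ k'x) // -kk'.
have orthx (k k' : 'I_n) : (k.+1 < x)%N ->
    (k.+1 < k')%N && ((k' < x)%N || (val k' \in [:: val l; x : nat])) -> orth k k'.
  move=> kx /andP[kk'] _ /=; have rk := regx k kx.
  have [/val_inj->|k'l] := eqVneq (val k') (val l).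
    by have [|-> ->] := @orthD k; rewrite ?eqxx // -xl ltnS.
  have rk' : reg k' by apply/reg_lt/lt_l.
  by have [|-> ->] := chis_reg_far rk rk'; rewrite ?kk' ?eqxx.
have ijy : (i < j <= y)%N by rewrite ij jy.
have RD' := rootword_descent (ltnW (ltn_ord x)) mids perm2 regx nbrx orthx ijy yx.
rewrite RD SD in RD'.
have -> : (s - r)^-1 / (r * s) / (r * s) ^+ (x - j) =
    (s - r)^-1 / (r * s) / (r * s) / (r * s) ^+ (y - j).
  by have -> : (x - j)%N = (y - j).+1;
    [rewrite -(subSn jy) /= px|rewrite exprS (invfM (r * s)) !mulrA].
exact: RD' base.
Qed.

End TypeD.
End LastLetter.

(** * From words to roots *)

Section RootVectorPairing.
Variable ell : 'rV[int]_n -> word n.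
Hypothesis hell : inverse_wt r s t ell.

Let pr (v : 'rV[int]_n) := B (fvec r s t g ell v) (evec r s t g ell v).

(** As [ell] inverts the weight on dominant Lyndon words, one such word of the right weight
    identifies the root vectors. *)
Let pair_word u : dominant r s t u -> lyndon u -> pr (wt u) = B (fw u) (ew u).
Proof. by move=> du lu; have [_ e] := hell.1 u (conj du lu); rewrite /pr /fvec /evec e. Qed.

Let pair_rootword (w w' : seq nat) N (v : 'rV[int]_n) : rootword (ordword w) (ordword w') N ->
    (ordword w' != ordword w -> wordlt (ordword w') (ordword w)) ->
    headmin (ordword w) -> all (gtn n) w ->
  v = \sum_(k <- w) alpha n k.+1 -> pr v = N.
Proof.
move=> Rw ww' hw wn ->; rewrite -wt_ordword // -(rootword_pair Rw).
by apply: pair_word (rootword_dominant Rw ww') (headmin_lyndon hw).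
Qed.

Let pair_rootword1 (w : seq nat) N (v : 'rV[int]_n) : rootword (ordword w) (ordword w) N ->
    headmin (ordword w) -> all (gtn n) w -> v = \sum_(k <- w) alpha n k.+1 -> pr v = N.
Proof. by move=> Rw; apply: (pair_rootword Rw); rewrite eqxx. Qed.

Let all_iota (i k : nat) : (k <= n)%N -> all (gtn n) (index_iota i k).
Proof.
move=> kn; apply/allP => z; rewrite mem_index_iota => /andP[_ zk]; exact: leq_trans kn.
Qed.

Let headmin_iota1 (i : 'I_n) (k : nat) : (i < k)%N -> headmin (ordword (index_iota i k)).
Proof. by move=> ik; have := @headmin_iota i k [::] ik; rewrite cats0; apply. Qed.

Let gammarE (i k : nat) : gammar n i.+1 k = \sum_(z <- index_iota i k) alpha n z.+1.
Proof. by rewrite /gammar big_add1. Qed.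

Lemma pair_gamma (i k : 'I_n) : (i <= k)%N -> reg k -> pr (gammar n i.+1 k.+1) = (S - R)^-1.
Proof.
move=> ik rk; apply: (pair_rootword1 (rootword_gamma ik rk)); last exact: gammarE.
  exact: headmin_iota1.
exact: all_iota.
Qed.

Let sum_rev (w : seq nat) : \sum_(k <- rev w) alpha n k.+1 = \sum_(k <- w) alpha n k.+1.
Proof. by apply: perm_big; rewrite perm_rev. Qed.

Let sum_iota2 (i j k : nat) : (i <= j <= k)%N ->
  \sum_(i.+1 <= z < j.+1) alpha n z + \sum_(j.+1 <= z < k.+1) alpha n z *+ 2 =
  \sum_(z <- index_iota i k) alpha n z.+1 + \sum_(z <- rev (index_iota j k)) alpha n z.+1.
Proof.
move=> ijk; rewrite sum_rev (cat_iota ijk) big_cat /= !big_add1 /= -addrA; congr (_ + _).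
by rewrite sumrMnl mulr2n.
Qed.

Variable l : 'I_n.
Hypothesis ln : l.+1 = n.

Let all_rev_iota (j k : nat) : (k <= n)%N -> all (gtn n) (rev (index_iota j k)).
Proof. by rewrite all_rev; apply: all_iota. Qed.

Lemma pair_gammaB (i : 'I_n) : t = TypeB -> pr (gammar n i.+1 n) = (s - r)^-1.
Proof.
move=> et; apply: (pair_rootword1 (rootword_gammaB ln et i)); last exact: gammarE.
  exact: headmin_iota1.
exact: all_iota.
Qed.

Lemma pair_betaB (i j : 'I_n) : t = TypeB -> (i < j <= l)%N ->
  pr (betar t n i.+1 j.+1) =
    qint r s 2 ^+ 2 / (s ^+ 2 - r ^+ 2) / (r ^+ 2 * s ^+ 2) ^+ (l - j).
Proof.
move=> et ijl; have /andP[ij jl] := ijl.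
apply: (pair_rootword1 (rootword_betaB ln et ijl)).
- apply: headmin_iota => // z; rewrite mem_rev mem_index_iota => /andP[jz _].
  exact: leq_trans jz.
- by rewrite all_cat all_iota ?all_rev_iota.
- by rewrite /betar et big_cat /= -sum_iota2 // (ltnW ij) ltnW.
Qed.

Lemma pair_gammaC (i : 'I_n) : t = TypeC -> (i < l)%N -> pr (gammar n i.+1 n) = (s - r)^-1.
Proof.
move=> et il; apply: (pair_rootword1 (rootword_gammaC ln et il)); last exact: gammarE.
  exact: headmin_iota1.
exact: all_iota.
Qed.

Lemma pair_gammaCn : t = TypeC -> pr (gammar n n n) = (s ^+ 2 - r ^+ 2)^-1.
Proof.
move=> et; apply: (pair_rootword1 (rootword_gammaCn ln et)).
- exact: headmin_ordword.
- by rewrite /= ltn_ord.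
- by rewrite big_seq1 ln /gammar big_nat1.
Qed.

Lemma pair_betaCii (i : 'I_n) : t = TypeC -> (i < l)%N ->
  pr (betar t n i.+1 i.+1) = qint r s 2 ^+ 2 / (s ^+ 2 - r ^+ 2).
Proof.
move=> et il; have ln' : (l <= n)%N := ltnW (ltn_ord l).
rewrite -(pair_square_word ln et il)
  -(pair_word (dominant_betaCii ln et il) (lyndon_betaCii ln et il)).
congr pr; rewrite wt_ordword ?all_cat ?all_iota //= ?ltn_ord // !big_cat /= big_seq1 ln addrA.
rewrite /betar et; congr (_ + _).
by have := @sum_iota2 i i l; rewrite leqnn (ltnW il) sum_rev ln; apply.
Qed.

Lemma pair_betaC (i j : 'I_n) : t = TypeC -> (i < j < l)%N ->
  pr (betar t n i.+1 j.+1) = (s - r)^-1 / (r * s) ^+ (l - j).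
Proof.
move=> et ijl; have /andP[ij jl] := ijl; have ln' : (l <= n)%N := ltnW (ltn_ord l).
apply: (pair_rootword1 (rootword_betaC ln et ijl)).
- apply: headmin_iota => [|z]; first exact: ltn_trans jl.
  rewrite inE mem_rev mem_index_iota => /orP[/eqP->|/andP[jz _]]; first exact: ltn_trans jl.
  exact: leq_trans jz.
- by rewrite all_cat all_iota //= ltn_ord all_rev_iota.
- rewrite /betar et !big_cat /= big_seq1 ln addrCA addrC -sum_iota2 ?(ltnW ij) ?(ltnW jl) //.
  by rewrite ln.
Qed.

Hypothesis n2 : (1 < n)%N.

Let l1n : (l.-1 <= n)%N. Proof. by move: (ltn_ord l); clear; lia. Qed.
Let nl1 : n.-1 = l. Proof. by rewrite -[in LHS]ln. Qed.
Let l10 : (l.-1.+1 = l)%N. Proof. by rewrite prednK // -ltnS ln. Qed.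

Lemma pair_betaDn (i : 'I_n) : t = TypeD -> (i < l)%N ->
  pr (betar t n i.+1 n) = (s - r)^-1.
Proof.
move=> et il; apply: (pair_rootword1 (rootword_betaDn ln et n2 il)).
- move: (il); rewrite -l10 ltnS leq_eqVlt => /orP[/eqP<-|il1].
    by rewrite /index_iota subnn; apply: headmin_ordword.
  by apply: headmin_iota => // z; rewrite inE => /eqP->.
- by rewrite all_cat all_iota //= ltn_ord.
- by rewrite /betar et eqxx big_cat /= big_seq1 ln big_add1 nl1.
Qed.

Let wordlt_fork (i : nat) (w : seq nat) :
  wordlt (ordword (index_iota i l.-1 ++ [:: l.-1; val l] ++ w))
         (ordword (index_iota i l.-1 ++ [:: val l; l.-1] ++ w)).
Proof.
have l1 : (l.-1 < n)%N by rewrite l10 ltnW.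
rewrite !ordword_cat wordlt_cat -[[:: l.-1; _]]/[:: val (Ordinal l1); val l].
rewrite -[[:: _; l.-1]]/[:: val l; val (Ordinal l1)] !ordword_cons wordlt_cons /=.
by rewrite l10 leqnn.
Qed.

Let headmin_fork (i : 'I_n) (w : seq nat) : (i < l.-1)%N -> (forall z, z \in w -> (i < z)%N) ->
  headmin (ordword (index_iota i l.-1 ++ [:: val l; l.-1] ++ w)).
Proof.
move=> il iw; apply: headmin_iota => // z; rewrite !inE => /or3P[/eqP->|/eqP->|/iw]//.
exact: leq_trans il (leq_pred _).
Qed.

Lemma pair_betaDn1 (i : 'I_n) : t = TypeD -> (i < l.-1)%N ->
  pr (betar t n i.+1 l) = (s - r)^-1 / (r * s).
Proof.
move=> et il; apply: (pair_rootword (rootword_betaDn1 ln et n2 il)).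
- by move=> _; apply: (wordlt_fork _ [::]).
- by apply: (headmin_fork il) => z.
- by rewrite all_cat all_iota //= ltn_ord l10 ltnW.
- rewrite /betar et [_ == n]ltn_eqF // nl1 eqxx big_cat /= big_cons big_seq1 l10 ln.
  have il' : (i < l)%N := leq_trans il (leq_pred _).
  rewrite (@big_cat_nat _ _ _ l) //=; last by rewrite leqW // ltnW.
  by rewrite big_add1 [X in _ + X]big_ltn ?ln ?big_nat1 1?[alpha n l + _]addrC // leqW.
Qed.

Lemma pair_betaD (i : 'I_n) (j : nat) : t = TypeD -> (i < j)%N -> (j < l.-1)%N ->
  pr (betar t n i.+1 j.+1) = (s - r)^-1 / (r * s) / (r * s) ^+ (l.-1 - j).
Proof.
move=> et ij jl; apply: (pair_rootword (rootword_betaD ln et n2 ij jl)).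
- by move=> _; apply: wordlt_fork.
- apply: headmin_fork => [|z]; first exact: ltn_trans jl.
  by rewrite mem_rev mem_index_iota => /andP[jz _]; exact: leq_trans jz.
- by rewrite !all_cat all_iota //= ltn_ord l10 ltnW // all_rev_iota.
- rewrite /betar et [_ == n]ltn_eqF; last by rewrite -ln ltnS (leq_trans jl) ?leq_pred.
  rewrite nl1 [j.+1 == _]ltn_eqF; last by rewrite -l10.
  have e := @sum_iota2 i j l.-1; rewrite l10 (ltnW ij) (ltnW jl) in e.
  rewrite !big_cat /= !big_cons big_nil addr0 l10 ln e // -!addrA; congr (_ + _).
  by rewrite addrA addrC; congr (_ + _); rewrite addrC.
Qed.

End RootVectorPairing.
End HopfPairing.

(** * Nonvanishing conditions and the field C(r, s) *)

(** The value is (r/s)^d with d equal to 1 or 2, and r differs from s and from -s. *)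
Lemma chis_diag_neq1 (K : fieldType) (r s : K) t n (j : 'I_n) : r != 0 -> s != 0 ->
  r != s -> r + s != 0 -> ((if t is TypeD then 2 else 1) <= n)%N -> chis r s t j j != 1.
Proof.
move=> r0 s0 rs rs' hn; rewrite chisE.
have [d -> d12] : exists2 d, simple_form t n j.+1 j.+1 = d & d = 1 \/ d = 2.
  exists (simple_form t n j.+1 j.+1) => //; have jn := ltn_ord j.
  have [rj|rj] := boolP (regular t n j.+1).
    by rewrite simple_form_reg // eqxx; case: (t); [left|right|left|left].
  have {rj} jE : t <> TypeA /\ j.+1 = n by move: rj jn; rewrite /regular;
    case: (t) => /= rj jn; split=> //; move: rj jn; clear; lia.
  case: jE => tA ->; move: hn tA; case: (t) => // hn _.
  - by left; apply: simple_form_lastBB.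
  - by right; apply: simple_form_lastCC.
  - by left; apply: simple_form_lastDD.
case: d12 => ->; rewrite /rspow -exprnN -exprnP -subr_eq0.
  by rewrite !expr1 -(divff s0) -mulrBl mulf_neq0 ?invr_eq0 // subr_eq0.
rewrite -(@divff _ (s ^+ 2)) ?expf_neq0 // -mulrBl mulf_neq0 ?invr_eq0 ?expf_neq0 //.
by rewrite subr_sqr mulf_neq0 // subr_eq0.
Qed.

Lemma exprz_subn (K : fieldType) (a : K) (j m : nat) : (j <= m)%N ->
  a ^ (j%:Z - m%:Z) = (a ^+ (m - j))^-1.
Proof. by move=> jm; rewrite -opprB subzn // exprnN. Qed.

Section RationalFunctions.
Variable R : realType.

Lemma varr_neq0 : varr R != 0.
Proof. by rewrite /varr tofrac_eq0 polyC_eq0 polyX_eq0. Qed.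

Lemma vars_neq0 : vars R != 0.
Proof. by rewrite /vars tofrac_eq0 polyX_eq0. Qed.

Lemma varr_neq_vars : varr R != vars R.
Proof.
rewrite /varr /vars tofrac_eq; apply/eqP => /(congr1 (fun p : {poly {poly _}} => size p)).
by rewrite size_polyX size_polyC polyX_eq0.
Qed.

Lemma varrDvars_neq0 : varr R + vars R != 0.
Proof.
rewrite /varr /vars -tofracD tofrac_eq0 addrC.
apply/eqP => /(congr1 (fun p : {poly {poly _}} => size p)).
by rewrite size_XaddC size_poly0.
Qed.

End RationalFunctions.

Theorem theorem7p2 (R : realType) (t : cltype) (n : nat)
  (hn : ((if t is TypeD then 2 else 1) <= n)%N)
  (Delta : {lrmorphism Uq (varr R) (vars R) t n ->
                       tensor2 (Uq (varr R) (vars R) t n)})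
  (hDelta : coproduct (Ugens (varr R) (vars R) t n) Delta)
  (B : Uq (varr R) (vars R) t n -> Uq (varr R) (vars R) t n -> Crs R)
  (hB : hopf_pairing (varr R) (vars R) t (Ugens (varr R) (vars R) t n) Delta B)
  (ell : 'rV[int]_n -> word n)
  (hell : inverse_wt (varr R) (vars R) t ell) :
  let r := varr R in
  let s := vars R in
  let g := Ugens r s t n in
  let pair (v : 'rV[int]_n) := B (fvec r s t g ell v) (evec r s t g ell v) in
  let gamma i j := gammar n i j in
  let beta i j := betar t n i j in
  match t with
  | TypeA =>
      forall i j, (1 <= i <= j)%N -> (j <= n)%N ->
        pair (gamma i j) = 1 / (s - r)
  | TypeB =>
      [/\ forall i j, (1 <= i <= j)%N -> (j < n)%N ->
            pair (gamma i j) = 1 / (s ^+ 2 - r ^+ 2),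
          forall i, (1 <= i <= n)%N ->
            pair (gamma i n) = 1 / (s - r)
        & forall i j, (1 <= i < j)%N -> (j <= n)%N ->
            pair (beta i j) =
              qint r s 2 ^+ 2 * (r * s) ^ (2 * (j%:Z - n%:Z))
                / (s ^+ 2 - r ^+ 2)]
  | TypeC =>
      [/\ forall i j, (1 <= i <= j)%N -> (j <= n)%N -> (i, j) <> (n, n) ->
            pair (gamma i j) = 1 / (s - r),
          pair (gamma n n) = 1 / (s ^+ 2 - r ^+ 2),
          forall i, (1 <= i < n)%N ->
            pair (beta i i) = qint r s 2 ^+ 2 / (s ^+ 2 - r ^+ 2)
        & forall i j, (1 <= i < j)%N -> (j < n)%N ->
            pair (beta i j) = (r * s) ^ (j%:Z - n%:Z) / (s - r)]
  | TypeD =>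
      (forall i j, (1 <= i <= j)%N -> (j < n)%N ->
         pair (gamma i j) = 1 / (s - r)) /\
      (forall i j, (1 <= i < j)%N -> (j <= n)%N ->
         pair (beta i j) = (r * s) ^ (j%:Z - n%:Z) / (s - r))
  end.
Proof.
move=> r s g pair gamma beta.
have r0 : r != 0 := varr_neq0 R; have s0 : s != 0 := vars_neq0 R.
have rs : r != s := varr_neq_vars R; have rs' : r + s != 0 := varrDvars_neq0 R.
have cd (j : 'I_n) : chis r s t j j != 1 := chis_diag_neq1 j r0 s0 rs rs' hn.
have n0 : (0 < n)%N by apply: leq_trans hn; case: (t).
have [l ln] : exists l : 'I_n, l.+1 = n.
  by have nn : (n.-1 < n)%N; [rewrite prednK|exists (Ordinal nn); rewrite /= prednK].
have ordP k : (0 < k <= n)%N -> exists i : 'I_n, k = i.+1.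
  by case: k => // k /= kn; exists (Ordinal kn).
have Hrel := @Uq_rel _ r s t n.
have eg (i k : 'I_n) : (i <= k)%N -> regular t n k.+1 -> pair (gamma i.+1 k.+1) =
    (s ^ (if t is TypeB then 2 else 1) - r ^ (if t is TypeB then 2 else 1))^-1.
  exact: (pair_gamma r0 s0 Hrel hDelta hB cd rs rs' hell).
have egB (i : 'I_n) : t = TypeB -> pair (gamma i.+1 n) = (s - r)^-1.
  exact: (pair_gammaB r0 s0 Hrel hDelta hB cd rs rs' hell ln).
have ebB (i j : 'I_n) : t = TypeB -> (i < j <= l)%N -> pair (beta i.+1 j.+1) =
    qint r s 2 ^+ 2 / (s ^+ 2 - r ^+ 2) / (r ^+ 2 * s ^+ 2) ^+ (l - j).
  exact: (pair_betaB r0 s0 Hrel hDelta hB cd rs rs' hell ln).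
have egC (i : 'I_n) : t = TypeC -> (i < l)%N -> pair (gamma i.+1 n) = (s - r)^-1.
  exact: (pair_gammaC r0 s0 Hrel hDelta hB cd rs rs' hell ln).
have egCn : t = TypeC -> pair (gamma n n) = (s ^+ 2 - r ^+ 2)^-1.
  exact: (pair_gammaCn r0 s0 Hrel hDelta hB cd hell ln).
have ebCi (i : 'I_n) : t = TypeC -> (i < l)%N ->
    pair (beta i.+1 i.+1) = qint r s 2 ^+ 2 / (s ^+ 2 - r ^+ 2).
  exact: (pair_betaCii r0 s0 Hrel hDelta hB cd rs rs' hell ln).
have ebC (i j : 'I_n) : t = TypeC -> (i < j < l)%N ->
    pair (beta i.+1 j.+1) = (s - r)^-1 / (r * s) ^+ (l - j).
  exact: (pair_betaC r0 s0 Hrel hDelta hB cd rs rs' hell ln).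
have ebDn (i : 'I_n) : (1 < n)%N -> t = TypeD -> (i < l)%N -> pair (beta i.+1 n) = (s - r)^-1.
  by move=> n2; apply: (pair_betaDn r0 s0 Hrel hDelta hB cd rs rs' hell ln n2).
have ebDn1 (i : 'I_n) : (1 < n)%N -> t = TypeD -> (i < l.-1)%N ->
    pair (beta i.+1 l) = (s - r)^-1 / (r * s).
  by move=> n2; apply: (pair_betaDn1 r0 s0 Hrel hDelta hB cd rs rs' hell ln n2).
have ebD (i : 'I_n) (j : nat) : (1 < n)%N -> t = TypeD -> (i < j)%N -> (j < l.-1)%N ->
    pair (beta i.+1 j.+1) = (s - r)^-1 / (r * s) / (r * s) ^+ (l.-1 - j).
  by move=> n2; apply: (pair_betaD r0 s0 Hrel hDelta hB cd rs rs' hell ln n2).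
have pwz (j : 'I_n) : (r * s) ^ (j.+1%:Z - n%:Z) = ((r * s) ^+ (l - j))^-1.
  by rewrite exprz_subn // -(subSS j) ln.
have gammaP i j : (0 < i <= j)%N -> (if t is TypeA then j <= n else j < n)%N ->
    exists i' j' : 'I_n, [/\ i = i'.+1, j = j'.+1, (i' <= j')%N & regular t n j'.+1].
  move=> /andP[i1 ij] jn; have j1 := leq_trans i1 ij.
  have jn' : (j <= n)%N by move: jn; case: (t) => // /ltnW.
  have [|i' ei] := ordP i; first by rewrite i1 (leq_trans ij).
  have [|j' ej] := ordP j; first by rewrite j1.
  by exists i', j'; split=> //; [rewrite -ltnS -ei -ej|rewrite -ej /regular j1].
have betaP i j : (0 < i < j)%N -> (j <= n)%N ->
    exists i' j' : 'I_n, [/\ i = i'.+1, j = j'.+1 & (i' < j' <= l)%N].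
  move=> /andP[i1 ij] jn.
  have [|i' ei] := ordP i; first by rewrite i1 (leq_trans (ltnW ij)).
  have [|j' ej] := ordP j; first by rewrite jn (leq_trans i1 (ltnW ij)).
  by exists i', j'; split=> //; rewrite -ltnS -ei -ej ij -ltnS ln ltn_ord.
(* Only identities between scalars remain; the objects whose types depend on t are dropped to allow
   the case analysis on t. *)
clearbody pair; clear hB hDelta hell cd Hrel B Delta ell g.
rewrite {}/gamma {}/beta in eg egB ebB egC egCn ebCi ebC ebDn ebDn1 ebD *.
move: hn eg egB ebB egC egCn ebCi ebC ebDn ebDn1 ebD gammaP.
case: t => hn eg egB ebB egC egCn ebCi ebC ebDn ebDn1 ebD gammaP.
- move=> i j ij jn; have [i' [j' [-> -> ij' rj]]] := gammaP i j ij jn.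
  by rewrite (eg _ _ ij' rj) !expr1z div1r.
- split=> [i j ij jn|i i_n|i j ij jn].
  + have [i' [j' [-> -> ij' rj]]] := gammaP i j ij jn.
    by rewrite (eg _ _ ij' rj) div1r.
  + by have [i' ->] := ordP i i_n; rewrite egB // div1r.
  + have [i' [j' [-> -> ij']]] := betaP i j ij jn.
    rewrite (ebB _ _ erefl ij') mulrAC; congr (_ * _ / _).
    rewrite [2 * _]mulrC -exprz_exp pwz -[LHS]/(_^-1) -exprMn.
    by rewrite -exprnP exprVn -exprM mulnC exprM.
- split=> [i j ij jn nn||i i_n|i j ij jn].
  + have [jn'|nj] := ltnP j n.
      have [i' [j' [-> -> ij' rj]]] := gammaP i j ij jn'.
      by rewrite (eg _ _ ij' rj) !expr1z div1r.
    have {jn nj} ej : j = n by apply/eqP; rewrite eqn_leq jn.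
    rewrite {}ej in ij nn *; have [i' ei] := ordP i ij; rewrite ei egC ?div1r //.
    rewrite -ltnS ln -ei ltn_neqAle; case/andP: ij => _ ->; rewrite andbT.
    by apply/eqP => e; apply: nn; rewrite e.
  + by rewrite egCn // div1r.
  + have [|i' ei] := ordP i; first by case/andP: i_n => -> /ltnW.
    by rewrite ei ebCi // -ltnS ln -ei; case/andP: i_n.
  + have [i' [j' [-> ej /andP[ij' _]]]] := betaP i j ij (ltnW jn).
    by rewrite ej ebC ?pwz 1?mulrC // ij' -ltnS ln -ej.
- split=> i j ij jn.
    have [i' [j' [-> -> ij' rj]]] := gammaP i j ij jn.
    by rewrite (eg _ _ ij' rj) !expr1z div1r.
  have [i' [j' [-> -> /andP[ij' jl]]]] := betaP i j ij jn.
  (* The cases j = n, j = n-1 and j < n-1 correspond to the three shapes of beta_ij in type D. *)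
  rewrite pwz; move: jl; rewrite leq_eqVlt => /orP[/eqP jl|jl].
    by rewrite jl subnn expr0 invr1 mul1r ln ebDn // -jl.
  have l0 : l.-1.+1 = l by apply: ltn_predK jl.
  move: jl; rewrite -l0 ltnS leq_eqVlt => /orP[/eqP jl|jl].
    by rewrite jl subSnn l0 ebDn1 // -?jl // mulrC.
  by rewrite subSn 1?ltnW // ebD // exprS (invfM (r * s)) [RHS]mulrC !mulrA.
Qed.
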